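(* Let $s\geq 1$ be an integer. Let $V:\mathbb{R}\to\mathbb{R}$ be a real valued potential such that $V\in L^\infty(\mathbb{R})$, such that for every $j=1,\dots,s$ there is a constant $C_j>0$ with $$|\partial_x^j V(x)|\leq C_j (1+|x|)^{-1}\quad\text{for all } x\in\mathbb{R},$$ and such that $-\partial_x^2-V\geq 0$ in the operator sense on $L^2(\mathbb{R})$. Then for every $f\in\Sigma_s(\mathbb{R})$ there exists a constant $C>0$ (independent of $t$) such that $$\|e^{it(\partial_x^2+V)}f\|_{\Sigma_s(\mathbb{R})}^2\leq C\,\langle t\rangle^{2s}\quad\text{for all } t\in\mathbb{R}.$$ In particular, $e^{it(\partial_x^2+V)}f\in\Sigma_s(\mathbb{R})$ for every $t\in\mathbb{R}$.
   Context: For an integer $s\ge 1$, $\Sigma_s(\mathbb{R})$ is the space of (complex valued) functions with finite norm $\|f\|_{\Sigma_s(\mathbb{R})}^2=\|f\|_{H^s(\mathbb{R})}^2+\int_{\mathbb{R}}x^{2s}|f(x)|^2\,dx$, where $H^s(\mathbb{R})$ is the classical Sobolev space. $\langle t\rangle=(1+t^2)^{1/2}$. $e^{it(\partial_x^2+V)}$ is the unitary group on $L^2(\mathbb{R})$ generated by the self-adjoint operator $\partial_x^2+V$ (with domain $H^2(\mathbb{R})$), i.e. $u(t)=e^{it(\partial_x^2+V)}f$ solves $(i\partial_t+\partial_x^2+V(x))u=0$, $u(0)=f$. *)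

(* Defs.v *)
From HB Require Import structures.
From mathcomp Require Import all_boot all_order all_algebra.
From mathcomp Require Import complex.
From mathcomp Require Import all_classical all_reals all_analysis.

Set Implicit Arguments.
Unset Strict Implicit.
Unset Printing Implicit Defensive.

Import Order.TTheory GRing.Theory Num.Theory.
Import numFieldNormedType.Exports.

Local Open Scope classical_set_scope.
Local Open Scope ring_scope.

(* Elements of L^2(R; C) and of its subspaces are represented by functions
   R -> R[i]; equality in L^2 is equality almost everywhere. *)
Section L2.
Context {R : realType}.
Local Notation mu := (@lebesgue_measure R).
Implicit Types (f g : R -> R[i]) (x : R).

Definition L2norm2 f : \bar R := (\int[mu]_x (Normc.normc (f x) ^+ 2)%:E)%E.

Definition inL2 f : Prop :=
  [/\ measurable_fun setT (fun x => complex.Re (f x)),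
      measurable_fun setT (fun x => complex.Im (f x))
    & (L2norm2 f < +oo)%E].

Definition cintegral f : R[i] :=
  Complex (Rintegral mu setT (fun x => complex.Re (f x)))
          (Rintegral mu setT (fun x => complex.Im (f x))).

Definition L2dot f g : R[i] := cintegral (fun x => f x * conjc (g x)).

End L2.

Section Sobolev.
Context {R : realType}.
Local Notation mu := (@lebesgue_measure R).
Implicit Types (f g : R -> R[i]) (x : R).

Definition test_function (phi : R -> R) : Prop :=
  (forall n x, derivable (derive1n n phi) x 1) /\
  (exists M : R, forall x, M < `|x| -> phi x = 0).

(* Both functions are required to be in L^2, so that the integrals below
   converge; this is all that is needed for the spaces H^s. *)
Definition is_weak_derivative (n : nat) f g : Prop :=
  [/\ inL2 f, inL2 g
    & forall phi : R -> R, test_function phi ->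
        cintegral (fun x => f x * real_complex R (derive1n n phi x)) =
        (-1) ^+ n * cintegral (fun x => g x * real_complex R (phi x))].

(* Determined by f up to a null set when it exists, 0 otherwise; it is only
   used under the assumption that it exists. *)
Definition weak_derivative (n : nat) f : R -> R[i] :=
  xget (fun=> 0) [set g | is_weak_derivative n f g].

Definition inH (s : nat) f : Prop :=
  inL2 f /\ forall n, (n <= s)%N -> exists g, is_weak_derivative n f g.

(* This and Sigma_norm2 are meaningful only for f in H^s. *)
Definition Hnorm2 (s : nat) f : \bar R :=
  (\sum_(n < s.+1) L2norm2 (weak_derivative n f))%E.

Definition Sigma_norm2 (s : nat) f : \bar R :=
  (Hnorm2 s f +
   \int[mu]_x (x ^+ (2 * s) * Normc.normc (f x) ^+ 2)%:E)%E.

Definition inSigma (s : nat) f : Prop :=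
  inH s f /\ (Sigma_norm2 s f < +oo)%E.

End Sobolev.

Section Schrodinger.
Context {R : realType}.
Local Notation mu := (@lebesgue_measure R).
Implicit Types (f g : R -> R[i]) (V : R -> R).

(* The operator d^2/dx^2 + V, with domain H^2. *)
Definition schrodinger V f : R -> R[i] :=
  fun x => weak_derivative 2 f x + real_complex R (V x) * f x.

Definition schrodinger_nonpos V : Prop :=
  forall f, inH 2 f -> 0 <= L2dot (fun x => - schrodinger V f x) f.

Definition unitary_group (U : R -> (R -> R[i]) -> (R -> R[i])) : Prop :=
  [/\ forall t f, inL2 f -> inL2 (U t f),
      forall t (a : R[i]) f g, inL2 f -> inL2 g ->
        U t (fun x => a * f x + g x) = (fun x => a * U t f x + U t g x) %[ae mu],
      forall t f g, inL2 f -> inL2 g -> L2dot (U t f) (U t g) = L2dot f g,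
      (forall f, inL2 f -> U 0 f = f %[ae mu]) /\
      (forall t1 t2 f, inL2 f -> U (t1 + t2) f = U t1 (U t2 f) %[ae mu])
    & forall f, inL2 f ->
        L2norm2 (fun x => U t f x - f x) @[t --> (0 : R)] --> 0%E].

(* g = i A f, where i A is the infinitesimal generator of U = e^{itA}, that is
   the L^2 derivative of U at 0, defined exactly where that derivative exists;
   it is required to be i (d^2/dx^2 + V) with domain H^2. *)
Definition generated_by_schrodinger V (U : R -> (R -> R[i]) -> (R -> R[i])) : Prop :=
  unitary_group U /\
  forall f g, inL2 f -> inL2 g ->
    (L2norm2 (fun x => real_complex R h^-1 * (U h f x - f x) - g x)
       @[h --> (0 : R)^'] --> 0%E) <->
    (inH 2 f /\ g = (fun x => Complex 0 1 * schrodinger V f x) %[ae mu]).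

Definition japanese_bracket (t : R) : R := Num.sqrt (1 + t ^+ 2).

End Schrodinger.

(* Main.v *)
(* Since U t commutes with the generator, the H^s norm of u(t) = U t f is bounded
   uniformly in t: this is conservation of the L^2 norm for s = 0, conservation of
   the energy for s = 1 (after regularising f), and the equation exchanges two
   space derivatives for one application of the generator.  For the moments, take
   the bounded weights p_d(x) = (1+x^2)/(1+d x^2), which satisfy p_d'^2 <= 4 p_d,
   and put A_k = int p_d^k |u^(m-k)|^2.  Integrating by parts,
     A_(k+1) <= eta A_(k+2) + A_k / eta + C int p_d^k |u^(m-2-k)|^2,
   where the last term is controlled by the case m-2 of the induction on m and A_0
   by the H^s norm.  Normalising A_k by (1+|t|)^(2k), the chain gives
     A_(m-1) <= (1+|t|)^(2m-2) (e A_m / (1+|t|)^(2m) + C)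
   for every e > 0, while |A_m'| <= theta A_m + (C/theta) A_(m-1); taking theta of
   the order of 1/(1+|t|) and e small yields
     |A_m'| <= A_m / (1+|t|) + C (1+|t|)^(2m-1),
   hence A_m = O((1+|t|)^(2m)) uniformly in d, and d tends to 0 by Fatou. *)
Require Import Defs.
From HB Require Import structures.
From mathcomp Require Import all_boot all_order all_algebra.
From mathcomp Require Import complex.
From mathcomp Require Import all_classical all_reals all_analysis.
From mathcomp Require Import measurable_realfun ess_sup_inf.
From mathcomp Require Import ring lra.

Set Implicit Arguments.
Unset Strict Implicit.
Unset Printing Implicit Defensive.

Import Order.TTheory GRing.Theory Num.Theory.
Import numFieldNormedType.Exports.

Local Open Scope classical_set_scope.
Local Open Scope ring_scope.

(** The group is known only through its generator, so no formula for $u(t)$ is at hand and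
    identities hold almost everywhere. Derivatives are therefore carried as finite chains of real
    functions, one for the real and one for the imaginary part, in which every entry but the last is
    an indefinite integral of the next; integration by parts on the whole line is exact on such
    chains. Differentiating a weighted mass in $t$ requires $u(t)$ in the domain $H^2$. This makes
    $m = 1$ a base case of its own: there $f$ is replaced by $H^2$ data at squared distance at most
    $d$, and since $p_d \le 1/d$ the weighted error stays below a constant. Everywhere else the
    bound $1/d$ only makes integrals finite and enters no estimate. The remainder of one
    interpolation has its total order, powers of the weight plus derivatives, lowered by 2; hence
    the base cases 0 and 1. The choice $\theta = 1/(2(1+|t|))$, $e = 1/(16m^2)$ makes the two terms
    in the bound of $A_m'$ contribute half of $A_m/(1+|t|)$ each. *)

(** * Square integrable real functions *)

Section RealIntegrable.
Context {R : realType}.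
Notation mu := (@lebesgue_measure R).
Implicit Types (D : set R) (u v w : R -> R).

Lemma aeS (P Q : R -> Prop) : (forall x, P x -> Q x) ->
  (\forall x \ae mu, P x) -> \forall x \ae mu, Q x.
Proof.
move=> PQ; exact: (@filterS _ _ (ae_filter_ringOfSetsType mu) P Q PQ).
Qed.

Lemma aeS2 (P Q S : R -> Prop) : (forall x, P x -> Q x -> S x) ->
  (\forall x \ae mu, P x) -> (\forall x \ae mu, Q x) ->
  \forall x \ae mu, S x.
Proof.
move=> PQS; exact: (@filterS2 _ _ (ae_filter_ringOfSetsType mu) P Q S PQS).
Qed.

Lemma aeT (P : R -> Prop) : (forall x, P x) -> \forall x \ae mu, P x.
Proof. by move=> h; exact: (@aeW _ _ _ mu). Qed.

Lemma itgD D u v : measurable D -> mu.-integrable D (EFin \o u) ->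
  mu.-integrable D (EFin \o v) ->
  mu.-integrable D (EFin \o (fun x => u x + v x)).
Proof. by move=> mD iu iv; exact: (@integrableD _ _ _ mu D mD _ _ iu iv). Qed.

Lemma itgB D u v : measurable D -> mu.-integrable D (EFin \o u) ->
  mu.-integrable D (EFin \o v) ->
  mu.-integrable D (EFin \o (fun x => u x - v x)).
Proof. by move=> mD iu iv; exact: (@integrableB _ _ _ mu D mD _ _ iu iv). Qed.

Lemma itgZ D k u : measurable D -> mu.-integrable D (EFin \o u) ->
  mu.-integrable D (EFin \o (fun x => k * u x)).
Proof. by move=> mD iu; exact: (@integrableZl _ _ _ mu D mD k _ iu). Qed.

Lemma itgN D u : measurable D -> mu.-integrable D (EFin \o u) ->
  mu.-integrable D (EFin \o (fun x => - u x)).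
Proof. by move=> mD iu; exact: (integrableN iu). Qed.

Lemma itg_meas D u : mu.-integrable D (EFin \o u) -> measurable_fun D u.
Proof. by move=> /measurable_int /measurable_EFinP. Qed.

Lemma itg_le D u v : measurable D -> measurable_fun D u ->
  (forall x, D x -> `|u x| <= v x) -> mu.-integrable D (EFin \o v) ->
  mu.-integrable D (EFin \o u).
Proof.
move=> mD mu_ uv iv; apply: (@le_integrable _ _ _ mu D mD _ _ _ _ iv).
  exact/measurable_EFinP.
move=> x Dx /=; rewrite lee_fin (le_trans (uv x Dx))//.
exact: ler_norm.
Qed.

Lemma itg_abs D u : measurable D -> mu.-integrable D (EFin \o u) ->
  mu.-integrable D (EFin \o (fun x => `|u x|)).
Proof. by move=> mD iu; exact: (integrable_norm iu). Qed.

Lemma itg_ge0 D u : (forall x, D x -> 0 <= u x) -> measurable_fun D u ->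
  (mu.-integrable D (EFin \o u) <-> (\int[mu]_(x in D) (u x)%:E < +oo)%E).
Proof.
move=> u0 mu_; split.
  move/integrableP => [_]; congr (_ < _)%E.
  by apply: eq_integral => x /set_mem Dx /=; rewrite ger0_norm ?u0.
move=> h; apply/integrableP; split; first exact/measurable_EFinP.
apply: le_lt_trans h; rewrite le_eqVlt; apply/orP; left; apply/eqP.
by apply: eq_integral => x /set_mem Dx /=; rewrite ger0_norm ?u0.
Qed.

Lemma fineK_itg D u : measurable D -> mu.-integrable D (EFin \o u) ->
  (\int[mu]_(x in D) (u x)%:E)%E = (\int[mu]_(x in D) u x)%:E.
Proof. by move=> mD iu; rewrite /Rintegral fineK//; exact: integrable_fin_num. Qed.

Lemma ae_eq_Rintegral D u v : measurable D -> measurable_fun D u ->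
  measurable_fun D v -> (\forall x \ae mu, u x = v x) ->
  \int[mu]_(x in D) u x = \int[mu]_(x in D) v x.
Proof.
move=> mD mu_ mv uv; rewrite /Rintegral; congr fine.
apply: ae_eq_integral => //; [exact/measurable_EFinP..|].
by apply: aeS uv => x /= -> _.
Qed.

Lemma ae_eq_itg D u v : measurable D ->
  measurable_fun D v -> (\forall x \ae mu, u x = v x) ->
  mu.-integrable D (EFin \o u) -> mu.-integrable D (EFin \o v).
Proof.
move=> mD mv uv iu; have mu_ := itg_meas iu.
move/integrableP : iu => [_ iu]; apply/integrableP; split.
  exact/measurable_EFinP.
suff <- : (\int[mu]_(x in D) `|(EFin \o u) x| = \int[mu]_(x in D) `|(EFin \o v) x|)%E by [].
apply: ae_eq_integral => //.
- by apply/measurable_EFinP; exact: measurableT_comp.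
- by apply/measurable_EFinP; exact: measurableT_comp.
by apply: aeS uv => x /= -> _.
Qed.

Lemma RintegralN D u : measurable D -> mu.-integrable D (EFin \o u) ->
  \int[mu]_(x in D) (- u x) = - \int[mu]_(x in D) u x.
Proof.
move=> mD iu; rewrite -mulN1r -RintegralZl//.
by apply: eq_Rintegral => x _; rewrite mulN1r.
Qed.

Lemma Rint_norm_le D u : measurable D -> mu.-integrable D (EFin \o u) ->
  `|\int[mu]_(x in D) u x| <= \int[mu]_(x in D) `|u x|.
Proof. by move=> mD iu; exact: le_normr_Rintegral. Qed.

(** Measurability is a separate clause because that of [u ^+ 2] does not see the sign of [u]. *)
Definition L2r u := measurable_fun setT u /\
  mu.-integrable setT (EFin \o (fun x => u x ^+ 2)).

(** The squared norm as a real number. It carries information only under [L2r], since a divergent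
    integral has real value 0. *)
Definition n2 u : R := \int[mu]_x (u x ^+ 2).

Lemma L2r_meas u : L2r u -> measurable_fun setT u. Proof. by case. Qed.
Lemma L2r_itg u : L2r u -> mu.-integrable setT (EFin \o (fun x => u x ^+ 2)).
Proof. by case. Qed.

Lemma n2_ge0 u : 0 <= n2 u.
Proof. by apply: Rintegral_ge0 => x _; rewrite sqr_ge0. Qed.

Lemma L2r_le u v : measurable_fun setT u -> (forall x, u x ^+ 2 <= v x) ->
  mu.-integrable setT (EFin \o v) -> L2r u.
Proof.
move=> mu_ uv iv; split => //; apply: itg_le iv => //.
  by apply: measurable_funX.
by move=> x _; rewrite ger0_norm ?sqr_ge0.
Qed.

Lemma L2r_mul u v : L2r u -> L2r v ->
  mu.-integrable setT (EFin \o (fun x => u x * v x)).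
Proof.
move=> [mu_ iu] [mv iv].
apply: (@itg_le _ _ (fun x => u x ^+ 2 + v x ^+ 2)) => //.
- exact: measurable_funM.
- move=> x _; rewrite ler_norml.
  have := sqr_ge0 (u x + v x); have := sqr_ge0 (u x - v x).
  rewrite !expr2; nra.
- exact: itgD.
Qed.

Lemma L2rD u v : L2r u -> L2r v -> L2r (fun x => u x + v x).
Proof.
move=> lu lv; have [mu_ iu] := lu; have [mv iv] := lv.
apply: (@L2r_le _ (fun x => 2 * u x ^+ 2 + 2 * v x ^+ 2)).
- exact: measurable_funD.
- by move=> x; have := sqr_ge0 (u x - v x); rewrite !expr2; nra.
- by apply: itgD => //; exact: itgZ.
Qed.

Lemma L2rM w K u : measurable_fun setT w -> (forall x, `|w x| <= K) ->
  L2r u -> L2r (fun x => w x * u x).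
Proof.
move=> mw wK [mu_ iu].
apply: (@L2r_le _ (fun x => K ^+ 2 * u x ^+ 2)).
- exact: measurable_funM.
- move=> x; rewrite exprMn ler_wpM2r ?sqr_ge0//.
  by rewrite -(real_normK (num_real (w x))) ler_sqr ?nnegrE ?wK//
    (le_trans _ (wK x)).
- exact: itgZ.
Qed.

Lemma L2rZ k u : L2r u -> L2r (fun x => k * u x).
Proof. by apply: (@L2rM (cst k) `|k|) => //. Qed.

Lemma L2rN u : L2r u -> L2r (fun x => - u x).
Proof.
move=> /(L2rZ (-1)); congr L2r; apply/funext => x; exact: mulN1r.
Qed.

Lemma L2rB u v : L2r u -> L2r v -> L2r (fun x => u x - v x).
Proof. by move=> lu /L2rN lv; exact: L2rD. Qed.

Lemma L2r_ae u v : measurable_fun setT v -> (\forall x \ae mu, u x = v x) ->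
  L2r u -> L2r v.
Proof.
move=> mv uv [mu_ iu]; split => //; apply: ae_eq_itg iu => //.
  exact: measurable_funX.
by apply: aeS uv => x /= ->.
Qed.

Lemma n2_ae u v : measurable_fun setT u -> measurable_fun setT v ->
  (\forall x \ae mu, u x = v x) -> n2 u = n2 v.
Proof.
move=> mu_ mv uv; apply: ae_eq_Rintegral => //; [exact: measurable_funX..|].
by apply: aeS uv => x /= ->.
Qed.

Lemma n2_le u v : (forall x, u x ^+ 2 <= v x ^+ 2) -> L2r u -> L2r v ->
  n2 u <= n2 v.
Proof. by move=> uv [_ iu] [_ iv]; apply: le_Rintegral. Qed.

Lemma n2Z k u : L2r u -> n2 (fun x => k * u x) = k ^+ 2 * n2 u.
Proof.
move=> [_ iu]; rewrite /n2 -RintegralZl//.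
by apply: eq_Rintegral => x _; rewrite exprMn.
Qed.

Lemma n2N u : n2 (fun x => - u x) = n2 u.
Proof. by apply: eq_Rintegral => x _; rewrite sqrrN. Qed.

Lemma n2D_le u v : L2r u -> L2r v ->
  n2 (fun x => u x + v x) <= 2 * n2 u + 2 * n2 v.
Proof.
move=> lu lv; have [_ iu] := lu; have [_ iv] := lv.
rewrite /n2 -!RintegralZl// -RintegralD//; try exact: itgZ.
apply: le_Rintegral => //.
- by case: (L2rD lu lv).
- by apply: itgD => //; exact: itgZ.
- by move=> x _; have := sqr_ge0 (u x - v x); rewrite !expr2; nra.
Qed.

Lemma n2_mul_le u v : L2r u -> L2r v ->
  `|\int[mu]_x (u x * v x)| <= (n2 u + n2 v) / 2.
Proof.
move=> lu lv; have iuv := L2r_mul lu lv; have [_ iu] := lu; have [_ iv] := lv.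
apply: (le_trans (le_normr_Rintegral _ iuv)) => //.
rewrite /n2 -RintegralD// -RintegralZr//; last exact: itgD.
apply: le_Rintegral => //; first exact: itg_abs.
  by under eq_fun do rewrite mulrC; apply: itgZ => //; exact: itgD.
move=> x _; rewrite ler_norml.
have := sqr_ge0 (u x + v x); have := sqr_ge0 (u x - v x).
by rewrite !expr2; lra.
Qed.

End RealIntegrable.

#[global] Hint Resolve n2_ge0 : core.

(** * Absolute continuity and the product rule *)

Section AbsolutelyContinuous.
Context {R : realType}.
Notation mu := (@lebesgue_measure R).
Implicit Types (a b c : R) (u v f g F G : R -> R).

(** Absolute continuity in integral form. The density [f] is an explicit argument that may be
    changed on null sets, as suits representatives of weak derivatives. *)
Definition ACon a b F f :=
  mu.-integrable `[a, b] (EFin \o f) /\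
  forall c d, a <= c -> c <= d -> d <= b ->
    F d - F c = \int[mu]_(x in `[c, d]) f x.

Definition ACR F f := forall a b, ACon a b F f.

Lemma subitv a b c d : a <= c -> d <= b ->
  ([set` `[c, d]] : set R) `<=` [set` `[a, b]].
Proof.
move=> ac db x /=; rewrite !in_itv/= => /andP[cx xd].
by rewrite (le_trans ac)// (le_trans xd).
Qed.

Lemma itg_sub a b c d f : a <= c -> d <= b ->
  mu.-integrable `[a, b] (EFin \o f) -> mu.-integrable `[c, d] (EFin \o f).
Proof. by move=> ac db; apply: integrableS => //; exact: subitv. Qed.

Lemma itgT a b f : mu.-integrable setT (EFin \o f) ->
  mu.-integrable `[a, b] (EFin \o f).
Proof. exact: integrableS. Qed.

Lemma ACon_sub a b c d F f : a <= c -> d <= b -> ACon a b F f -> ACon c d F f.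
Proof.
move=> ac db [iF eF]; split; first exact: itg_sub iF.
by move=> x y cx xy yd; apply: eF => //; [exact: le_trans cx|exact: le_trans db].
Qed.

Lemma Rint_split a b c f : a <= b -> b <= c ->
  mu.-integrable `[a, c] (EFin \o f) ->
  \int[mu]_(x in `[a, c]) f x =
  \int[mu]_(x in `[a, b]) f x + \int[mu]_(x in `[b, c]) f x.
Proof.
move=> ab bc iF.
have := @Rintegral_itvB _ f (BLeft a) (BRight c) b iF ab bc.
rewrite Rintegral_itv_obnd_cbnd; first by move=> <-; rewrite addrC subrK.
apply: integrableS iF => // x /=; rewrite !in_itv/= => /andP[bx ->].
by rewrite andbT ltW// (le_lt_trans ab).
Qed.

Lemma Rint_cst a b k : a <= b -> \int[mu]_(x in `[a, b]) k = k * (b - a).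
Proof.
move=> ab; rewrite (Rintegral_cst mu)//= lebesgue_measure_itv/= lte_fin.
by move: ab; rewrite le_eqVlt => /predU1P[->|->//]; rewrite ltxx subrr.
Qed.

Lemma cont_itg a b f : {within `[a, b], continuous f} ->
  mu.-integrable `[a, b] (EFin \o f).
Proof.
move=> cf; apply: continuous_compact_integrable => //.
exact: segment_compact.
Qed.

Lemma itg_cst a b k : mu.-integrable `[a, b] (EFin \o (fun=> k)).
Proof. by apply: cont_itg => x; exact: cst_continuous. Qed.

Lemma ACon_continuous a b F f : a <= b -> ACon a b F f ->
  {within `[a, b], continuous F}.
Proof.
move=> ab [iF eF].
have H : {within `[a, b], continuous
    (fun x => F a + \int[mu]_(y in `[a, x]) f y)}.
  move=> x; apply: cvgD; first exact: cvg_cst.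
  exact: (parameterized_integral_continuous ab iF).
apply: (subspace_eq_continuous _ H) => x; rewrite inE/= in_itv/= => /andP[ax xb].
by rewrite /from_subspace -eF// addrC subrK.
Qed.

Lemma AC_continuous F f : ACR F f -> continuous F.
Proof.
move=> ac x.
have /= := @ACon_continuous (x - 1) (x + 1) F f _ (ac _ _).
have l1 : x - 1 < x by rewrite ltrBlDr ltrDl.
have l2 : x < x + 1 by rewrite ltrDl.
move=> /(_ (ltW (lt_trans l1 l2))).
move=> /(continuous_within_itvP _ (lt_trans l1 l2)) [h _ _].
by apply: h; rewrite in_itv/= l1.
Qed.

Lemma AC_measurable F f : ACR F f -> measurable_fun setT F.
Proof. by move=> /AC_continuous; exact: continuous_measurable_fun. Qed.

Lemma ACon_measurable a b F f : ACon a b F f -> measurable_fun `[a, b] F.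
Proof.
move=> h; have [ab|ba] := leP a b; last first.
  by rewrite set_itv_ge ?bnd_simp -?ltNge//; exact: measurable_fun_set0.
by apply: subspace_continuous_measurable_fun => //; exact: ACon_continuous h.
Qed.

Lemma ACon_osc a b F f c d : ACon a b F f -> a <= c -> c <= d -> d <= b ->
  `|F d - F c| <= \int[mu]_(x in `[c, d]) `|f x|.
Proof.
move=> [iF eF] ac cd db; rewrite eF//.
by apply: le_normr_Rintegral => //; exact: itg_sub iF.
Qed.

Lemma ACon_bounded a b F f : ACon a b F f ->
  exists K : R, forall x, a <= x <= b -> `|F x| <= K.
Proof.
move=> h; have [iF eF] := h.
exists (`|F a| + \int[mu]_(x in `[a, b]) `|f x|) => x /andP[ax xb].
rewrite -[F x](subrK (F a)) addrC (le_trans (ler_normD _ _))// lerD2l.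
apply: (le_trans (ACon_osc h (lexx a) ax xb)).
rewrite (@Rint_split a x b)//; last exact: itg_abs.
by rewrite lerDl; apply: Rintegral_ge0.
Qed.

Lemma ACon_itgM a b F f u : ACon a b F f ->
  mu.-integrable `[a, b] (EFin \o u) ->
  mu.-integrable `[a, b] (EFin \o (fun x => F x * u x)).
Proof.
move=> h iu; have [K FK] := ACon_bounded h.
apply: (@itg_le _ _ _ (fun x => K * `|u x|)) => //.
- by apply: measurable_funM; [exact: ACon_measurable h|exact: itg_meas iu].
- move=> x /=; rewrite in_itv/= => xab.
  by rewrite normrM ler_wpM2r// FK.
- by apply: itgZ => //; exact: itg_abs.
Qed.

Lemma AConD a b F f G g : ACon a b F f -> ACon a b G g ->
  ACon a b (fun x => F x + G x) (fun x => f x + g x).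
Proof.
move=> [iF eF] [iG eG]; split; first exact: itgD.
move=> c d ac cd db; rewrite RintegralD//; [|exact: itg_sub iF|exact: itg_sub iG].
by rewrite -eF// -eG//; ring.
Qed.

Lemma ACD F f G g : ACR F f -> ACR G g ->
  ACR (fun x => F x + G x) (fun x => f x + g x).
Proof. by move=> hF hG a b; exact: AConD. Qed.

Lemma AConZ k a b F f : ACon a b F f ->
  ACon a b (fun x => k * F x) (fun x => k * f x).
Proof.
move=> [iF eF]; split; first exact: itgZ.
move=> c d ac cd db; rewrite RintegralZl//; last exact: itg_sub iF.
by rewrite -eF//; ring.
Qed.

Lemma ACZ k F f : ACR F f -> ACR (fun x => k * F x) (fun x => k * f x).
Proof. by move=> h a b; exact: AConZ. Qed.

Lemma ACN F f : ACR F f -> ACR (fun x => - F x) (fun x => - f x).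
Proof.
move=> /(ACZ (-1)).
by under [X in ACR X]eq_fun do rewrite mulN1r; under [X in ACR _ X]eq_fun do rewrite mulN1r.
Qed.

Lemma ACB F f G g : ACR F f -> ACR G g ->
  ACR (fun x => F x - G x) (fun x => f x - g x).
Proof. by move=> hF /ACN; exact: ACD. Qed.

Lemma AC_cst k : ACR (fun=> k) (fun=> 0).
Proof.
move=> a b; split; first exact: itg_cst.
by move=> c d ac cd db; rewrite Rint_cst// mul0r subrr.
Qed.

Lemma AC_ae F f g : measurable_fun setT g -> (\forall x \ae mu, f x = g x) ->
  ACR F f -> ACR F g.
Proof.
move=> mg fg h a b; have [iF eF] := h a b.
have mg' c d : measurable_fun `[c, d] g by exact: measurable_funTS.
split; first by apply: ae_eq_itg fg iF.
move=> c d ac cd db; rewrite eF//; apply: ae_eq_Rintegral => //.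
exact: (itg_meas (itg_sub ac db iF)).
Qed.

(* Both increments of the product and the candidate integral are compared on a
   short interval, where they differ by at most the product of two small
   integrals. *)
Lemma ACon_mul_defect a b F f G g c d : ACon a b F f -> ACon a b G g ->
  a <= c -> c <= d -> d <= b ->
  `|F d * G d - F c * G c - \int[mu]_(x in `[c, d]) (f x * G x + F x * g x)|
  <= 2 * (\int[mu]_(x in `[c, d]) `|f x| * \int[mu]_(x in `[c, d]) `|g x|).
Proof.
move=> hF hG ac cd db.
have hF' := ACon_sub ac db hF; have hG' := ACon_sub ac db hG.
have [iF eF] := hF'; have [iG eG] := hG'.
have mI : measurable `[c, d] by [].
have ifG : mu.-integrable `[c, d] (EFin \o (fun x => f x * G x)).
  by have := ACon_itgM hG' iF; under [X in _ \o X]eq_fun do rewrite mulrC.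
have iFg := ACon_itgM hF' iG.
set If := \int[mu]_(x in _) `|f x|; set Ig := \int[mu]_(x in _) `|g x|.
have -> : F d * G d - F c * G c - \int[mu]_(x in `[c, d]) (f x * G x + F x * g x)
  = \int[mu]_(x in `[c, d]) (f x * (G d - G x) + (F c - F x) * g x).
  have -> : (fun x => f x * (G d - G x) + (F c - F x) * g x) =
     (fun x => (G d * f x + F c * g x) - (f x * G x + F x * g x)).
    by apply/funext => x; ring.
  rewrite RintegralB//; [|apply: itgD => //; exact: itgZ|exact: itgD].
  set J := \int[mu]_(x in _) (f x * G x + F x * g x).
  rewrite RintegralD//; [|exact: itgZ|exact: itgZ].
  rewrite !RintegralZl// -eF// -eG//; ring.
apply: (@le_trans _ _ (\int[mu]_(x in `[c, d]) (Ig * `|f x| + If * `|g x|))).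
  have iR : mu.-integrable `[c, d] (EFin \o (fun x => Ig * `|f x| + If * `|g x|)).
    by apply: itgD => //; apply: itgZ => //; exact: itg_abs.
  have mL : measurable_fun `[c, d] (fun x => f x * (G d - G x) + (F c - F x) * g x).
    apply: measurable_funD; apply: measurable_funM.
    - exact: itg_meas iF.
    - by apply: measurable_funB => //; exact: ACon_measurable hG'.
    - by apply: measurable_funB => //; exact: ACon_measurable hF'.
    - exact: itg_meas iG.
  have le x : `[c, d]%classic x ->
     `|f x * (G d - G x) + (F c - F x) * g x| <= Ig * `|f x| + If * `|g x|.
    rewrite /= in_itv/= => /andP[cx xd].
    apply: (le_trans (ler_normD _ _)); rewrite !normrM; apply: lerD.
      rewrite mulrC ler_wpM2r//; apply: (le_trans (ACon_osc hG' cx xd (lexx d))).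
      rewrite /Ig (@Rint_split c x d)//; last exact: itg_abs.
      by rewrite lerDr; apply: Rintegral_ge0.
    rewrite ler_wpM2r// distrC; apply: (le_trans (ACon_osc hF' (lexx c) cx xd)).
    rewrite /If (@Rint_split c x d)//; last exact: itg_abs.
    by rewrite lerDl; apply: Rintegral_ge0.
  have iL := itg_le mI mL le iR.
  apply: (le_trans (Rint_norm_le mI iL)).
  by apply: le_Rintegral => //; exact: itg_abs.
rewrite RintegralD//; try by apply: itgZ => //; exact: itg_abs.
rewrite !RintegralZl//; try exact: itg_abs.
by rewrite le_eqVlt; apply/orP; left; apply/eqP; rewrite /If /Ig; ring.
Qed.

Lemma abs_cont_itv a b g e : mu.-integrable `[a, b] (EFin \o g) -> 0 < e ->
  exists2 dl, 0 < dl & forall c d, a <= c -> c <= d -> d <= b -> d - c < dl ->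
    \int[mu]_(x in `[c, d]) `|g x| < e.
Proof.
move=> ig e0; pose h := g \_ `[a, b].
have ih : mu.-integrable setT (EFin \o h).
  by rewrite -restrict_EFin; apply/integrable_restrict => //=; rewrite setTI.
have [dl [dl0 H]] := integral_normr_continuous ih e0.
exists dl => // c d ac cd db dc.
have := H `[c, d]%classic (measurable_itv _).
rewrite /= lebesgue_measure_itv/= lte_fin.
have -> : \int[mu]_(x in `[c, d]) `|h x| = \int[mu]_(x in `[c, d]) `|g x|.
  apply: eq_Rintegral => x /set_mem/(subitv ac db) xab.
  by rewrite /h patchE mem_set.
apply; case: ifP => _; last by rewrite lte_fin.
by rewrite -EFinD lte_fin.
Qed.

(** The defect bounded in [ACon_mul_defect] is additive over adjacent intervals. On a fine
    subdivision every $\int|g|$ is uniformly small, so the sum of the products $\int|f|\int|g|$ is a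
    small multiple of $\int_c^d|f|$. *)
Lemma ACon_mul a b F f G g : ACon a b F f -> ACon a b G g ->
  ACon a b (fun x => F x * G x) (fun x => f x * G x + F x * g x).
Proof.
move=> hF hG; have [iF eF] := hF; have [iG eG] := hG.
have iH : mu.-integrable `[a, b] (EFin \o (fun x => f x * G x + F x * g x)).
  apply: itgD => //; last exact: ACon_itgM hF iG.
  by have := ACon_itgM hG iF; under [X in _ \o X]eq_fun do rewrite mulrC.
split=> // c d ac cd db; apply/eqP; rewrite -subr_eq0 -normr_eq0.
rewrite eq_le normr_ge0 andbT; apply/ler_addgt0Pr => e e0; rewrite add0r.
pose If := \int[mu]_(x in `[c, d]) `|f x|.
have If0 : 0 <= If by exact: Rintegral_ge0.
(* With this bound on each $\int|g|$ the total defect is at most $e\,I_f/(I_f+1) \le e$; the $+1$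
   avoids dividing by 0. *)
have e1 : 0 < e / (2 * (If + 1)) by rewrite divr_gt0// mulr_gt0// ltr_wpDl.
have [dl dl0 small] := abs_cont_itv iG e1.
have [n ndl] : exists n : nat, (d - c) / n.+1%:R < dl.
  exists (Num.truncn ((d - c) / dl)); rewrite ltr_pdivrMr// mulrC -ltr_pdivrMr//.
  exact: truncnS_gt.
pose h := (d - c) / n.+1%:R.
have h0 : 0 <= h by rewrite divr_ge0// subr_ge0.
pose D x y := F y * G y - F x * G x - \int[mu]_(z in `[x, y]) (f z * G z + F z * g z).
have step : forall k, (k <= n.+1)%N -> `|D c (c + k%:R * h)| <=
   2 * (\int[mu]_(x in `[c, c + k%:R * h]) `|f x| * (e / (2 * (If + 1)))).
  elim=> [_|k IH kn].
    rewrite mul0r addr0 /D set_itv1 !Rintegral_set1 !subrr ?subr0 normr0.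
    by rewrite mul0r mulr0.
  have ck : c <= c + k%:R * h by rewrite lerDl mulr_ge0.
  have kk : c + k%:R * h <= c + k.+1%:R * h by rewrite lerD2l ler_wpM2r// ler_nat.
  have kd : c + k.+1%:R * h <= d.
    rewrite -lerBrDl; apply: (@le_trans _ _ (n.+1%:R * h)).
      by rewrite ler_wpM2r// ler_nat.
    by rewrite /h mulrC divfK.
  have akk : a <= c + k%:R * h by exact: le_trans ck.
  have kb : c + k.+1%:R * h <= b by exact: le_trans db.
  have -> : D c (c + k.+1%:R * h) = D c (c + k%:R * h) +
      D (c + k%:R * h) (c + k.+1%:R * h).
    rewrite /D (@Rint_split c (c + k%:R * h) (c + k.+1%:R * h))//; first by ring.
    exact: itg_sub iH.
  apply: (le_trans (ler_normD _ _)).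
  rewrite (@Rint_split c (c + k%:R * h) (c + k.+1%:R * h))//; last first.
    by apply: itg_abs => //; exact: itg_sub iF.
  set q := e / _.
  rewrite [(_ + _) * q]mulrDl [2 * (_ + _)]mulrDr; apply: lerD; first exact: IH (ltnW kn).
  apply: (le_trans (ACon_mul_defect hF hG akk kk kb)).
  rewrite ler_pM2l// ler_wpM2l//; first exact: Rintegral_ge0.
  apply/ltW/small => //.
  by rewrite -/h in ndl; apply: le_lt_trans ndl; rewrite -natr1; lra.
have := step n.+1 (leqnn _).
have -> : c + n.+1%:R * h = d by rewrite /h [n.+1%:R * _]mulrC divfK// addrC subrK.
rewrite -/If /D => /le_trans; apply.
have -> : 2 * (If * (e / (2 * (If + 1)))) = e * (If / (If + 1)).
  by field; rewrite gt_eqF// ltr_wpDl.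
by rewrite -[leRHS]mulr1 ler_pM2l// ler_pdivrMr ?ltr_wpDl// mul1r lerDl.
Qed.

Lemma AC_mul F f G g : ACR F f -> ACR G g ->
  ACR (fun x => F x * G x) (fun x => f x * G x + F x * g x).
Proof. by move=> hF hG a b; exact: ACon_mul. Qed.

Lemma C1_AC F : (forall x, derivable F x 1) -> continuous (derive1 F) -> ACR F (derive1 F).
Proof.
move=> dF cF a b.
have cF' c d : {within `[c, d], continuous (derive1 F)} by exact: continuous_subspaceT.
split; first exact: (cont_itg (cF' a b)).
move=> c d ac; rewrite le_eqVlt => /predU1P[<-|cd] db.
  by rewrite set_itv1 Rintegral_set1 subrr.
have cF0 x : {for x, continuous F} by apply/differentiable_continuous/derivable1_diffP.
rewrite /Rintegral (continuous_FTC2 cd (cF' c d) (F := F))//.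
by split=> [x _||]; [exact: dF|exact/cvg_at_right_filter/cF0|exact/cvg_at_left_filter/cF0].
Qed.

Lemma itg_restrict (A : set R) f : measurable A ->
  mu.-integrable A (EFin \o f) <-> mu.-integrable setT (EFin \o (f \_ A)).
Proof.
by move=> mA; rewrite -restrict_EFin; exact: (@integrable_mkcond _ _ _ mu A).
Qed.

Lemma itgU (A B : set R) f : measurable A -> measurable B ->
  mu.-integrable A (EFin \o f) -> mu.-integrable B (EFin \o f) ->
  mu.-integrable (A `|` B) (EFin \o f).
Proof.
move=> mA mB iA iB; have mAB : measurable (A `|` B) by exact: measurableU.
have mf : measurable_fun (A `|` B) f.
  by apply/measurable_funU => //; split; [exact: itg_meas iA|exact: itg_meas iB].
apply/itg_restrict => //.
apply: (@itg_le _ _ _ (fun x => `|(f \_ A) x| + `|(f \_ B) x|)) => //.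
- by apply/(measurable_restrictT _ _).1.
- move=> x _; rewrite !patchE in_setU.
  by case: (x \in A); case: (x \in B) => //=; rewrite ?normr0 ?addr0 ?add0r ?lerDl.
- have iA' := (itg_restrict f mA).1 iA; have iB' := (itg_restrict f mB).1 iB.
  by apply: itgD => //; exact: itg_abs.
Qed.

Lemma ACon_glue a b c F f : ACon a b F f -> ACon b c F f -> a <= b -> b <= c ->
  ACon a c F f.
Proof.
move=> [i1 e1] [i2 e2] ab bc.
have iac : mu.-integrable `[a, c] (EFin \o f).
  have -> : `[a, c]%classic = `[a, b]%classic `|` `[b, c]%classic :> set R.
    apply/seteqP; split => x /=; rewrite !in_itv/=.
      by move=> /andP[-> ->]; case: (leP x b) => [|/ltW ->] /=; [left|right].
    by move=> [] /andP[h1 h2]; rewrite ?h1 ?h2 ?andbT//=;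
      [exact: le_trans bc|exact: le_trans h1].
  exact: itgU.
split => // x y ax xy yc.
have [yb|by_] := leP y b; first exact: e1.
have [bx|xb] := leP b x; first exact: e2.
rewrite (@Rint_split x b y) ?ltW//; last exact: itg_sub iac.
rewrite -(e1 x b) ?(ltW xb)// -(e2 b y) ?(ltW by_)//; ring.
Qed.

(** Functions defined by cases across 0, such as [prim] and [bidamped], are treated one side at a
    time. *)
Lemma AC_glue0 F f : (forall b, 0 <= b -> ACon 0 b F f) ->
  (forall a, a <= 0 -> ACon a 0 F f) -> ACR F f.
Proof.
move=> hp hn a b.
have am : Num.min a 0 <= 0 by rewrite ge_min lexx orbT.
have bM : 0 <= Num.max b 0 by rewrite le_max lexx orbT.
apply: (@ACon_sub (Num.min a 0) (Num.max b 0)).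
- by rewrite ge_min lexx.
- by rewrite le_max lexx.
by apply: ACon_glue (hn _ am) (hp _ bM) am bM.
Qed.

End AbsolutelyContinuous.

(** * Smooth bumps and cut-offs built from flat exponentials *)

Section FlatBump.
Context {R : realType}.
Notation mu := (@lebesgue_measure R).
Implicit Types (f g F G : R -> R) (x a b : R) (n : nat).

Lemma is_derive_at_cvg F x l :
  (fun h => h^-1 * (F (h + x) - F x)) @ (0 : R)^' --> l -> is_derive x 1 F l.
Proof.
move=> H.
have H' : h^-1 *: ((F \o shift x) (h *: 1) - F x) @[h --> (0 : R)^'] --> l.
  apply: cvg_trans H; apply: near_eq_cvg; near=> h.
  by rewrite /= /GRing.scale/= mulr1.
apply: DeriveDef; first by apply: cvgP H'.
by apply: cvg_lim H'.
Unshelve. all: by end_near. Qed.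

Lemma is_derive_sqr_bound F x C : F x = 0 ->
  (forall h, `|F (h + x)| <= C * h ^+ 2) -> is_derive x 1 F 0.
Proof.
move=> F0 FC; apply: is_derive_at_cvg.
have C0 : 0 <= C by have := FC 1; rewrite expr1n mulr1; apply: le_trans.
apply/cvgrPdist_le => e e0; near=> h.
rewrite F0 subr0 sub0r normrN normrM normfV.
have h0 : h != 0 by near: h; exact: nbhs_dnbhs_neq.
have hp : 0 < `|h| by rewrite normr_gt0.
rewrite mulrC ler_pdivrMr//.
apply: (le_trans (FC h)); rewrite -real_normK ?num_real// expr2 mulrA ler_wpM2r//.
have : `|h| <= e / (C + 1).
  near: h; apply: dnbhs0_le; rewrite divr_gt0// ltr_wpDl//.
rewrite ler_pdivlMr ?ltr_wpDl// => /(le_trans _); apply.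
by rewrite mulrC ler_wpM2l// lerDl.
Unshelve. all: by end_near. Qed.

(* The flat functions x^-n exp(-1/x), extended by 0, span a space that is
   closed under differentiation. *)
Definition flat n x : R := if 0 < x then x^-1 ^+ n * expR (- x^-1) else 0.

(** This is $e^y \ge y^N/N!$ at $y = 1/x$, $N = n+m+1$. *)
Lemma flat_le n m x : 0 < x -> flat n x <= ((n + m).+1)`!%:R * x ^+ m.+1.
Proof.
move=> x0; rewrite /flat x0.
have xi : 0 <= x^-1 by rewrite invr_ge0 ltW.
have := expR_ge1Dxn (n + m) xi.
set N := (_)`!%:R => H.
have N0 : 0 < N by rewrite ltr0n fact_gt0.
have e0 : 0 < expR x^-1 by exact: expR_gt0.
rewrite expRN ler_pdivrMr//.
have : x^-1 ^+ (n + m).+1 / N <= expR x^-1 by apply: le_trans H; rewrite lerDr.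
rewrite ler_pdivrMr// => H2.
have -> : x^-1 ^+ n = x ^+ m.+1 * x^-1 ^+ (n + m).+1.
  by rewrite -addnS exprD mulrCA -exprMn mulfV ?gt_eqF// expr1n mulr1.
rewrite [N * _]mulrC -mulrA; apply: ler_wpM2l; first by rewrite exprn_ge0// ltW.
by rewrite mulrC.
Qed.

Lemma flat_ge0 n x : 0 <= flat n x.
Proof.
rewrite /flat; case: ifP => // x0.
by rewrite mulr_ge0 ?expR_ge0// exprn_ge0// invr_ge0 ltW.
Qed.

Lemma flat_derive n x :
  is_derive x 1 (flat n) (- n%:R * flat n.+1 x + flat n.+2 x).
Proof.
have [x0|x0|<-] := ltgtP 0 x.
- have x1 : x != 0 by rewrite gt_eqF.
  have D : is_derive x 1 (fun y => y^-1 ^+ n * expR (- y^-1))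
      (- n%:R * flat n.+1 x + flat n.+2 x).
    have dV : is_derive x 1 (fun y : R => y^-1) (- x ^- 2).
      have := @is_deriveV _ id x 1 1 x1 (is_derive_id x 1).
      by rewrite /GRing.scale/= mulr1.
    have dX : is_derive x 1 (fun y : R => y^-1 ^+ n) (n%:R * x^-1 ^+ n.-1 * - x ^- 2).
      have := @is_derive1_comp _ (fun z => z ^+ n) (fun y => y^-1) x
        (n%:R * x^-1 ^+ n.-1) (- x ^- 2).
      apply => //.
      have := @is_deriveX _ _ id n x^-1 1 1 (is_derive_id _ _).
      by rewrite exprfctE /GRing.scale/= mulr1.
    have dE : is_derive x 1 (fun y : R => expR (- y^-1)) (expR (- x^-1) * x ^- 2).
      have := @is_derive1_comp _ expR (fun y => - y^-1) x (expR (- x^-1)) (x ^- 2).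
      apply.
      have := @is_deriveN _ _ _ _ x 1 _ dV; by rewrite opprK.
    have := @is_deriveM _ _ _ _ x 1 _ _ dX dE.
    rewrite /GRing.scale/= => D; apply: is_derive_eq D _.
    rewrite /flat x0 -exprVn; case: n {dX} => [|n] /=; rewrite ?exprS; ring.
  apply: near_eq_is_derive D; near=> y.
  by rewrite /flat ifT//; near: y; exact: lt_nbhsr.
- have D : is_derive x 1 (fun=> 0 : R) (0 : R) by exact: is_derive_cst.
  rewrite /flat ltNge (ltW x0)/= mulr0 addr0.
  apply: near_eq_is_derive D; near=> y.
  by rewrite /= ltNge ifF//; apply/negbF/ltW; near: y; exact: lt_nbhsl.
- rewrite /flat ltxx mulr0 addr0.
  (* At the junction 0 neither formula covers a neighbourhood; [flat_le] with [m = 1] gives the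
     quadratic bound $(n+2)!\,h^2$. *)
  apply: (@is_derive_sqr_bound _ _ (n.+2`!%:R)); first by rewrite ltxx.
  move=> h; rewrite addr0 -/(flat n h) ger0_norm ?flat_ge0//.
  have [h0|h0] := ltP 0 h.
    by have := flat_le n 1 h0; rewrite addn1.
  by rewrite /flat ltNge h0/= mulr_ge0// sqr_ge0.
Unshelve. all: by end_near. Qed.

Definition flat_bump x : R := flat 0 x * flat 0 (1 - x).

Lemma derive_AC F f : ACR F f -> continuous f -> forall x, is_derive x 1 F (f x).
Proof.
move=> hF cf x; have [iF eF] := hF (x - 1) (x + 1).
have l1 : x - 1 < x by rewrite ltrBlDr ltrDl.
have l2 : x < x + 1 by rewrite ltrDl.
have [dG eG] := continuous_FTC1_closed l2 iF l1 (cf x).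
set G := fun _ => _ in dG eG.
have D : is_derive x 1 (fun y => F (x - 1) + G y) (f x).
  have D : is_derive x 1 G (f x) by apply: DeriveDef dG _; rewrite -derive1E.
  by have := is_deriveD (is_derive_cst (F (x - 1)) x 1) D; rewrite add0r.
apply: near_eq_is_derive D; near=> y.
rewrite /G -eF//; first by rewrite addrC subrK.
- by near: y; exact: lt_le_nbhsr.
- by near: y; exact: lt_le_nbhsl.
Unshelve. all: by end_near. Qed.

(** The oriented integral from 0 to [x]: one of the two intervals is always empty or a single
    point. *)
Definition prim f x : R :=
  \int[mu]_(y in `[0, x]) f y - \int[mu]_(y in `[x, 0]) f y.

Lemma prim0 f : prim f 0 = 0. Proof. by rewrite /prim subrr. Qed.

Lemma Rint_rev a b f : b <= a -> \int[mu]_(y in `[a, b]) f y = 0.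
Proof.
rewrite le_eqVlt => /predU1P[->|ba]; first by rewrite set_itv1 Rintegral_set1.
by rewrite set_itv_ge ?Rintegral_set0// bnd_simp -ltNge.
Qed.

Lemma AC_prim f : (forall a b, mu.-integrable `[a, b] (EFin \o f)) ->
  ACR (prim f) f.
Proof.
move=> lf; apply: AC_glue0 => [b b0|a a0]; split=> // c d.
  move=> c0 cd db; rewrite /prim (@Rint_split _ 0 c d)//.
  by rewrite (@Rint_rev c 0 f)// (@Rint_rev d 0 f) ?(le_trans c0)//; ring.
move=> ac cd d0; rewrite /prim (@Rint_split _ c d 0)//.
by rewrite (@Rint_rev 0 c f) ?(le_trans cd)// (@Rint_rev 0 d f)//; ring.
Qed.

Lemma flat_continuous n : continuous (flat n).
Proof.
move=> x; apply/differentiable_continuous/derivable1_diffP.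
by have [] := flat_derive n x.
Qed.

Lemma flat_bump_continuous : continuous flat_bump.
Proof.
move=> x; apply: continuousM; first exact: flat_continuous.
have h1 : {for x, continuous (fun y : R => 1 - y)}.
  by apply: continuousB; [exact: cst_continuous|move=> ?].
exact: (continuous_comp h1 (@flat_continuous 0 (1 - x))).
Qed.

Definition flat_bump_mass := \int[mu]_(x in `[0, 1]) flat_bump x.

Lemma flat_bump_ge0 x : 0 <= flat_bump x. Proof. by rewrite mulr_ge0// flat_ge0. Qed.

Lemma flat0_le1 x : flat 0 x <= 1.
Proof.
rewrite /flat; case: ifP => // x0; rewrite expr0 mul1r -expR0 ler_expR.
by rewrite oppr_le0 invr_ge0 ltW.
Qed.

Lemma flat_bump_le1 x : flat_bump x <= 1.
Proof.
by rewrite /flat_bump -[leRHS]mul1r ler_pM ?flat_ge0 ?flat0_le1.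
Qed.

Lemma flat_bump_mass_gt0 : 0 < flat_bump_mass.
Proof.
have cb a b : {within `[a, b], continuous flat_bump}.
  by apply: continuous_subspaceT; exact: flat_bump_continuous.
have ib a b : mu.-integrable `[a, b] (EFin \o flat_bump) by exact: cont_itg.
have h4 : 0 < 4^-1 :> R by rewrite invr_gt0.
(* On $[1/4, 3/4]$ both $x$ and $1-x$ are at least $1/4$, so both factors of the bump are at least
   $e^{-4}$. *)
have l x : 4^-1 <= x -> expR (- 4) <= flat 0 x.
  move=> x4; have x0 : 0 < x by exact: lt_le_trans x4.
  rewrite /flat x0 expr0 mul1r ler_expR lerN2 -[leRHS]invrK.
  by rewrite lef_pV2 ?posrE// invrK.
rewrite /flat_bump_mass (@Rint_split _ 0 4^-1 1)//; [|lra..].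
rewrite (@Rint_split _ 4^-1 (3 / 4) 1)//; [|lra..].
apply: ltr_wpDl; first by apply: Rintegral_ge0 => x _; exact: flat_bump_ge0.
apply: ltr_pwDl; last by apply: Rintegral_ge0 => x _; exact: flat_bump_ge0.
apply: (@lt_le_trans _ _ (\int[mu]_(x in `[4^-1, 3 / 4]) (expR (- 4) ^+ 2))).
  rewrite Rint_cst; last lra.
  by rewrite mulr_gt0// ?exprn_gt0 ?expR_gt0//; lra.
apply: le_Rintegral => //; first exact: itg_cst.
move=> x /=; rewrite in_itv/= => /andP[x1 x2].
by rewrite /flat_bump expr2 ler_pM ?expR_ge0 ?l//; lra.
Qed.

(** A smooth transition from 0 to 1 that takes place inside $[0,1]$. *)
Definition step x := flat_bump_mass^-1 * prim flat_bump x.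

Lemma flat_bump_out x : x <= 0 \/ 1 <= x -> flat_bump x = 0.
Proof.
rewrite /flat_bump /flat => -[x0|x1].
  by rewrite ltNge x0/= mul0r.
by rewrite [X in _ * X]ifF ?mulr0//; apply/negbTE; rewrite -leNgt subr_le0.
Qed.

Lemma step_AC : ACR step (fun x => flat_bump_mass^-1 * flat_bump x).
Proof.
apply/ACZ/AC_prim => a b; apply: cont_itg; apply: continuous_subspaceT.
exact: flat_bump_continuous.
Qed.

Lemma step_derive x : is_derive x 1 step (flat_bump_mass^-1 * flat_bump x).
Proof.
apply: (derive_AC step_AC) => z.
have h1 : {for z, continuous (fun=> flat_bump_mass^-1)} by exact: cst_continuous.
exact: (continuousM h1 (@flat_bump_continuous z)).
Qed.

Lemma step_le0 x : x <= 0 -> step x = 0.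
Proof.
move=> x0; rewrite /step /prim (Rint_rev _ x0) sub0r.
rewrite (_ : \int[mu]_(_ in _) _ = 0) ?oppr0 ?mulr0//.
rewrite -[RHS](mul0r (0 - x)) -Rint_cst//; apply: eq_Rintegral => y.
rewrite inE/= in_itv/= => /andP[_ y0]; apply: flat_bump_out; by left.
Qed.

Lemma step_ge1 x : 1 <= x -> step x = 1.
Proof.
move=> x1; rewrite /step /prim (Rint_rev _ (le_trans ler01 x1)) subr0.
rewrite (@Rint_split _ 0 1 x)//; last first.
  by apply: cont_itg; apply: continuous_subspaceT; exact: flat_bump_continuous.
rewrite (_ : \int[mu]_(_ in `[1, x]) _ = 0).
  by rewrite addr0 mulVf// gt_eqF// flat_bump_mass_gt0.
rewrite -[RHS](mul0r (x - 1)) -Rint_cst//; apply: eq_Rintegral => y.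
rewrite inE/= in_itv/= => /andP[y0 _]; apply: flat_bump_out; by right.
Qed.

(** A syntactic class stable under differentiation, so that infinite differentiability becomes one
    induction. Affine arguments sit in the generators because the derivative of [step] contains
    [flat 0 (1 - x)]; [step] is a generator of its own, being an integral of members of the
    class. *)
Inductive smooth_class : (R -> R) -> Prop :=
| sm_flat n a b : smooth_class (fun x => flat n (a * x + b))
| sm_step a b : smooth_class (fun x => step (a * x + b))
| sm_add f g : smooth_class f -> smooth_class g -> smooth_class (fun x => f x + g x)
| sm_mul f g : smooth_class f -> smooth_class g -> smooth_class (fun x => f x * g x)
| sm_scale k f : smooth_class f -> smooth_class (fun x => k * f x).

Lemma is_derive_affine a b x : is_derive x 1 (fun y : R => a * y + b) a.
Proof.
rewrite -[X in is_derive _ _ _ X]addr0; apply: is_deriveD.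
have := @is_deriveZ _ _ _ id a x 1 1 (is_derive_id x 1).
by rewrite /GRing.scale/= mulr1.
Qed.

Lemma smooth_class_derive f : smooth_class f ->
  exists2 g, smooth_class g & forall x, is_derive x 1 f (g x).
Proof.
elim=> {f} [n a b|a b|f g _ [f' sf df] _ [g' sg dg]|f g sf0 [f' sf df] sg0 [g' sg dg]
  |k f _ [f' sf df]].
- exists (fun x => a * (- n%:R * flat n.+1 (a * x + b) + flat n.+2 (a * x + b))).
    apply: sm_scale; apply: sm_add; last exact: sm_flat.
    by apply: sm_scale; exact: sm_flat.
  move=> x; rewrite mulrC.
  exact: (@is_derive1_comp _ (flat n) (fun y => a * y + b) _ _ _
    (flat_derive n (a * x + b)) (is_derive_affine a b x)).
- exists (fun x => a * (flat_bump_mass^-1 * (flat 0 (a * x + b) * flat 0 (- a * x + (1 - b))))).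
    by do 2 apply: sm_scale; apply: sm_mul; exact: sm_flat.
  move=> x; rewrite mulrC.
  have -> : - a * x + (1 - b) = 1 - (a * x + b) by ring.
  apply: (@is_derive1_comp _ step (fun y => a * y + b) _ _ _ _ (is_derive_affine a b x)).
  exact: step_derive.
- by exists (fun x => f' x + g' x); [exact: sm_add|move=> x; exact: is_deriveD].
- exists (fun x => f x * g' x + g x * f' x).
    by apply: sm_add; apply: sm_mul.
  move=> x; exact: is_deriveM.
- exists (fun x => k * f' x); first exact: sm_scale.
  by move=> x; exact: is_deriveZ.
Qed.

Lemma smooth_class_derivable f n x : smooth_class f ->
  derivable (derive1n n f) x 1.
Proof.
move=> sf; suff H : smooth_class (derive1n n f).
  by have [g _ /(_ x) []] := smooth_class_derive H.
elim: n => // n IH; rewrite derive1nS.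
have [g sg dg] := smooth_class_derive IH.
suff -> : derive1 (derive1n n f) = g by [].
by apply/funext => y; rewrite derive1E; have [_ ->] := dg y.
Qed.

Lemma smooth_class_continuous f : smooth_class f -> continuous f.
Proof.
move=> /smooth_class_derive[g _ fg] x.
by apply/differentiable_continuous/derivable1_diffP; have [] := fg x.
Qed.

Lemma is_derive_AC F f : (forall x, is_derive x 1 F (f x)) -> continuous f ->
  ACR F f.
Proof.
move=> D cf; have E : f = derive1 F.
  by apply/funext => x; rewrite derive1E; have [_ ->] := D x.
rewrite E; apply: C1_AC => [x|]; first by have [] := D x.
by rewrite -E.
Qed.

(** It goes from 0 to 1 on $[a, a+1/l]$ and back on $[b, b+1/l]$. It serves twice: as a wide cut-off
    with small slope, and, for large [l], as a test function whose derivative is a difference of two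
    mollifiers located at [a] and [b]. *)
Definition plateau l a b x := step (l * (x - a)) - step (l * (x - b)).

Definition dplateau l a b x : R :=
  l * flat_bump_mass^-1 * (flat_bump (l * (x - a)) - flat_bump (l * (x - b))).

Lemma plateau_test l a b : 0 < l -> test_function (plateau l a b).
Proof.
move=> l0; split.
  move=> n x; apply: smooth_class_derivable.
  have -> : plateau l a b =
     (fun x => step (l * x + - (l * a)) + -1 * step (l * x + - (l * b))).
    by apply/funext => y; rewrite /plateau mulN1r !mulrBr.
  by apply: sm_add; [exact: sm_step|apply: sm_scale; exact: sm_step].
exists (`|a| + `|b| + l^-1) => x hx; rewrite /plateau.
have li : 0 < l^-1 by rewrite invr_gt0.
have [x0|x0] := leP 0 x.
  rewrite !step_ge1 ?subrr//.
  - rewrite mulrC -ler_pdivrMr// div1r lerBrDr.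
    have := ler_norm b; have := normr_ge0 a; rewrite (ger0_norm x0) in hx; lra.
  - rewrite mulrC -ler_pdivrMr// div1r lerBrDr.
    have := ler_norm a; have := normr_ge0 b; rewrite (ger0_norm x0) in hx; lra.
rewrite (ltr0_norm x0) in hx.
rewrite !step_le0 ?subrr//; rewrite pmulr_rle0// subr_le0.
- have := ler_norm (- b); have := normr_ge0 a; rewrite normrN; lra.
- have := ler_norm (- a); have := normr_ge0 b; rewrite normrN; lra.
Qed.

Lemma plateau_derive l a b x : is_derive x 1 (plateau l a b) (dplateau l a b x).
Proof.
have S (y : R) : is_derive y 1 step (flat_bump_mass^-1 * flat_bump y).
  exact: step_derive.
have T (c : R) : is_derive x 1 (fun y => step (l * (y - c)))
    (l * flat_bump_mass^-1 * flat_bump (l * (x - c))).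
  have -> : l * flat_bump_mass^-1 * flat_bump (l * (x - c)) =
    (flat_bump_mass^-1 * flat_bump (l * x + - (l * c))) * l by rewrite mulrBr; ring.
  have -> : (fun y => step (l * (y - c))) = step \o (fun y => l * y + - (l * c)).
    by apply/funext => y; rewrite /= mulrBr.
  apply: (@is_derive1_comp _ step (fun y => l * y + - (l * c)) x _ _ (S _)).
  exact: is_derive_affine.
rewrite /dplateau mulrBr; exact: is_deriveB.
Qed.

End FlatBump.

(** * Weak derivatives: the fundamental lemma and absolutely continuous representatives *)

Section WeakDerivative.
Context {R : realType}.
Notation mu := (@lebesgue_measure R).
Implicit Types (u v f g F G phi : R -> R) (x a b : R) (n : nat).

Definition loc_itg v := forall a b, mu.-integrable `[a, b] (EFin \o v).

Lemma restrict_supp f a b : (forall x, ~~ (a <= x <= b) -> f x = 0) ->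
  f \_ `[a, b]%classic = f.
Proof.
move=> f0; apply/funext => x; rewrite patchE.
by case: ifPn => // /negP; rewrite inE/= in_itv/= => /negP/f0.
Qed.

Lemma Rint_supp f a b : (forall x, ~~ (a <= x <= b) -> f x = 0) ->
  \int[mu]_x f x = \int[mu]_(x in `[a, b]) f x.
Proof. by move=> /restrict_supp f0; rewrite [RHS]Rintegral_mkcond f0. Qed.

Lemma itg_supp f a b : (forall x, ~~ (a <= x <= b) -> f x = 0) ->
  mu.-integrable `[a, b] (EFin \o f) -> mu.-integrable setT (EFin \o f).
Proof.
move=> /restrict_supp f0 iF; rewrite -f0; exact: (itg_restrict f _).1.
Qed.

Lemma test_AC phi : test_function phi -> ACR phi (derive1 phi).
Proof.
move=> [sm _]; apply: C1_AC; first by move=> x; exact: (sm 0%N).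
move=> x; apply/differentiable_continuous/derivable1_diffP.
by have := sm 1%N x; rewrite derive1n1.
Qed.

Lemma test_supp phi : test_function phi ->
  exists2 M, 0 <= M & forall x, ~~ (- M <= x <= M) -> phi x = 0 /\ derive1 phi x = 0.
Proof.
move=> [_ [M HM]]; exists `|M| => // x; rewrite -ler_norml -ltNge => Mx.
have M1 : M < `|x| by apply: le_lt_trans Mx; exact: ler_norm.
split; first exact: HM.
rewrite derive1E.
have D : is_derive x 1 (fun=> 0 : R) (0 : R) by exact: is_derive_cst.
have D' : is_derive x 1 phi 0.
  apply: near_eq_is_derive D; near=> y; rewrite HM//.
  near: y; move: (@norm_continuous _ R x) => /cvgr_gt; exact.
by have [_ ->] := D'.
Unshelve. all: by end_near. Qed.

Lemma test_derive1 phi : test_function phi -> test_function (derive1 phi).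
Proof.
move=> t; have [M M0 HM] := test_supp t; have [sm _] := t; split.
  by move=> n x; have := sm n.+1 x; rewrite derive1Sn.
exists M => x Mx; apply: (HM x _).2.
by rewrite -ler_norml -ltNge.
Qed.

Lemma itg_test v phi : loc_itg v -> test_function phi ->
  mu.-integrable setT (EFin \o (fun x => v x * phi x)).
Proof.
move=> lv t; have [M M0 HM] := test_supp t.
apply: (@itg_supp _ (- M) M); first by move=> x /HM[-> _]; rewrite mulr0.
under [X in _ \o X]eq_fun do rewrite mulrC.
exact: (ACon_itgM (test_AC t _ _)).
Qed.

Lemma AC_loc_itg F f : ACR F f -> loc_itg F.
Proof.
move=> /AC_continuous cF a b; apply: cont_itg; exact: continuous_subspaceT.
Qed.

Lemma L2_loc_itg v : L2r v -> loc_itg v.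
Proof.
move=> [mv iv] a b.
apply: (@itg_le _ _ _ (fun x => 1 + v x ^+ 2)) => //.
- exact: measurable_funTS.
- move=> x _; rewrite ler_norml.
  have := sqr_ge0 (v x + 1); have := sqr_ge0 (v x - 1); rewrite !expr2; nra.
- by apply: itgD => //; [exact: itg_cst|exact: itgT].
Qed.

Lemma ibp_test u v phi : ACR u v -> test_function phi ->
  \int[mu]_x (u x * derive1 phi x) = - \int[mu]_x (v x * phi x).
Proof.
move=> uv t; have [M M0 HM] := test_supp t.
have lv : loc_itg v by move=> a b; case: (uv a b).
have i1 := itg_test lv t.
have i2 := itg_test (AC_loc_itg uv) (test_derive1 t).
apply/eqP; rewrite -addr_eq0 addrC -RintegralD//; apply/eqP.
(* [test_supp] says nothing at the end points $\pm M$ themselves; the margin 1 makes the boundary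
   terms vanish. *)
have M1 : - (M + 1) <= M + 1 by lra.
rewrite (@Rint_supp _ (- (M + 1)) (M + 1)).
  have [_ <-] := ACon_mul (uv (- (M + 1)) (M + 1)) (test_AC t _ _); last first.
  - exact: lexx.
  - exact: M1.
  - exact: lexx.
  rewrite (HM (M + 1) _).1 ?(HM (- (M + 1)) _).1 ?mulr0 ?subrr//.
  - by rewrite negb_and -!ltNge; apply/orP; left; lra.
  - by rewrite negb_and -!ltNge; apply/orP; right; lra.
move=> x xM; have /HM[-> ->] : ~~ (- M <= x <= M).
  by apply: contra xM => /andP[h1 h2]; apply/andP; split; lra.
by rewrite !mulr0 addr0.
Qed.

(** The derivative of a rescaled [step]: for [0 < r], a mollifier of integral 1 supported in
    $[a, a+r]$, on one side of [a] only. *)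
Definition kern r a x : R := r^-1 * flat_bump_mass^-1 * flat_bump (r^-1 * (x - a)).

Lemma kern_continuous r a : continuous (kern r a).
Proof.
apply: smooth_class_continuous.
have -> : kern r a = fun x => r^-1 * flat_bump_mass^-1 *
   (flat 0 (r^-1 * x + - (r^-1 * a)) * flat 0 (- r^-1 * x + (1 + r^-1 * a))).
  apply/funext => x; rewrite /kern /flat_bump mulrBr.
  by congr (_ * (_ * flat _ _)); ring.
by apply: sm_scale; apply: sm_mul; exact: sm_flat.
Qed.

Lemma kern_AC r a : ACR (fun x : R => step (r^-1 * (x - a))) (kern r a).
Proof.
apply: is_derive_AC (@kern_continuous r a) => x.
have -> : kern r a x =
    (flat_bump_mass^-1 * flat_bump (r^-1 * x + - (r^-1 * a))) * r^-1.
  by rewrite /kern mulrBr; ring.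
have -> : (fun y => step (r^-1 * (y - a))) = step \o (fun y => r^-1 * y + - (r^-1 * a)).
  by apply/funext => y; rewrite /= mulrBr.
apply: (@is_derive1_comp _ step (fun y => r^-1 * y + - (r^-1 * a)) x _ _ (step_derive _)).
exact: is_derive_affine.
Qed.

Lemma kern_int r a : 0 < r -> \int[mu]_(x in `[a, a + r]) kern r a x = 1.
Proof.
move=> r0; have [_ <-] := kern_AC r a a (a + r) => //; last by rewrite lerDl ltW.
rewrite [a + r]addrC addrK mulVf ?gt_eqF// step_ge1// subrr mulr0 step_le0//.
by rewrite subr0.
Qed.

Lemma kern_supp r a x : 0 < r -> ~~ (a <= x <= a + r) -> kern r a x = 0.
Proof.
move=> r0; rewrite negb_and -!ltNge /kern => /orP[xa|ax]; rewrite flat_bump_out ?mulr0//.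
  by left; rewrite pmulr_rle0 ?invr_gt0// subr_le0 ltW.
right; rewrite mulrC ler_pdivlMr// mul1r.
by rewrite lerBrDr addrC ltW.
Qed.

Lemma kern_bound r a x : 0 < r -> `|kern r a x| <= r^-1 * flat_bump_mass^-1.
Proof.
move=> r0; rewrite /kern normrM ger0_norm.
  rewrite -[leRHS]mulr1 ler_wpM2l//.
    by rewrite mulr_ge0// invr_ge0 ltW// flat_bump_mass_gt0.
  by rewrite ger0_norm ?flat_bump_le1 ?flat_bump_ge0.
by rewrite mulr_ge0// invr_ge0 ltW// flat_bump_mass_gt0.
Qed.

Definition moll r a u : R := \int[mu]_x (u x * kern r a x).

Lemma itg_mul_cont a b u f : mu.-integrable `[a, b] (EFin \o u) -> continuous f ->
  mu.-integrable `[a, b] (EFin \o (fun x => u x * f x)).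
Proof.
move=> iu cf; have [ab|ba] := leP a b; last first.
  by rewrite set_itv_ge ?bnd_simp -?ltNge//; exact: integrable_set0.
have cf' : {within `[a, b], continuous (fun x => `|f x|)}.
  apply: continuous_subspaceT => x.
  exact: (continuous_comp (cf x) (@norm_continuous _ _ (f x))).
have [c _ Hc] := EVT_max ab cf'.
apply: (@itg_le _ _ _ (fun x => `|f c| * `|u x|)) => //.
- apply: measurable_funM; first exact: itg_meas iu.
  by apply: measurable_funTS; exact: continuous_measurable_fun.
- move=> x /= xab; rewrite normrM mulrC ler_wpM2r//; exact: Hc.
- by apply: itgZ => //; exact: itg_abs.
Qed.

Lemma moll_itg r a u : loc_itg u -> 0 < r ->
  mu.-integrable setT (EFin \o (fun x => u x * kern r a x)).
Proof.
move=> lu r0; apply: (@itg_supp _ a (a + r)).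
  by move=> x /(kern_supp r0) ->; rewrite mulr0.
exact: itg_mul_cont (lu _ _) (@kern_continuous r a).
Qed.

Lemma moll_diff r a u : loc_itg u -> 0 < r ->
  `|moll r a u - u a| <= r^-1 * flat_bump_mass^-1 *
     \int[mu]_(x in `[a, a + r]) `|u x - u a|.
Proof.
move=> lu r0.
have supp x : ~~ (a <= x <= a + r) -> u x * kern r a x = 0.
  by move=> /(kern_supp r0) ->; rewrite mulr0.
have ik := itg_mul_cont (lu a (a + r)) (@kern_continuous r a).
have ik1 : mu.-integrable `[a, a + r] (EFin \o kern r a).
  by apply: cont_itg; apply: continuous_subspaceT; exact: kern_continuous.
have id : mu.-integrable `[a, a + r] (EFin \o (fun x => u x - u a)).
  by apply: itgB => //; exact: itg_cst.
have -> : moll r a u - u a = \int[mu]_(x in `[a, a + r]) ((u x - u a) * kern r a x).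
  rewrite /moll (Rint_supp supp) -[X in _ - X]mul1r -(kern_int a r0).
  rewrite -RintegralZr// -RintegralB//; last first.
    by under [X in _ \o X]eq_fun do rewrite mulrC; exact: itgZ.
  by apply: eq_Rintegral => x _; ring.
have ip := itg_mul_cont id (@kern_continuous r a).
apply: (le_trans (Rint_norm_le _ ip)) => //.
rewrite -RintegralZl//; last exact: itg_abs.
apply: le_Rintegral => //; first exact: itg_abs.
  by apply: itgZ => //; exact: itg_abs.
by move=> x _; rewrite normrM mulrC ler_wpM2r// kern_bound.
Qed.

Lemma locally_itg u : measurable_fun setT u -> loc_itg u ->
  locally_integrable setT u.
Proof.
move=> mu_ lu; split=> //; first exact: openT.
move=> K _ cK; have [M [Mr HM]] := compact_bounded cK.
have sub : K `<=` `[- (M + 1), M + 1]%classic.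
  move=> x Kx; have := HM (M + 1) _ x Kx; rewrite ltrDl => /(_ ltr01).
  by rewrite /= in_itv/= ler_norml.
have /integrableP[mf] := lu (- (M + 1)) (M + 1); apply: le_lt_trans.
apply: ge0_subset_integral => //; first exact: compact_measurable.
by apply/measurable_EFinP/measurableT_comp => //; exact/measurable_EFinP.
Qed.

(** The kernel is at most $1/(r\mu)$, with $\mu$ the mass of the bump, and lives in the ball of
    radius $r$; the error is thus at most $2/\mu$ times the mean of $|u - u(a)|$ over that ball,
    which tends to 0 at a Lebesgue point. *)
Lemma lebesgue_pt_moll u a e : measurable_fun setT u -> loc_itg u ->
  lebesgue_pt u a -> 0 < e ->
  exists2 d, 0 < d & forall r, 0 < r -> r < d -> `|moll r a u - u a| <= e.
Proof.
move=> mu_ lu /fine_cvgP[fin /cvgrPdist_le L] e0.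
have k0 := @flat_bump_mass_gt0 R.
have e1 : 0 < e * flat_bump_mass / 2 by rewrite divr_gt0// mulr_gt0.
have {}L := L _ e1.
have [d /= d0 H] := filterI fin L.
exists d => // r r0 rd.
have [] := H r _ r0.
  by rewrite /= sub0r normrN gtr0_norm.
move=> f1; rewrite /= sub0r normrN => f2.
apply: (le_trans (moll_diff _ lu r0)).
have id c b : mu.-integrable `[c, b] (EFin \o (fun x => u x - u a)).
  by apply: itgB => //; exact: itg_cst.
have sub : `[a, a + r[%classic `<=` ball a r.
  move=> x /=; rewrite in_itv/= => /andP[ax xr].
  by rewrite -ball_normE /= distrC ger0_norm ?subr_ge0// ltrBlDl.
have ib : mu.-integrable (ball a r) (EFin \o (fun x => u x - u a)).
  rewrite ball_itv; apply: integrableS (id (a - r) (a + r)) => //.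
  by apply: subset_itv; rewrite bnd_simp.
have : \int[mu]_(x in `[a, a + r]) `|u x - u a| <= \int[mu]_(x in ball a r) `|u x - u a|.
  rewrite -Rintegral_itv_bndo_bndc; last first.
    apply: itg_abs => //; apply: integrableS (id a (a + r)) => //.
    by apply: subset_itv; rewrite bnd_simp.
  rewrite -lee_fin -!fineK_itg//.
  - apply: ge0_subset_integral => //; first exact: measurable_ball.
    by apply/measurable_EFinP/measurableT_comp => //; exact: itg_meas ib.
  - exact: measurable_ball.
  - by apply: itg_abs => //; exact: measurable_ball.
  - apply: itg_abs => //; apply: integrableS (id a (a + r)) => //.
    by apply: subset_itv; rewrite bnd_simp.
move=> h.
apply: (@le_trans _ _ (r^-1 * flat_bump_mass^-1 * \int[mu]_(x in ball a r) `|u x - u a|)).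
  by apply: ler_wpM2l => //; rewrite mulr_ge0// invr_ge0 ltW.
suff E : fine (davg u a r) = (2 * r)^-1 * \int[mu]_(x in ball a r) `|u x - u a|.
  move: f2; rewrite E ger0_norm; last first.
    by apply: mulr_ge0; [rewrite invr_ge0 mulr_ge0// ltW|exact: Rintegral_ge0].
  set J := \int[mu]_(x in _) _ => f2.
  have -> : r^-1 * flat_bump_mass^-1 * J = 2 / flat_bump_mass * ((2 * r)^-1 * J).
    by field; rewrite !gt_eqF.
  apply: (@le_trans _ _ (2 / flat_bump_mass * (e * flat_bump_mass / 2))).
    by rewrite ler_pM2l// divr_gt0.
  by rewrite le_eqVlt; apply/orP; left; apply/eqP; field; rewrite gt_eqF.
rewrite /davg /iavg lebesgue_measure_ball ?ltW//.
rewrite inver mulrn_eq0/= gt_eqF//= -[r *+ 2]mulr_natl.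
rewrite /= fineK_itg//; first exact: measurable_ball.
by apply: itg_abs => //; exact: measurable_ball.
Qed.

Lemma ae_ex (P : R -> Prop) : (\forall x \ae mu, P x) -> exists x, P x.
Proof.
move=> aeP; apply: contrapT => nP.
have : (\forall x \ae mu, False).
  by apply: aeS aeP => x Px; apply: nP; exists x.
move=> [A [mA A0]] /(_ _)/= sub.
have : mu setT = 0%E.
  apply/eqP; rewrite -measure_le0 -A0; apply: le_measure; rewrite ?inE//.
  by move=> x _; apply: sub.
have := @lebesgue_measure_itv R `[0, 1]; rewrite lte_fin ltr01 => E1 E2.
have : (mu `[0%R, 1%R]%classic <= mu setT)%E by apply: le_measure; rewrite ?inE.
by rewrite E1 E2 -EFinD lee_fin subr0 ler10.
Qed.

(** Testing with a [plateau], whose derivative is [kern r a - kern r b], shows that the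
    mollifications at [a] and [b] agree for every [r]. At two Lebesgue points their limits are [u a]
    and [u b]. *)
Lemma weak_deriv0_cst u : measurable_fun setT u -> loc_itg u ->
  (forall phi, test_function phi -> \int[mu]_x (u x * derive1 phi x) = 0) ->
  exists c, \forall x \ae mu, u x = c.
Proof.
move=> mu_ lu H.
have L := lebesgue_differentiation (locally_itg mu_ lu).
have [a La] := ae_ex L.
exists (u a); apply: aeS L => b Lb.
apply/eqP; rewrite -subr_eq0 -normr_eq0 eq_le normr_ge0 andbT.
apply/ler_addgt0Pr => e e0; rewrite add0r.
have e2 : 0 < e / 2 by rewrite divr_gt0.
have [d d0 Hd] := lebesgue_pt_moll mu_ lu La e2.
have [d' d'0 Hd'] := lebesgue_pt_moll mu_ lu Lb e2.
pose r := Num.min d d' / 2.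
have m0 : 0 < Num.min d d' by rewrite lt_min d0.
have r0 : 0 < r by rewrite divr_gt0.
have rm : r < Num.min d d' by rewrite ltr_pdivrMr// ltr_pMr// ltr1n.
have := Hd r r0 (lt_le_trans rm _); rewrite ge_min lexx => /(_ isT) Ha.
have := Hd' r r0 (lt_le_trans rm _); rewrite ge_min lexx orbT => /(_ isT) Hb.
have E : moll r a u = moll r b u.
  have ri : 0 < r^-1 by rewrite invr_gt0.
  have := H _ (plateau_test a b ri).
  have -> : derive1 (plateau r^-1 a b) = fun x => kern r a x - kern r b x.
    apply/funext => x; rewrite derive1E; have [_ ->] := plateau_derive r^-1 a b x.
    by rewrite /dplateau /kern mulrBr.
  have -> : (fun x => u x * (kern r a x - kern r b x)) =
     (fun x => u x * kern r a x - u x * kern r b x).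
    by apply/funext => x; ring.
  rewrite RintegralB//; [|exact: moll_itg|exact: moll_itg].
  by move=> /eqP; rewrite subr_eq0 => /eqP.
have -> : u b - u a = (moll r a u - u a) - (moll r b u - u b) by rewrite E; ring.
apply: (le_trans (ler_normB _ _)).
by rewrite [leRHS]splitr lerD.
Qed.

(** The difference of [u] and the primitive of [v] has weak derivative 0, hence is constant almost
    everywhere. *)
Lemma weak_AC u v : L2r u -> L2r v ->
  (forall phi, test_function phi ->
    \int[mu]_x (u x * derive1 phi x) = - \int[mu]_x (v x * phi x)) ->
  exists2 w, (\forall x \ae mu, u x = w x) & ACR w v.
Proof.
move=> lu lv H; have lv' := L2_loc_itg lv; have lu' := L2_loc_itg lu.
have ap := AC_prim lv'.
have lp := AC_loc_itg ap.
have [c Hc] : exists c, \forall x \ae mu, u x - prim v x = c.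
  apply: weak_deriv0_cst.
  - apply: measurable_funB; first exact: L2r_meas lu.
    exact: AC_measurable ap.
  - by move=> a b; apply: itgB.
  move=> phi t.
  have -> : (fun x => (u x - prim v x) * derive1 phi x) =
    (fun x => u x * derive1 phi x - prim v x * derive1 phi x).
    by apply/funext => x; ring.
  rewrite RintegralB//; [|exact: itg_test (test_derive1 t)|exact: itg_test (test_derive1 t)].
  by rewrite H// (ibp_test ap t) subrr.
exists (fun x => c + prim v x).
  by apply: aeS Hc => x <-; rewrite subrK.
have := ACD (AC_cst c) ap; by under [X in ACR _ X]eq_fun do rewrite add0r.
Qed.

Lemma L2r_cst c : L2r (fun=> c : R) -> c = 0.
Proof.
move=> [_ /integrableP[_]] /=.
rewrite integral_cst//= => h; apply/eqP; apply: contraTT isT => c0.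
move: h; have -> : lebesgue_measure [set: R] = +oo%E by rewrite -set_itvNyy lebesgue_measure_itv.
by rewrite gt0_muley ?ltxx// lte_fin normr_gt0 sqrf_eq0.
Qed.

(** Such a [g] is orthogonal in particular to derivatives of test functions, hence almost everywhere
    constant, and the only square integrable constant is 0. *)
Lemma weak_eq0 g : L2r g ->
  (forall phi, test_function phi -> \int[mu]_x (g x * phi x) = 0) ->
  \forall x \ae mu, g x = 0.
Proof.
move=> lg H; have lg' := L2_loc_itg lg.
have [c Hc] : exists c, \forall x \ae mu, g x = c.
  apply: weak_deriv0_cst => //; first exact: L2r_meas lg.
  by move=> phi t; apply: H; exact: test_derive1.
have : L2r (fun=> c) by apply: L2r_ae Hc lg.
by move=> /L2r_cst c0; rewrite c0 in Hc.
Qed.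

End WeakDerivative.

(** * Integration by parts on the line, completeness, weak lower semicontinuity *)

Section L2Complete.
Context {R : realType}.
Notation mu := (@lebesgue_measure R).
Implicit Types (u v f g F G phi : R -> R) (x a b : R) (n : nat).

Lemma step_bound x : 0 <= step x <= 1.
Proof.
have mono a b : a <= b -> step a <= step b.
  move=> ab; rewrite -subr_ge0.
  have [_ ->] := @step_AC R a b => //.
  apply: Rintegral_ge0 => y _.
  by rewrite mulr_ge0 ?invr_ge0 ?flat_bump_ge0// ltW// flat_bump_mass_gt0.
have [x0|x0] := leP x 0; first by rewrite step_le0// lexx ler01.
have [x1|x1] := leP 1 x; first by rewrite step_ge1// lexx ler01.
rewrite -[X in X <= step x](@step_le0 R 0)// mono ?(ltW x0)//=.
by rewrite -[leRHS](@step_ge1 R 1)// mono// ltW.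
Qed.

Lemma dplateau_bound l a b x : 0 < l ->
  `|dplateau l a b x| <= l * flat_bump_mass^-1.
Proof.
move=> l0; have k0 := @flat_bump_mass_gt0 R.
have c0 : 0 <= l * flat_bump_mass^-1 by rewrite mulr_ge0 ?invr_ge0 ?ltW.
rewrite /dplateau normrM ger0_norm//.
rewrite -[leRHS]mulr1 ler_wpM2l// ler_norml.
have := flat_bump_ge0 (l * (x - a)); have := flat_bump_le1 (l * (x - a)).
have := flat_bump_ge0 (l * (x - b)); have := flat_bump_le1 (l * (x - b)).
lra.
Qed.

(** With cut-offs $\phi_n$ of slope $O(1/n)$, $\int f\phi_n \to \int f$ by dominated convergence,
    while $\int f\phi_n = -\int F\phi_n' = O(1/n)$. No decay of [F] at infinity has to be
    extracted. *)
Lemma AC_int_eq0 F f : ACR F f -> mu.-integrable setT (EFin \o F) ->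
  mu.-integrable setT (EFin \o f) -> \int[mu]_x f x = 0.
Proof.
move=> Ff iF jf.
(* With $N = n+1$, it rises on $[-2N,-N]$, equals 1 on $[-N,N]$ and falls on $[N,2N]$. *)
pose phi n := plateau n.+1%:R^-1 (- (2 * n.+1%:R)) n.+1%:R : R -> R.
have n0 n : 0 < n.+1%:R^-1 :> R by rewrite invr_gt0 ltr0n.
have t n : test_function (phi n) by exact: plateau_test.
have mphi n : measurable_fun setT (phi n).
  exact: AC_measurable (test_AC (t n)).
have phi1 n x : `|phi n x| <= 1.
  rewrite /phi /plateau ler_norml.
  have := step_bound (n.+1%:R^-1 * (x - - (2 * n.+1%:R))).
  by have := step_bound (n.+1%:R^-1 * (x - n.+1%:R)); lra.
have C1 : (fun n => \int[mu]_x (f x * phi n x)) @ \oo --> \int[mu]_x f x.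
  have D : (fun n => \int[mu]_x (f x * phi n x)%:E)%E @ \oo --> (\int[mu]_x (f x)%:E)%E.
    apply: (@dominated_cvg _ _ _ mu setT _ (fun n x => (f x * phi n x)%:E)
      (EFin \o f) (fun x => `|f x|%:E)) => //.
    - move=> n; apply/measurable_EFinP; apply: measurable_funM.
        exact: itg_meas jf.
      exact: mphi.
    - move=> x _; apply: cvg_near_cst; near=> n.
      have xn : `|x| <= n.+1%:R.
        apply: (@le_trans _ _ n%:R); last by rewrite ler_nat.
        by near: n; exact: nbhs_infty_ger.
      have /andP[x1 x2] : - n.+1%:R <= x <= n.+1%:R by rewrite -ler_norml.
      rewrite /phi /plateau step_ge1 ?step_le0 ?subr0 ?mulr1//=.
        by rewrite pmulr_rle0// subr_le0.
      by rewrite mulrC ler_pdivlMr// mul1r; lra.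
    - exact: itg_abs.
    - by move=> n x _; rewrite /= lee_fin normrM ler_piMr.
  have E n : \int[mu]_x (f x * phi n x) = fine (\int[mu]_x (f x * phi n x)%:E)%E by [].
  apply: fine_cvg; move: D; rewrite (fineK_itg _ jf)//; exact.
have C2 : (fun n => \int[mu]_x (f x * phi n x)) @ \oo --> (0 : R).
  pose K := flat_bump_mass^-1 * \int[mu]_x `|F x|.
  have B n : `|\int[mu]_x (f x * phi n x)| <= n.+1%:R^-1 * K.
    have -> : \int[mu]_x (f x * phi n x) = - \int[mu]_x (F x * derive1 (phi n) x).
      by rewrite (ibp_test Ff (t n)) opprK.
    have dphi : derive1 (phi n) = dplateau n.+1%:R^-1 (- (2 * n.+1%:R)) n.+1%:R.
      apply/funext => x; rewrite derive1E.
      by have [_ ->] := plateau_derive n.+1%:R^-1 (- (2 * n.+1%:R)) n.+1%:R x.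
    have iFd := itg_test (AC_loc_itg Ff) (test_derive1 (t n)).
    rewrite normrN (le_trans (Rint_norm_le _ iFd))//.
    rewrite /K mulrA -RintegralZl//; last exact: itg_abs.
    apply: le_Rintegral => //; first exact: itg_abs.
      by apply: itgZ => //; exact: itg_abs.
    by move=> x _; rewrite normrM mulrC ler_wpM2r// dphi dplateau_bound.
  have H : (fun n => n.+1%:R^-1 * K) @ \oo --> (0 : R).
    by rewrite -(mul0r K); apply: cvgM; [exact: cvg_harmonic|exact: cvg_cst].
  apply/cvgr0Pnorm_le => e e0; near=> n.
  apply: (le_trans (B n)); apply: (le_trans (ler_norm _)).
  by near: n; move: e e0; exact/cvgr0Pnorm_le.
exact: (cvg_unique _ C1 C2).
Unshelve. all: by end_near. Qed.

Lemma AC_parts u u' v v' : ACR u u' -> ACR v v' ->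
  L2r u -> L2r u' -> L2r v -> L2r v' ->
  \int[mu]_x (u x * v' x) = - \int[mu]_x (u' x * v x).
Proof.
move=> uu' vv' lu lu' lv lv'; apply/eqP; rewrite -addr_eq0 addrC.
rewrite -RintegralD//; [|exact: L2r_mul|exact: L2r_mul].
apply/eqP; apply: (AC_int_eq0 (AC_mul uu' vv')); first exact: L2r_mul.
by apply: itgD => //; exact: L2r_mul.
Qed.

Lemma n2_comb a b u v : L2r u -> L2r v ->
  n2 (fun x => a * u x + b * v x) =
    a ^+ 2 * n2 u + 2 * a * b * (\int[mu]_x (u x * v x)) + b ^+ 2 * n2 v.
Proof.
move=> lu lv; have iu := L2r_itg lu; have iv := L2r_itg lv.
have iuv := L2r_mul lu lv.
rewrite /n2 -!RintegralZl// -!RintegralD//; try exact: itgZ.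
  by apply: eq_Rintegral => x _; ring.
by apply: itgD => //; exact: itgZ.
Qed.

Lemma Cauchy_Schwarz u v : L2r u -> L2r v ->
  (\int[mu]_x (u x * v x)) ^+ 2 <= n2 u * n2 v.
Proof.
move=> lu lv; set P := \int[mu]_x _; set A := n2 u; set B := n2 v.
have H t : 0 <= t ^+ 2 * A + 2 * t * P + B.
  have := n2_comb t 1 lu lv; rewrite -/A -/B -/P expr1n mul1r mulr1 => <-.
  exact: n2_ge0.
have A0 : 0 <= A by exact: n2_ge0.
have [A1|] := ltP 0 A.
  have := H (- P / A).
  have -> : (- P / A) ^+ 2 * A + 2 * (- P / A) * P + B = B - P ^+ 2 / A.
    by field; rewrite gt_eqF.
  by rewrite subr_ge0 ler_pdivrMr// mulrC.
move=> A1; have {A0 A1} A0 : A = 0 by apply/eqP; rewrite eq_le A0 A1.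
rewrite A0 mul0r; have [->|P0] := eqVneq P 0; first by rewrite expr0n.
(* When $A = 0$ the quadratic is affine in $t$; at this point its value would be $-1$. *)
have := H (- (B + 1) / (2 * P)); rewrite A0 mulr0 add0r.
have -> : 2 * (- (B + 1) / (2 * P)) * P + B = - 1 by field.
by rewrite ler0N1.
Qed.

Lemma limn_einf_le (w : nat -> \bar R) (M : \bar R) :
  (forall n, (w n <= M)%E) -> (limn_einf w <= M)%E.
Proof.
move=> wM; rewrite limn_einf_lim; apply: lime_le; first exact: is_cvg_einfs.
apply: nearW => n; apply: le_trans (wM n).
by apply: ereal_inf_lbound; exists n => //=.
Qed.

Lemma Rfatou (h : nat -> R -> R) f M : (forall n, measurable_fun setT (h n)) ->
  measurable_fun setT f ->
  (forall x, (fun n => h n x) @ \oo --> f x) -> (forall n x, 0 <= h n x) ->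
  (forall n, mu.-integrable setT (EFin \o h n) /\ \int[mu]_x h n x <= M) ->
  mu.-integrable setT (EFin \o f) /\ \int[mu]_x f x <= M.
Proof.
move=> mh mf hf h0 hM.
have f0 x : 0 <= f x.
  rewrite -(cvg_lim _ (hf x))//; apply: limr_ge; first exact: cvgP (hf x).
  by apply: nearW => n; exact: h0.
have F := @fatou _ _ _ mu setT measurableT (fun n => EFin \o h n)
  (fun n => (measurable_EFinP _ _).2 (mh n)) (fun n x _ => h0 n x).
have {}F : (\int[mu]_x (f x)%:E <= M%:E)%E.
  have -> : (fun x => (f x)%:E) = (fun x => limn_einf (fun n => (EFin \o h n) x)).
    apply/funext => x; apply/esym.
    have : (fun n => (EFin \o h n) x) @ \oo --> (f x)%:E.
      by apply: cvg_EFin; [exact: nearW|exact: hf].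
    by move/cvg_limn_einf_sup => [].
  apply: (le_trans F); apply: limn_einf_le => n.
  by have [i1 i2] := hM n; rewrite /= fineK_itg// lee_fin.
have iF : mu.-integrable setT (EFin \o f).
  by apply/(itg_ge0 (fun x _ => f0 x) mf); apply: le_lt_trans F _; rewrite ltry.
by split=> //; rewrite -lee_fin -fineK_itg.
Qed.

Lemma geo_cauchy (w : nat -> R) (B : R) : 0 <= B ->
  (forall n, `|w n.+1 - w n| <= B * 2^-1 ^+ n) ->
  forall n m, (n <= m)%N -> `|w m - w n| <= 2 * B * 2^-1 ^+ n.
Proof.
move=> B0 H n m /subnK <-; move: (m - n)%N => k {m}.
(* Keeping the remaining tail of the geometric series in the bound lets the induction on [k]
   close. *)
suff : `|w (k + n)%N - w n| <= 2 * B * 2^-1 ^+ n - 2 * B * 2^-1 ^+ (k + n).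
  move=> h; apply: (le_trans h); rewrite gerDl oppr_le0.
  by rewrite mulr_ge0 ?mulr_ge0// exprn_ge0.
elim: k => [|k IH]; first by rewrite add0n !subrr normr0.
have -> : w (k.+1 + n)%N - w n = (w (k + n).+1 - w (k + n)%N) + (w (k + n)%N - w n).
  by rewrite addSn; ring.
apply: (le_trans (ler_normD _ _)); apply: (le_trans (lerD (H _) IH)).
by rewrite addSn exprS; lra.
Qed.

Lemma half_small (e : R) : 0 < e -> exists n, 2^-1 ^+ n < e.
Proof.
move=> e0; have H : (fun n => 2^-1 ^+ n : R) @ \oo --> (0 : R).
  by apply: cvg_expr; rewrite ger0_norm// invf_lt1// ltr1n.
have [n _ Hn] := (cvgr0Pnorm_lt _).1 H _ e0.
exists n; have := Hn n (leqnn n); rewrite /= ger0_norm// exprn_ge0//.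
Qed.

Lemma geo_cvg (w : nat -> R) (B : R) : 0 <= B ->
  (forall n, `|w n.+1 - w n| <= B * 2^-1 ^+ n) -> cvgn w.
Proof.
move=> B0 H; apply/cauchy_cvgP; apply: cauchy_exP => e e0.
have B1 : 0 < 2 * B + 1 by rewrite ltr_wpDl// mulr_ge0.
have [n Hn] := half_small (divr_gt0 e0 B1).
exists (w n); exists n => // m /= nm; rewrite -ball_normE/= distrC.
apply: (le_lt_trans (geo_cauchy B0 H nm)).
move: Hn; rewrite ltr_pdivlMr// mulrC; apply: le_lt_trans.
by rewrite ler_wpM2r ?exprn_ge0// lerDl.
Qed.

Lemma itg_n2 u v : L2r u -> L2r v ->
  mu.-integrable setT (EFin \o (fun x => (u x - v x) ^+ 2)).
Proof. by move=> lu lv; exact: L2r_itg (L2rB lu lv). Qed.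

(* Riesz-Fischer, along rapidly Cauchy sequences: the weights 4^n turn the
   summability of the squared increments into pointwise geometric decay. *)
Lemma L2r_complete (g : nat -> R -> R) : (forall n, L2r (g n)) ->
  (forall n m, (n <= m)%N -> n2 (fun x => g m x - g n x) <= 8^-1 ^+ n) ->
  exists2 G, L2r G & forall n, n2 (fun x => G x - g n x) <= 8^-1 ^+ n.
Proof.
move=> lg C.
pose d n x := 4 ^+ n * (g n.+1 x - g n x) ^+ 2.
have d0 n x : 0 <= d n x by apply: mulr_ge0; [exact: exprn_ge0|exact: sqr_ge0].
have id n : mu.-integrable setT (EFin \o d n) by apply: itgZ => //; exact: itg_n2.
have mdn n : measurable_fun setT (d n) := itg_meas (id n).
pose W x := (\sum_(0 <= n <oo) (d n x)%:E)%E.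
have mW : measurable_fun setT W.
  apply: ge0_emeasurable_sum => //; first by move=> n x _ _; rewrite lee_fin.
  by move=> n _; apply/measurable_EFinP.
have W0 x : (0 <= W x)%E by apply: nneseries_ge0 => n _ _; rewrite lee_fin.
have iW : (\int[mu]_x W x <= 2%:E)%E.
  have mE n : measurable_fun setT (fun x => (d n x)%:E) by exact/measurable_EFinP.
  rewrite (@integral_nneseries _ _ _ mu _ measurableT (fun n x => (d n x)%:E))//;
    last by move=> n x _; rewrite lee_fin.
  apply: lime_le; first by apply: is_cvg_nneseries => n _ _; apply: integral_ge0 => x _; rewrite lee_fin.
  apply: nearW => n.
  (* The $k$-th term is at most $4^k 8^{-k} = 2^{-k}$, and this is the exact partial sum. *)
  apply: (@le_trans _ _ (2 - 2 * 2^-1 ^+ n)%:E); last first.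
    by rewrite lee_fin gerDl oppr_le0 mulr_ge0// exprn_ge0.
  elim: n => [|n IH]; first by rewrite big_geq// expr0 mulr1 subrr.
  rewrite big_nat_recr//=.
  have -> : 2 - 2 * 2^-1 ^+ n.+1 = (2 - 2 * 2^-1 ^+ n) + 2^-1 ^+ n :> R.
    by rewrite exprS; lra.
  rewrite EFinD; apply: leeD => //.
  rewrite fineK_itg// lee_fin /d RintegralZl//; last exact: itg_n2.
  apply: (@le_trans _ _ (4 ^+ n * 8^-1 ^+ n)).
    by rewrite ler_wpM2l ?exprn_ge0// C.
  rewrite -exprMn (_ : 4 * 8^-1 = 2^-1)//; by field.
have fW : {ae mu, forall x, (W x < +oo)%E}.
  have : mu.-integrable setT W.
    apply/integrableP; split=> //.
    apply: (@le_lt_trans _ _ 2%:E); last by rewrite ltry.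
    by under eq_integral => x _ do rewrite gee0_abs//.
  by move=> /(integrable_ae measurableT); apply: aeS => x /(_ I); rewrite ge0_fin_numE.
pose A : set R := [set x | (W x < +oo)%E].
have mA : measurable A.
  have -> : A = setT `&` [set x | (W x < +oo)%E] by rewrite setTI.
  exact: emeasurable_fun_infty_o.
(* Set to 0 off the set of convergence, the sequence converges at every point, which makes its limit
   measurable. *)
pose h n := g n \_ A.
have mh n : measurable_fun setT (h n).
  have mg : measurable_fun A (g n).
    by apply: measurable_funTS; exact: L2r_meas (lg n).
  by apply/(measurable_restrictT _ _).1.
have hg n : \forall x \ae mu, h n x = g n x.
  by apply: aeS fW => x Wx; rewrite /h patchE mem_set.
have hc x : cvgn (fun n => h n x).
  have [Ax|nAx] := pselect (A x); last first.
    have -> : (fun n => h n x) = fun=> 0.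
      by apply/funext => n; rewrite /h patchE memNset.
    exact: is_cvg_cst.
  have -> : (fun n => h n x) = (fun n => g n x).
    by apply/funext => n; rewrite /h patchE mem_set.
  have fx : W x \is a fin_num by rewrite ge0_fin_numE.
  (* With $y = 2^n|g_{n+1}(x)-g_n(x)|$, the series gives $y^2 \le W(x)$, and $y \le 1 + y^2$. *)
  apply: (@geo_cvg _ (1 + fine (W x))).
    by rewrite addr_ge0// fine_ge0.
  move=> n.
  have dW : d n x <= fine (W x).
    rewrite -lee_fin fineK//.
    apply: le_trans (nneseries_lim_ge n.+1 _); last by move=> k _ _; rewrite lee_fin.
    rewrite big_nat_recr//=; apply: leeDr.
    by apply: sume_ge0 => k _; rewrite lee_fin.
  have e0 : 0 < 2 ^+ n :> R by rewrite exprn_gt0.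
  rewrite exprVn ler_pdivlMr// mulrC.
  move: dW; rewrite /d (_ : 4 = 2 ^+ 2); last by ring.
  rewrite -exprM mulnC exprM -exprMn -[X in X ^+ 2 <= _]/(_ * _).
  rewrite -(real_normK (num_real (2 ^+ n * _))) normrM (ger0_norm (ltW e0)).
  set y := _ * `|_|; have y0 : 0 <= y by rewrite mulr_ge0// ltW.
  by have := sqr_ge0 (y - 1); rewrite !expr2; nra.
pose G x := limn (fun n => h n x).
have mG : measurable_fun setT G.
  by apply: (@measurable_fun_cvg _ _ _ _ h) => // x _; exact: hc.
have key n : mu.-integrable setT (EFin \o (fun x => (G x - g n x) ^+ 2)) /\
    \int[mu]_x ((G x - g n x) ^+ 2) <= 8^-1 ^+ n.
  apply: (@Rfatou (fun k x => (h (k + n)%N x - g n x) ^+ 2)).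
  - move=> k; apply: measurable_funX; apply: measurable_funB => //.
    exact: L2r_meas (lg n).
  - apply: measurable_funX; apply: measurable_funB => //.
    exact: L2r_meas (lg n).
  - move=> x; apply: (@cvg_comp _ _ _ (fun k => h (k + n)%N x - g n x) (fun z => z ^+ 2)); last exact: exprn_continuous.
    apply: cvgB; last exact: cvg_cst.
    by rewrite (cvg_shiftn n (fun k => h k x)); exact: hc.
  - by move=> k x; exact: sqr_ge0.
  - move=> k; have E : \forall x \ae mu, (g (k + n)%N x - g n x) ^+ 2 = (h (k + n)%N x - g n x) ^+ 2.
      by apply: aeS (hg (k + n)%N) => x ->.
    have mE : measurable_fun setT (fun x => (h (k + n)%N x - g n x) ^+ 2).
      apply: measurable_funX; apply: measurable_funB => //.
      exact: L2r_meas (lg n).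
    split; first by apply: ae_eq_itg E _ => //; exact: itg_n2.
    rewrite -(ae_eq_Rintegral _ _ mE E)//; last exact: itg_meas (itg_n2 (lg _) (lg _)).
    by apply: C; rewrite leq_addl.
exists G; last by move=> n; exact: (key n).2.
have -> : G = fun x => (G x - g 0%N x) + g 0%N x.
  by apply/funext => x; rewrite subrK.
apply: L2rD => //; split; last exact: (key 0%N).1.
by apply: measurable_funB => //; exact: L2r_meas (lg _).
Qed.

Lemma Rint_mul_cvg (w : nat -> R -> R) u p : L2r u -> (forall n, L2r (w n)) ->
  L2r p -> (fun n => n2 (fun x => u x - w n x)) @ \oo --> (0 : R) ->
  (fun n => \int[mu]_x (w n x * p x)) @ \oo --> \int[mu]_x (u x * p x).
Proof.
move=> lu lw lp C.
apply/cvgrPdist_le => e e0.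
have e1 : 0 < e ^+ 2 / (n2 p + 1) by rewrite divr_gt0//; [exact: exprn_gt0|rewrite ltr_wpDl// n2_ge0].
near=> n.
rewrite -RintegralB//; [|exact: L2r_mul|exact: L2r_mul].
have -> : (fun x => u x * p x - w n x * p x) = (fun x => (u x - w n x) * p x).
  by apply/funext => x; ring.
rewrite -ler_sqr ?nnegrE ?(ltW e0)// real_normK ?num_real//.
apply: (le_trans (Cauchy_Schwarz (L2rB lu (lw n)) lp)).
have : n2 (fun x => u x - w n x) <= e ^+ 2 / (n2 p + 1).
  apply: (le_trans (ler_norm _)).
  by near: n; exact: ((cvgr0Pnorm_le _).1 C _ e1).
rewrite ler_pdivlMr ?ltr_wpDl ?n2_ge0//; apply: le_trans.
by rewrite ler_wpM2l ?n2_ge0// lerDl.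
Unshelve. all: by end_near. Qed.

Lemma test_L2 phi : test_function phi -> L2r phi.
Proof.
move=> t; split; first exact: AC_measurable (test_AC t).
exact: (itg_test (AC_loc_itg (test_AC t)) t).
Qed.

Definition H1 u v := [/\ ACR u v, L2r u & L2r v].

(* A minimising sequence for the norm of the derivative is Cauchy by the
   parallelogram identity. *)
Lemma H1_lsc f M : L2r f ->
  (forall e, 0 < e -> exists u v,
     [/\ H1 u v, n2 (fun x => u x - f x) <= e & n2 v <= M]) ->
  exists u v, [/\ \forall x \ae mu, f x = u x, H1 u v & n2 v <= 2 * M + 4].
Proof.
move=> lf H.
pose K e u v := H1 u v /\ n2 (fun x => u x - f x) <= e.
(* The lower bounds of [n2 v] over all approximations of [f] that are close enough; their supremum
   [D] is the lower limit of the derivative norm along approximations of [f]. *)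
pose S := [set l : R | exists2 e, 0 < e & forall u v, K e u v -> l <= n2 v].
have S0 : S 0 by exists 1 => // u v _; exact: n2_ge0.
have SM l : S l -> l <= M.
  move=> [e e0 hl]; have [u [v [h1 h2 h3]]] := H e e0.
  exact: le_trans (hl u v _) h3.
have hs : has_sup S by split; [exists 0|exists M => l; exact: SM].
pose D := sup S.
have DM : D <= M by apply: ge_sup; [exists 0|move=> l; exact: SM].
have above e y : 0 < e -> 0 < y -> exists u v, K e u v /\ n2 v <= D + y.
  move=> e0 y0; apply: contrapT => nex.
  have SD : S (D + y).
    exists e => // u v Kuv; rewrite leNgt; apply/negP => lt.
    by apply: nex; exists u, v; split=> //; exact: ltW.
  have := sup_upper_bound hs SD; rewrite -/D; lra.
have below y : 0 < y -> exists2 e, 0 < e & forall u v, K e u v -> D - y <= n2 v.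
  move=> y0; have [l [e e0 hl] Dl] := sup_adherent y0 hs.
  by exists e => // u v Kuv; apply: le_trans (hl u v Kuv); exact: ltW.
(* The parallelogram identity gives $2(D+\eta_m) + 2(D+\eta_n) - 4(D-\eta_n) \le 8\eta_n$, which has
   to be $8^{-n}$. *)
pose eta n : R := 8^-1 ^+ n / 8.
have eta0 n : 0 < eta n by rewrite divr_gt0// exprn_gt0.
have exq n : exists q : R * (R -> R) * (R -> R),
    [/\ 0 < q.1.1 <= eta n, K q.1.1 q.1.2 q.2, n2 q.2 <= D + eta n &
        forall u v, K q.1.1 u v -> D - eta n <= n2 v].
  have [e e0 he] := below _ (eta0 n).
  pose e' := Num.min e (eta n).
  have e'0 : 0 < e' by rewrite lt_min e0 eta0.
  have [u [v [Kuv nv]]] := above e' (eta n) e'0 (eta0 n).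
  exists (e', u, v); split=> //=.
    by rewrite e'0 ge_min lexx orbT.
  move=> u' v' [h1 h2]; apply: (he u'); split=> //.
  by apply: (le_trans h2); rewrite ge_min lexx.
pose q n := projT1 (cid (exq n)).
have hq n : [/\ 0 < (q n).1.1 <= eta n, K (q n).1.1 (q n).1.2 (q n).2,
   n2 (q n).2 <= D + eta n & forall u v, K (q n).1.1 u v -> D - eta n <= n2 v].
  exact: (projT2 (cid (exq n))).
pose u n := (q n).1.2; pose v n := (q n).2.
have hu n : H1 (u n) (v n) by have [_ []] := hq n.
have lu n : L2r (u n) by have [] := hu n.
have lv n : L2r (v n) by have [] := hu n.
have eta_le n m : (n <= m)%N -> eta m <= eta n.
  move=> nm; rewrite /eta ler_pM2r ?invr_gt0//.
  by apply: ler_wiXn2l => //; lra.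
have Kmid n m e : (q n).1.1 <= e -> (q m).1.1 <= e ->
    K e (fun x => 2^-1 * u n x + 2^-1 * u m x) (fun x => 2^-1 * v n x + 2^-1 * v m x).
  move=> ne me; have [a1 l1 l1'] := hu n; have [a2 l2 l2'] := hu m.
  have [_ [_ k1] _ _] := hq n; have [_ [_ k2] _ _] := hq m.
  split; first by split; [apply: ACD; exact: ACZ|apply: L2rD; exact: L2rZ|
    apply: L2rD; exact: L2rZ].
  have -> : (fun x => 2^-1 * u n x + 2^-1 * u m x - f x) =
     (fun x => (2^-1 * (u n x - f x)) + (2^-1 * (u m x - f x))).
    by apply/funext => x; field.
  have h1 := L2rB l1 lf; have h2 := L2rB l2 lf.
  apply: (le_trans (n2D_le (L2rZ 2^-1 h1) (L2rZ 2^-1 h2))).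
  rewrite !n2Z//; have := le_trans k1 ne; have := le_trans k2 me.
  by rewrite !expr2; lra.
have C n m : (n <= m)%N -> n2 (fun x => v m x - v n x) <= 8^-1 ^+ n.
  move=> nm.
  (* The midpoint is admissible at the coarser of the two tolerances. These need not decrease with
     the index, hence the two cases. *)
  have mid : D - eta n <= n2 (fun x => 2^-1 * v n x + 2^-1 * v m x).
    have [_ _ _ bn] := hq n; have [_ _ _ bm] := hq m.
    have [le|/ltW le] := leP (q m).1.1 (q n).1.1.
      exact: bn (Kmid n m _ (lexx _) le).
    apply: le_trans (bm _ _ (Kmid n m _ le (lexx _))).
    by rewrite lerD2l lerN2 eta_le.
  have [_ _ nn _] := hq n; have [_ _ nm' _] := hq m.
  have := n2_comb 1 (-1) (lv m) (lv n).
  have := n2_comb 2^-1 2^-1 (lv n) (lv m).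
  have -> : (fun x => 1 * v m x + -1 * v n x) = (fun x => v m x - v n x).
    by apply/funext => x; ring.
  have -> : \int[mu]_x (v m x * v n x) = \int[mu]_x (v n x * v m x).
    by apply: eq_Rintegral => x _; rewrite mulrC.
  rewrite !expr2 => E1 E2; rewrite E1 in mid; rewrite E2.
  have := eta_le _ _ nm; rewrite /eta in mid nn nm' *; rewrite -/(v n) -/(v m) in nn nm'.
  set t := 8^-1 ^+ n in mid nn *; set t' := 8^-1 ^+ m in nm' *.
  lra.
have [V lV hV] := L2r_complete lv C.
(* Comparison with the first term only, which costs the factor 2 and leaves room in the additive
   constant. *)
have hVM : n2 V <= 2 * M + 4.
  have -> : V = fun x => (V x - v 0%N x) + v 0%N x.
    by apply/funext => x; rewrite subrK.
  apply: (le_trans (n2D_le (L2rB lV (lv 0%N)) (lv 0%N))).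
  have := hV 0%N; rewrite expr0 => h; have [_ _ h' _] := hq 0%N.
  by rewrite /eta expr0 -/(v 0%N) in h'; lra.
have small0 (w : nat -> R) : (forall n, 0 <= w n <= 8^-1 ^+ n) -> w @ \oo --> (0 : R).
  move=> hw; apply: (@squeeze_cvgr _ _ _ _ (fun=> 0) (fun n => 8^-1 ^+ n : R)).
  - by apply: nearW => n; exact: hw.
  - exact: cvg_cst.
  - by apply: cvg_expr; rewrite ger0_norm//; lra.
have cV : (fun n => n2 (fun x => V x - v n x)) @ \oo --> (0 : R).
  by apply: small0 => n; rewrite n2_ge0 hV.
have cU : (fun n => n2 (fun x => f x - u n x)) @ \oo --> (0 : R).
  apply: small0 => n; rewrite n2_ge0/=.
  have -> : n2 (fun x => f x - u n x) = n2 (fun x => u n x - f x).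
    by rewrite -[RHS]n2N; congr n2; apply/funext => x; rewrite opprB.
  have [/andP[_ h1] [_ h2] _ _] := hq n.
  apply: (le_trans h2); apply: (le_trans h1); rewrite /eta.
  rewrite ler_pdivrMr// -[leLHS]mulr1 ler_wpM2l ?exprn_ge0//; lra.
have [w fw aw] : exists2 w, (\forall x \ae mu, f x = w x) & ACR w V.
  apply: weak_AC => // phi t.
  have c1 := Rint_mul_cvg lf lu (test_L2 (test_derive1 t)) cU.
  have c2 := Rint_mul_cvg lV lv (test_L2 t) cV.
  have E : (fun n => \int[mu]_x (u n x * derive1 phi x)) =
      (fun n => - \int[mu]_x (v n x * phi x)).
    by apply/funext => n; have [a _ _] := hu n; rewrite (ibp_test a t).
  rewrite E in c1; exact: (cvg_unique _ c1 (cvgN c2)).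
exists w, V; split=> //; split=> //.
by apply: L2r_ae fw lf; exact: AC_measurable aw.
Qed.

End L2Complete.

(** * Approximation of $H^1$ functions by $H^2$ functions *)

Section Regularisation.
Context {R : realType}.
Notation mu := (@lebesgue_measure R).
Implicit Types (u v f g F G phi : R -> R) (x a b k : R) (n : nat).

Lemma ACon_eq a b F f G g : (forall x, a <= x <= b -> F x = G x /\ f x = g x) ->
  ACon a b F f -> ACon a b G g.
Proof.
move=> E [iF eF]; split.
  apply: eq_integrable iF => // x; rewrite inE/= in_itv/= => /E[_ h] .
  by rewrite /= h.
move=> c d ac cd db.
rewrite -(E c _).1 ?ac ?(le_trans cd)// -(E d _).1 ?db ?(le_trans ac)//.
rewrite eF//; apply: eq_Rintegral => x; rewrite inE/= in_itv/= => /andP[cx xd].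
by rewrite (E x _).2// (le_trans ac)// (le_trans xd).
Qed.

Lemma expR_AC k : ACR (fun x => expR (k * x)) (fun x => k * expR (k * x)).
Proof.
have D x : is_derive x 1 (fun y : R => expR (k * y)) (k * expR (k * x)).
  rewrite mulrC.
  apply: (@is_derive1_comp _ expR (fun y => k * y) x) => //.
  have := is_derive_affine k 0 x.
  by under eq_fun do rewrite addr0.
apply: (is_derive_AC D) => x.
apply: (@continuousM _ _ (fun=> k) (fun y => expR (k * y))).
  exact: cst_continuous.
by apply/differentiable_continuous/derivable1_diffP; have [] := D x.
Qed.

(** The solution of $F' + kF = v$ with $F(0) = 0$, by variation of constants. *)
Definition damped k v x : R :=
  expR (- k * x) * prim (fun y => expR (k * y) * v y) x.

Lemma damped0 k v : damped k v 0 = 0.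
Proof. by rewrite /damped prim0 mulr0. Qed.

Lemma damped_AC k v : loc_itg v ->
  ACR (damped k v) (fun x => v x - k * damped k v x).
Proof.
move=> lv.
have ap : ACR (prim (fun y => expR (k * y) * v y)) (fun y => expR (k * y) * v y).
  by apply: AC_prim => a b; apply: ACon_itgM (lv _ _); exact: expR_AC.
have := AC_mul (expR_AC (- k)) ap.
congr ACR; apply/funext => x.
have -> : expR (- k * x) * (expR (k * x) * v x) = v x.
  by rewrite mulrA -expRD -mulrDl addNr mul0r expR0 mul1r.
rewrite /damped; ring.
Qed.

(** An energy estimate: $(F^2)' = 2F(v-kF) \le v^2/k - kF^2$, and the integral of the left side over
    $[0,b]$ is $F(b)^2 \ge 0$. *)
Lemma damped_right k v b : 0 < k -> L2r v -> 0 <= b ->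
  \int[mu]_(x in `[0, b]) (damped k v x ^+ 2) <=
    k ^- 2 * \int[mu]_(x in `[0, b]) (v x ^+ 2).
Proof.
move=> k0 lv b0; have aF := damped_AC k (L2_loc_itg lv).
set F := damped k v in aF *.
have [iE eE] := ACon_mul (aF 0 b) (aF 0 b).
have := eE 0 b (lexx _) b0 (lexx _).
rewrite {3 4}/F damped0 mulr0 subr0 => E.
have iF2 : mu.-integrable `[0, b] (EFin \o (fun x => F x ^+ 2)).
  exact: (AC_loc_itg (AC_mul aF aF)).
have iv2 : mu.-integrable `[0, b] (EFin \o (fun x => v x ^+ 2)).
  by apply: itgT; exact: L2r_itg.
have : 0 <= \int[mu]_(x in `[0, b]) (k^-1 * v x ^+ 2 - k * F x ^+ 2).
  apply: (@le_trans _ _ (F b * F b)); first by rewrite -expr2 sqr_ge0.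
  rewrite E; apply: le_Rintegral => //.
    by apply: itgB => //; exact: itgZ.
  move=> x _; rewrite -subr_ge0.
  have -> : k^-1 * v x ^+ 2 - k * F x ^+ 2 -
    ((v x - k * F x) * F x + F x * (v x - k * F x)) = k^-1 * (v x - k * F x) ^+ 2.
    by field; rewrite gt_eqF.
  by rewrite mulr_ge0 ?sqr_ge0// invr_ge0 ltW.
rewrite RintegralB//; try exact: itgZ.
rewrite !RintegralZl// subr_ge0 mulrC -ler_pdivlMr// => /le_trans; apply.
by rewrite le_eqVlt; apply/orP; left; apply/eqP; field; rewrite gt_eqF.
Qed.

(** The mirror image: the zero of [F] is now at the right end, so the rate has to be negative. *)
Lemma damped_left k v a : 0 < k -> L2r v -> a <= 0 ->
  \int[mu]_(x in `[a, 0]) (damped (- k) v x ^+ 2) <=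
    k ^- 2 * \int[mu]_(x in `[a, 0]) (v x ^+ 2).
Proof.
move=> k0 lv a0; have aF := damped_AC (- k) (L2_loc_itg lv).
set F := damped (- k) v in aF *.
have [iE eE] := ACon_mul (aF a 0) (aF a 0).
have := eE a 0 (lexx _) a0 (lexx _).
rewrite {1 2}/F damped0 mulr0 sub0r => E.
have iF2 : mu.-integrable `[a, 0] (EFin \o (fun x => F x ^+ 2)).
  exact: (AC_loc_itg (AC_mul aF aF)).
have iv2 : mu.-integrable `[a, 0] (EFin \o (fun x => v x ^+ 2)).
  by apply: itgT; exact: L2r_itg.
have : \int[mu]_(x in `[a, 0]) (k * F x ^+ 2 - k^-1 * v x ^+ 2) <= 0.
  apply: (@le_trans _ _ (- (F a * F a))); last by rewrite oppr_le0 -expr2 sqr_ge0.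
  rewrite E; apply: le_Rintegral => //.
    by apply: itgB => //; exact: itgZ.
  move=> x _; rewrite -subr_ge0.
  have -> : (v x - - k * F x) * F x + F x * (v x - - k * F x) -
    (k * F x ^+ 2 - k^-1 * v x ^+ 2) = k^-1 * (v x + k * F x) ^+ 2.
    by field; rewrite gt_eqF.
  by rewrite mulr_ge0 ?sqr_ge0// invr_ge0 ltW.
rewrite RintegralB//; try exact: itgZ.
rewrite !RintegralZl// subr_le0 mulrC -ler_pdivlMr// => /le_trans; apply.
by rewrite le_eqVlt; apply/orP; left; apply/eqP; field; rewrite gt_eqF.
Qed.

Definition sgn0 x : R := if 0 <= x then 1 else -1.

(** The damping acts away from 0 on both sides, which makes the map bounded on $L^2$ of the whole
    line with norm at most $1/k$. *)
Definition bidamped k v x := if 0 <= x then damped k v x else damped (- k) v x.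

Lemma bidamped_pos k v x : 0 <= x -> bidamped k v x = damped k v x.
Proof. by rewrite /bidamped => ->. Qed.

Lemma bidamped_neg k v x : x <= 0 -> bidamped k v x = damped (- k) v x.
Proof.
rewrite le_eqVlt => /predU1P[->|x0]; first by rewrite /bidamped lexx !damped0.
by rewrite /bidamped leNgt x0.
Qed.

Lemma sgn0_neg x : x < 0 -> sgn0 x = -1.
Proof. by rewrite /sgn0 leNgt => ->. Qed.

Lemma bidamped_AC k v : loc_itg v ->
  ACR (bidamped k v) (fun x => v x - k * (sgn0 x * bidamped k v x)).
Proof.
move=> lv; apply: AC_glue0 => [b b0|a a0].
  apply: ACon_eq (damped_AC k lv 0 b) => x /andP[x0 xb].
  by rewrite bidamped_pos// /sgn0 x0 mul1r.
apply: ACon_eq (damped_AC (- k) lv a 0) => x /andP[ax].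
rewrite le_eqVlt => /predU1P[->|x0].
  by rewrite bidamped_pos// !damped0 !mulr0.
by rewrite (bidamped_neg _ _ (ltW x0)) sgn0_neg//; split=> //; ring.
Qed.

(* The value of v at the junction 0 has to be 0 for the two one-sided
   derivatives to agree there. *)
Lemma bidamped_sgn_AC k v : loc_itg v -> v 0 = 0 ->
  ACR (fun x => sgn0 x * bidamped k v x) (fun x => sgn0 x * v x - k * bidamped k v x).
Proof.
move=> lv v0; apply: AC_glue0 => [b b0|a a0].
  apply: ACon_eq (damped_AC k lv 0 b) => x /andP[x0 xb].
  by rewrite bidamped_pos// /sgn0 x0 !mul1r.
apply: ACon_eq (AConZ (-1) (damped_AC (- k) lv a 0)) => x /andP[ax].
rewrite le_eqVlt => /predU1P[->|x0].
  by rewrite bidamped_pos// v0 !damped0 !mulr0 subrr !mulr0.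
by rewrite (bidamped_neg _ _ (ltW x0)) sgn0_neg//; split=> //; ring.
Qed.

Lemma L2r_exhaust g M : measurable_fun setT g ->
  (forall b, 0 <= b -> mu.-integrable `[- b, b] (EFin \o (fun x => g x ^+ 2)) /\
     \int[mu]_(x in `[- b, b]) (g x ^+ 2) <= M) ->
  L2r g /\ n2 g <= M.
Proof.
move=> mg H; pose h n := (fun x => g x ^+ 2) \_ `[- n%:R, n%:R]%classic.
have mg2 : measurable_fun setT (fun x => g x ^+ 2) by exact: measurable_funX.
have [] : mu.-integrable setT (EFin \o (fun x => g x ^+ 2)) /\
    \int[mu]_x (g x ^+ 2) <= M.
  apply: (@Rfatou _ h) => //.
  - move=> n; have mgn : measurable_fun `[- (n%:R : R), n%:R] (fun x => g x ^+ 2).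
      exact: measurable_funTS.
    by apply/(measurable_restrictT _ _).1.
  - move=> x; apply: cvg_near_cst; near=> n; rewrite /h patchE mem_set//=.
    rewrite in_itv/= -ler_norml; near: n; exact: nbhs_infty_ger.
  - by move=> n x; rewrite /h patchE; case: ifP => // _; exact: sqr_ge0.
  - move=> n; have [h1 h2] := H n%:R (ler0n _ _); split.
      exact: (itg_restrict _ _).1.
    by rewrite /h -Rintegral_mkcond.
by move=> i1 i2; split.
Unshelve. all: by end_near. Qed.

Lemma bidamped_L2 k v : 0 < k -> L2r v ->
  L2r (bidamped k v) /\ n2 (bidamped k v) <= k ^- 2 * n2 v.
Proof.
move=> k0 lv; have aB := bidamped_AC k (L2_loc_itg lv).
have aB2 := AC_loc_itg (AC_mul aB aB).
apply: L2r_exhaust; first exact: AC_measurable aB.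
move=> b b0; split; first exact: aB2.
have bn : - b <= 0 by rewrite oppr_le0.
have iv a c : mu.-integrable `[a, c] (EFin \o (fun x => v x ^+ 2)).
  by apply: itgT; exact: L2r_itg.
apply: (@le_trans _ _ (k ^- 2 * \int[mu]_(x in `[- b, b]) (v x ^+ 2))).
  have iB : mu.-integrable `[- b, b] (EFin \o (fun x => bidamped k v x ^+ 2)).
    exact: (aB2 (- b) b).
  rewrite (Rint_split bn b0 iB) (Rint_split bn b0 (iv (- b) b)).
  rewrite mulrDr; apply: lerD.
    apply: le_trans (damped_left k0 lv bn); rewrite le_eqVlt; apply/orP; left.
    apply/eqP/eq_Rintegral => x; rewrite inE/= in_itv/= => /andP[_ x0].
    by rewrite bidamped_neg.
  apply: le_trans (damped_right k0 lv b0); rewrite le_eqVlt; apply/orP; left.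
  apply/eqP/eq_Rintegral => x; rewrite inE/= in_itv/= => /andP[x0 _].
  by rewrite bidamped_pos.
apply: ler_wpM2l; first by rewrite invr_ge0 sqr_ge0.
rewrite Rintegral_mkcond; apply: le_Rintegral => //.
- exact: (itg_restrict _ _).1.
- exact: L2r_itg.
- by move=> x _; rewrite patchE; case: ifP => // _; exact: sqr_ge0.
Qed.

Lemma ae_neq0 : \forall x \ae mu, x != 0.
Proof.
exists [set 0]; split; [exact: measurable_set1|exact: lebesgue_measure_set1|].
by move=> x /= /negP; rewrite negbK => /eqP.
Qed.

Lemma sgn0_meas : measurable_fun setT sgn0.
Proof.
have -> : sgn0 = fun x => if (fun=> 0) x <= id x then 1 else -1 by [].
apply: measurable_fun_ifT => //; exact: measurable_fun_ler.
Qed.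

(** Let $B$ solve $B' = v - k\,\mathrm{sgn}(x)B$ with $k = 1/e$, and $w = u - B$. Then $w' =
    k\,\mathrm{sgn}(x)B$ is again absolutely continuous, $\|B\| \le e\|v\|$, and therefore $\|w'\|
    \le \|v\|$ without loss of a constant. *)
Lemma H1_approx u v e : H1 u v -> 0 < e ->
  exists w w1 w2, [/\ H1 w w1, H1 w1 w2,
    n2 (fun x => w x - u x) <= e ^+ 2 * n2 v & n2 w1 <= n2 v].
Proof.
move=> [auv lu lv] e0; pose k := e^-1; have k0 : 0 < k by rewrite invr_gt0.
have ke : k ^- 2 = e ^+ 2 by rewrite /k exprVn invrK.
(* Changing the density at one point meets the junction condition of [bidamped_sgn_AC]. *)
pose v0 x := if x == 0 then 0 else v x.
have vv0 : \forall x \ae mu, v x = v0 x.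
  by apply: aeS ae_neq0 => x; rewrite /v0 => /negbTE ->.
have mv0 : measurable_fun setT v0.
  apply: measurable_fun_ifT => //; last exact: L2r_meas lv.
  by apply: measurable_fun_eqr.
have lv0 : L2r v0 by exact: L2r_ae vv0 lv.
have nv0 : n2 v = n2 v0 by apply: n2_ae vv0 => //; exact: L2r_meas lv.
have auv0 : ACR u v0 by exact: AC_ae vv0 auv.
have [lB nB] := bidamped_L2 k0 lv0.
have lloc := L2_loc_itg lv0.
have v00 : v0 0 = 0 by rewrite /v0 eqxx.
have aB := bidamped_AC k lloc; have aS := bidamped_sgn_AC k lloc v00.
set B := bidamped k v0 in lB nB aB aS.
have s1 x : `|sgn0 x| <= 1 by rewrite /sgn0; case: ifP => _; rewrite ?normrN normr1.
have ss x : sgn0 x ^+ 2 = 1 by rewrite /sgn0; case: ifP => _; ring.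
have lS : L2r (fun x => sgn0 x * B x) by apply: L2rM s1 lB; exact: sgn0_meas.
have aw : ACR (fun x => u x - B x) (fun x => k * (sgn0 x * B x)).
  have := ACB auv0 aB; congr ACR; apply/funext => x; ring.
exists (fun x => u x - B x), (fun x => k * (sgn0 x * B x)),
  (fun x => k * (sgn0 x * v0 x - k * B x)); split.
- by split=> //; [exact: L2rB|exact: L2rZ].
- split; [exact: ACZ|exact: L2rZ|apply: L2rZ; apply: L2rB; last exact: L2rZ].
  by apply: L2rM s1 lv0; exact: sgn0_meas.
- have -> : (fun x => u x - B x - u x) = fun x => - B x by apply/funext => x; ring.
  by rewrite n2N nv0 -ke.
rewrite n2Z// nv0.
have -> : n2 (fun x => sgn0 x * B x) = n2 B.
  by apply: eq_Rintegral => x _; rewrite exprMn ss mul1r.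
apply: (@le_trans _ _ (k ^+ 2 * (k ^- 2 * n2 v0))).
  by apply: ler_wpM2l nB; exact: sqr_ge0.
by rewrite mulrA mulfV ?mul1r// expf_neq0// gt_eqF.
Qed.

End Regularisation.

(** * Chains of successive derivatives *)

Section SobolevChains.
Context {R : realType}.
Notation mu := (@lebesgue_measure R).
Implicit Types (u f g : R -> R) (x a b k B C K : R) (v w : nat -> R -> R) (m n i j : nat).

(** One representative of each derivative up to order [m] is fixed at once. Entries beyond [m] are
    arbitrary, and [v m] alone need not be continuous. *)
Definition Hs m v B :=
  (forall i, (i <= m)%N -> L2r (v i) /\ n2 (v i) <= B) /\
  (forall i, (i < m)%N -> ACR (v i) (v i.+1)).

Lemma Hs_L2 m v B i : Hs m v B -> (i <= m)%N -> L2r (v i).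
Proof. by move=> [h _] /h []. Qed.

Lemma Hs_n2 m v B i : Hs m v B -> (i <= m)%N -> n2 (v i) <= B.
Proof. by move=> [h _] /h []. Qed.

Lemma Hs_AC m v B i : Hs m v B -> (i < m)%N -> ACR (v i) (v i.+1).
Proof. by move=> [_ h] /h. Qed.

Lemma Hs_H1 m v B i : Hs m v B -> (i < m)%N -> H1 (v i) (v i.+1).
Proof.
by move=> h im; split; [exact: Hs_AC h im|exact: Hs_L2 h (ltnW im)|exact: Hs_L2 h im].
Qed.

Lemma Hs_mono m m' v B B' : (m' <= m)%N -> B <= B' -> Hs m v B -> Hs m' v B'.
Proof.
move=> mm BB [h1 h2]; split.
  by move=> i im; have [l n] := h1 i (leq_trans im mm); split=> //; exact: le_trans BB.
by move=> i im; apply: h2; exact: leq_trans im mm.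
Qed.

Lemma Hs_ge0 m v B : Hs m v B -> 0 <= B.
Proof. by move=> /Hs_n2 /(_ (leq0n m)); apply: le_trans; exact: n2_ge0. Qed.

Definition scons u v i : R -> R := if i is j.+1 then v j else u.

Lemma Hs_cons m u v B : ACR u (v 0%N) -> L2r u -> n2 u <= B -> Hs m v B ->
  Hs m.+1 (scons u v) B.
Proof. by move=> au lu nu [h1 h2]; split=> -[|i] //= im; [exact: h1|exact: h2]. Qed.

Lemma Hs_shift m v B : Hs m.+1 v B -> Hs m (fun i => v i.+1) B.
Proof. by move=> [h1 h2]; split=> i im; [exact: h1|exact: h2]. Qed.

Lemma Hs_add m v w B C : Hs m v B -> Hs m w C ->
  Hs m (fun i x => v i x + w i x) (2 * B + 2 * C).
Proof.
move=> [h1 h2] [g1 g2]; split=> i im.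
  have [l1 n1] := h1 i im; have [l2 n2'] := g1 i im; split; first exact: L2rD.
  by apply: (le_trans (n2D_le l1 l2)); rewrite lerD// ler_pM2l.
by apply: ACD; [exact: h2|exact: g2].
Qed.

Lemma Hs_scale m k v B : Hs m v B -> Hs m (fun i x => k * v i x) (k ^+ 2 * B).
Proof.
move=> [h1 h2]; split=> i im.
  have [l1 n1] := h1 i im; split; first exact: L2rZ.
  by rewrite n2Z// ler_wpM2l// sqr_ge0.
by apply: ACZ; exact: h2.
Qed.

(** Induction on [m] through $(Vv)' = V'v + Vv'$, applied to the two shifted chains. Only the
    existence of a chain with a uniform bound is claimed, which avoids binomial sums. *)
Lemma Hs_mul m K B : 0 <= K -> exists C, forall (Vd : nat -> R -> R) v,
  (forall i, (i <= m)%N -> measurable_fun setT (Vd i) /\ forall x, `|Vd i x| <= K) ->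
  (forall i, (i < m)%N -> ACR (Vd i) (Vd i.+1)) ->
  Hs m v B -> exists w, w 0%N = (fun x => Vd 0%N x * v 0%N x) /\ Hs m w C.
Proof.
move=> K0.
have base (Vd : nat -> R -> R) v : measurable_fun setT (Vd 0%N) ->
    (forall x, `|Vd 0%N x| <= K) -> L2r (v 0%N) -> n2 (v 0%N) <= B ->
    L2r (fun x => Vd 0%N x * v 0%N x) /\ n2 (fun x => Vd 0%N x * v 0%N x) <= K ^+ 2 * B.
  move=> mV VK lv nv; have lVv := L2rM mV VK lv; split=> //.
  apply: (@le_trans _ _ (n2 (fun x => K * v 0%N x))).
    apply: n2_le => //; last exact: L2rZ.
    move=> x; rewrite !exprMn ler_wpM2r ?sqr_ge0//.
    by rewrite -(real_normK (num_real (Vd 0%N x))) ler_sqr ?nnegrE.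
  by rewrite n2Z// ler_wpM2l// sqr_ge0.
elim: m => [|m [C IH]].
  exists (K ^+ 2 * B) => Vd v hV _ hv.
  have [mV VK] := hV 0%N isT.
  have [l1 n1] := base Vd v mV VK (Hs_L2 hv (leq0n _)) (Hs_n2 hv (leq0n _)).
  exists (fun _ x => Vd 0%N x * v 0%N x); split=> //; split=> // i _; by split.
exists (Num.max (K ^+ 2 * B) (2 * C + 2 * C)) => Vd v hV aV hv.
have [mV VK] := hV 0%N isT.
have [l1 n1] := base Vd v mV VK (Hs_L2 hv (leq0n _)) (Hs_n2 hv (leq0n _)).
have [w1 [e1 h1]] : exists w, w 0%N = (fun x => Vd 1%N x * v 0%N x) /\ Hs m w C.
  apply: (IH (fun i => Vd i.+1) v) => [i im|i im|]; [exact: hV|exact: aV|].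
  exact: Hs_mono (leqnSn m) (lexx B) hv.
have [w2 [e2 h2]] : exists w, w 0%N = (fun x => Vd 0%N x * v 1%N x) /\ Hs m w C.
  apply: (IH Vd (fun i => v i.+1)) => [i im|i im|].
  - exact: hV (leqW im).
  - exact: aV (ltnW im).
  - exact: Hs_shift.
exists (scons (fun x => Vd 0%N x * v 0%N x) (fun i x => w1 i x + w2 i x)); split=> //.
apply: Hs_cons => //.
- rewrite e1 e2; apply: AC_mul; [exact: aV|exact: Hs_AC hv _].
- by apply: le_trans n1 _; rewrite le_max lexx.
- apply: Hs_mono (Hs_add h1 h2) => //; by rewrite le_max lexx orbT.
Qed.

End SobolevChains.

(** * Uniqueness of chains, interpolation, weighted integrals *)

Section SobolevChains2.
Context {R : realType}.
Notation mu := (@lebesgue_measure R).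
Implicit Types (u f g p : R -> R) (x a b k B C K : R) (m n i j : nat).

Lemma AC_unique f g f' g' : ACR f f' -> ACR g g' -> L2r f' -> L2r g' ->
  (\forall x \ae mu, f x = g x) -> \forall x \ae mu, f' x = g' x.
Proof.
move=> af ag lf lg fg.
have H : \forall x \ae mu, f' x - g' x = 0.
  apply: weak_eq0; first exact: L2rB.
  move=> phi t.
  have -> : (fun x => (f' x - g' x) * phi x) = (fun x => f' x * phi x - g' x * phi x).
    by apply/funext => x; rewrite mulrBl.
  rewrite RintegralB//; [|exact: L2r_mul (test_L2 t)|exact: L2r_mul (test_L2 t)].
  have := ibp_test af t; have := ibp_test ag t.
  have -> : \int[mu]_x (f x * derive1 phi x) = \int[mu]_x (g x * derive1 phi x).
    have mt : measurable_fun setT (derive1 phi).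
      exact: AC_measurable (test_AC (test_derive1 t)).
    apply: ae_eq_Rintegral => //.
    - by apply: measurable_funM mt; exact: AC_measurable af.
    - by apply: measurable_funM mt; exact: AC_measurable ag.
    - by apply: aeS fg => x ->.
  by move=> -> /oppr_inj ->; rewrite subrr.
by apply: aeS H => x /eqP; rewrite subr_eq0 => /eqP.
Qed.

Lemma Hs_unique m v w B C : Hs m v B -> Hs m w C ->
  (\forall x \ae mu, v 0%N x = w 0%N x) ->
  forall i, (i <= m)%N -> \forall x \ae mu, v i x = w i x.
Proof.
move=> hv hw E0; elim=> [//|i IH] im.
apply: (AC_unique (Hs_AC hv im) (Hs_AC hw im)) (IH (ltnW im)).
  exact: Hs_L2 hv im.
exact: Hs_L2 hw im.
Qed.

(** Integration by parts: $\int f'^2 = -\int f f''$. *)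
Lemma n2_interp f f1 f2 : H1 f f1 -> H1 f1 f2 -> n2 f1 <= (n2 f + n2 f2) / 2.
Proof.
move=> [a0 l0 l1] [a1 _ l2].
have := AC_parts a0 a1 l0 l1 l1 l2.
have -> : \int[mu]_x (f1 x * f1 x) = n2 f1 by apply: eq_Rintegral => x _; rewrite expr2.
move=> E; have := n2_mul_le l0 l2; rewrite E normrN ger0_norm//; exact: n2_ge0.
Qed.

(** The chain [w] takes the place of [v 2]. The first derivative is bounded by interpolation, so
    that [B] does not enter the result: in the application [B] depends on the time, whereas [C] and
    [D] do not. *)
Lemma Hs_extend2 m v w B C D : Hs 2 v B -> Hs m w C ->
  (\forall x \ae mu, v 2%N x = w 0%N x) ->
  n2 (v 0%N) <= D -> C <= D ->
  exists v', v' 0%N = v 0%N /\ Hs m.+2 v' D.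
Proof.
move=> hv hw E nD CD.
have mw : measurable_fun setT (w 0%N) by exact: L2r_meas (Hs_L2 hw (leq0n m)).
have n2w : n2 (v 2%N) <= D.
  rewrite (n2_ae _ mw E); last exact: L2r_meas (Hs_L2 hv _).
  exact: le_trans (Hs_n2 hw (leq0n m)) CD.
exists (scons (v 0%N) (scons (v 1%N) w)); split=> //.
apply: Hs_cons => //=.
- exact: Hs_AC hv _.
- exact: Hs_L2 hv _.
apply: Hs_cons => //=.
- by apply: AC_ae mw E _; exact: Hs_AC hv _.
- exact: Hs_L2 hv _.
- by apply: le_trans (n2_interp (Hs_H1 hv _) (Hs_H1 hv _)) _ => //; lra.
- exact: Hs_mono CD hw.
Qed.

Lemma itg_wuv p K f g : measurable_fun setT p -> (forall x, `|p x| <= K) ->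
  L2r f -> L2r g -> mu.-integrable setT (EFin \o (fun x => p x * (f x * g x))).
Proof.
move=> mp pK lf lg; under [X in _ \o X]eq_fun do rewrite mulrA.
by apply: L2r_mul => //; exact: L2rM pK lf.
Qed.

Definition wn2 (p : R -> R) n f := \int[mu]_x (p x ^+ n * (f x * f x)).

(** * Integral identities with a bounded weight *)

Section Weight.
Variables (p p' : R -> R) (K : R).
Hypotheses (ap : ACR p p') (mp' : measurable_fun setT p')
  (p1 : forall x, 1 <= p x) (pK : forall x, p x <= K)
  (pp' : forall x, p' x ^+ 2 <= 4 * p x).

Lemma weight_gt0 x : 0 < p x. Proof. exact: lt_le_trans (p1 x). Qed.

Lemma weight_meas n : measurable_fun setT (fun x => p x ^+ n).
Proof. by apply: measurable_funX; exact: AC_measurable ap. Qed.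

Lemma weight_bound n x : `|p x ^+ n| <= K ^+ n.
Proof.
have h := weight_gt0 x.
rewrite ger0_norm ?exprn_ge0 ?(ltW h)//; apply: lerXn2r; rewrite ?nnegrE ?(ltW h)//.
by apply: ltW; apply: lt_le_trans (pK x).
Qed.

Lemma weight_itg n f g : L2r f -> L2r g ->
  mu.-integrable setT (EFin \o (fun x => p x ^+ n * (f x * g x))).
Proof. by apply: itg_wuv; [exact: weight_meas|exact: weight_bound]. Qed.

Lemma wn2_ge0 n f : 0 <= wn2 p n f.
Proof.
apply: Rintegral_ge0 => x _; rewrite mulr_ge0 ?exprn_ge0 ?(ltW (weight_gt0 x))//.
by rewrite -expr2 sqr_ge0.
Qed.

Lemma dweight_bound x : `|p' x| <= 2 * K.
Proof.
have h := weight_gt0 x; have K1 : 1 <= K := le_trans (p1 x) (pK x).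
have h4 : p' x ^+ 2 <= (2 * K) ^+ 2.
  by apply: (le_trans (pp' x)); have := pK x; rewrite !expr2; nra.
rewrite -(@ler_pXn2r _ 2)// ?nnegrE//; last lra.
by rewrite real_normK ?num_real.
Qed.

Lemma dweight_itg n f g : L2r f -> L2r g ->
  mu.-integrable setT (EFin \o (fun x => p x ^+ n * p' x * (f x * g x))).
Proof.
apply: (@itg_wuv _ (K ^+ n * (2 * K))).
  by apply: measurable_funM => //; exact: weight_meas.
by move=> x; rewrite normrM ler_pM// ?weight_bound ?dweight_bound.
Qed.

Lemma weight_AC n : ACR (fun x => p x ^+ n.+1) (fun x => n.+1%:R * (p x ^+ n * p' x)).
Proof.
elim: n => [|n IH].
  move: ap; congr ACR; apply/funext => x.
  by rewrite expr0 !mul1r.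
have := AC_mul ap IH; congr ACR; apply/funext => x.
by rewrite !exprS -[n.+2%:R]natr1; ring.
Qed.

(** The integrand is the derivative of $p^{n+1}fg$, and both are integrable. *)
Lemma weight_flux_eq0 n f f1 g g1 : H1 f f1 -> H1 g g1 ->
  mu.-integrable setT (EFin \o
    (fun x => n.+1%:R * (p x ^+ n * p' x * (f x * g x)) +
      (p x ^+ n.+1 * (f1 x * g x) + p x ^+ n.+1 * (f x * g1 x)))) /\
  \int[mu]_x (n.+1%:R * (p x ^+ n * p' x * (f x * g x)) +
      (p x ^+ n.+1 * (f1 x * g x) + p x ^+ n.+1 * (f x * g1 x))) = 0.
Proof.
move=> [af lf lf1] [ag lg lg1].
have i1 : mu.-integrable setT (EFin \o
    (fun x => n.+1%:R * (p x ^+ n * p' x * (f x * g x)) +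
      (p x ^+ n.+1 * (f1 x * g x) + p x ^+ n.+1 * (f x * g1 x)))).
  apply: itgD => //; first by apply: itgZ => //; exact: dweight_itg.
  by apply: itgD => //; exact: weight_itg.
split=> //; apply: AC_int_eq0 (weight_itg n.+1 lf lg) i1.
have := AC_mul (weight_AC n) (AC_mul af ag).
congr ACR; apply/funext => x; ring.
Qed.

(** Integrating $(p^{n+1}ff')'$ trades $p^{n+1}f'^2$ for $p^{n+1}ff''$ and a term in $p'ff'$. The
    constants do not involve the upper bound [K] of the weight, so they are uniform over the family
    of weights. *)
Lemma weight_interp n (eta : R) f f1 f2 : 0 < eta -> H1 f f1 -> H1 f1 f2 ->
  wn2 p n.+1 f1 <= eta * wn2 p n.+2 f + eta^-1 * wn2 p n f2 +
     4 * n.+1%:R ^+ 2 * wn2 p n f.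
Proof.
move=> e0 h h1; have [iD ID] := weight_flux_eq0 n h h1.
have [_ lf lf1] := h; have [_ _ lf2] := h1.
rewrite /wn2 -!RintegralZl//; try exact: weight_itg.
have i1 := weight_itg n.+1 lf1 lf1.
have i2 := itgZ eta measurableT (weight_itg n.+2 lf lf).
have i3 := itgZ eta^-1 measurableT (weight_itg n lf2 lf2).
have i4 := itgZ (4 * n.+1%:R ^+ 2) measurableT (weight_itg n lf lf).
rewrite -!RintegralD//; try exact: itgD.
(* Subtracting twice the vanishing integral turns the claim into a pointwise inequality: one copy
   cancels $p^{n+1}f'^2$, the other leaves it available to complete a square. *)
rewrite -[leLHS]subr0 -[X in _ - X](mulr0 2) -[X in _ - _ * X]ID.
rewrite -RintegralZl// -RintegralB//; last exact: itgZ.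
apply: le_Rintegral => //.
- by apply: itgB => //; exact: itgZ.
- by apply: itgD => //; exact: itgD.
move=> x _; have P := weight_gt0 x; have Q : 0 <= p x ^+ n by rewrite exprn_ge0 ?(ltW P).
rewrite !exprS; set q := p x ^+ n in Q *; set P0 := p x in P *.
set a := f x; set b := f1 x; set c := f2 x; set N := n.+1%:R.
have h4 := pp' x; rewrite -/P0 in h4; set d := p' x in h4 *.
(* The difference of the two sides is exactly $p^n$ times [s1 + s2 + s3]; the last term is where
   $p'^2 \le 4p$ enters. *)
have s1 : 0 <= eta^-1 * (eta * P0 * a + c) ^+ 2.
  by rewrite mulr_ge0 ?sqr_ge0// invr_ge0 ltW.
have s2 : 0 <= P0^-1 * (P0 * b + N * d * a) ^+ 2.
  by rewrite mulr_ge0 ?sqr_ge0// invr_ge0 ltW.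
have s3 : 0 <= P0^-1 * (N ^+ 2 * a ^+ 2 * (4 * P0 - d ^+ 2)).
  rewrite mulr_ge0 ?invr_ge0 ?(ltW P)// mulr_ge0 ?subr_ge0//.
  by rewrite mulr_ge0 ?sqr_ge0.
rewrite -subr_ge0.
have := mulr_ge0 Q (addr_ge0 (addr_ge0 s1 s2) s3).
congr (0 <= _); field; rewrite !gt_eqF//.
Qed.

(** The left side is the time derivative of the weighted mass, as in [wmass_derive]. Two
    integrations by parts leave only terms with $p'$, which are split by Young's inequality using
    $|p'| \le 2\sqrt p$. *)
Lemma weight_flux n (th : R) f f1 f2 g g1 g2 : 0 < th ->
  H1 f f1 -> H1 f1 f2 -> H1 g g1 -> H1 g1 g2 ->
  `|2 * \int[mu]_x (p x ^+ n.+1 * (g x * f2 x) - p x ^+ n.+1 * (f x * g2 x))| <=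
    th * (wn2 p n.+1 f + wn2 p n.+1 g) +
    4 * n.+1%:R ^+ 2 * th^-1 * (wn2 p n f1 + wn2 p n g1).
Proof.
move=> t0 hf hf1 hg hg1.
have [iD ID] := weight_flux_eq0 n hg hf1.
have [iE IE] := weight_flux_eq0 n hf hg1.
have [_ lf lf1] := hf; have [_ _ lf2] := hf1.
have [_ lg lg1] := hg; have [_ _ lg2] := hg1.
have iDE := itgB measurableT iD iE.
have IDE := RintegralB measurableT iD iE; rewrite ID IE subrr in IDE.
have iX : mu.-integrable setT (EFin \o (fun x =>
    p x ^+ n.+1 * (g x * f2 x) - p x ^+ n.+1 * (f x * g2 x))).
  by apply: itgB => //; exact: weight_itg.
(* In the difference of the two flux identities the terms $p^{n+1}f'g'$ cancel. *)
have E : 2 * \int[mu]_x (p x ^+ n.+1 * (g x * f2 x) - p x ^+ n.+1 * (f x * g2 x)) =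
   \int[mu]_x (2 * n.+1%:R * (p x ^+ n * p' x * (f x * g1 x) - p x ^+ n * p' x * (g x * f1 x))).
  rewrite -RintegralZl// -[LHS]subr0 -[X in _ - X](mulr0 2) -[X in _ - _ * X]IDE.
  rewrite -RintegralZl// -RintegralB//; [|exact: itgZ|exact: itgZ].
  apply: eq_Rintegral => x _; ring.
have iY : mu.-integrable setT (EFin \o (fun x =>
    2 * n.+1%:R * (p x ^+ n * p' x * (f x * g1 x) - p x ^+ n * p' x * (g x * f1 x)))).
  by apply: itgZ => //; apply: itgB => //; exact: dweight_itg.
rewrite E; apply: (le_trans (Rint_norm_le _ iY)) => //.
have w i h : L2r h -> mu.-integrable setT (EFin \o (fun x => p x ^+ i * (h x * h x))).
  by move=> lh; exact: weight_itg.
rewrite /wn2 -!RintegralD//; try exact: w.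
have a1 := itgD measurableT (w n.+1 f lf) (w n.+1 g lg).
have a2 := itgD measurableT (w n f1 lf1) (w n g1 lg1).
rewrite -!RintegralZl// -RintegralD//; [|exact: itgZ|exact: itgZ].
apply: le_Rintegral => //; first exact: itg_abs.
  by apply: itgD => //; exact: itgZ.
move=> x _; have P := weight_gt0 x; have Q : 0 <= p x ^+ n by rewrite exprn_ge0 ?(ltW P).
rewrite !exprS; set q := p x ^+ n in Q *; set P0 := p x in P *.
have h4 := pp' x; rewrite -/P0 in h4; set d := p' x in h4 *.
set N := n.+1%:R; set F := f x; set G := g x; set F1 := f1 x; set G1 := g1 x.
have t4 : 0 <= th * (4 * P0 - d ^+ 2) / 4.
  by rewrite divr_ge0// mulr_ge0 ?subr_ge0// ltW.
have ti : 0 <= th^-1 by rewrite invr_ge0 ltW.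
(* Used with both signs of [z], this gives the upper and the lower bound. *)
have key y z : 0 <= th * P0 * y ^+ 2 + 4 * N ^+ 2 * th^-1 * z ^+ 2 + 2 * N * d * y * z.
  have s1 : 0 <= th^-1 * (th * d * y / 2 + 2 * N * z) ^+ 2.
    by rewrite mulr_ge0 ?sqr_ge0.
  have s2 : 0 <= th * (4 * P0 - d ^+ 2) / 4 * y ^+ 2 by rewrite mulr_ge0 ?sqr_ge0.
  have := addr_ge0 s1 s2; congr (0 <= _); field; rewrite gt_eqF//.
rewrite ler_norml; apply/andP; split; rewrite -subr_ge0.
  have := mulr_ge0 Q (addr_ge0 (key F G1) (key G (- F1))).
  congr (0 <= _); ring.
have := mulr_ge0 Q (addr_ge0 (key F (- G1)) (key G F1)).
congr (0 <= _); ring.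
Qed.

End Weight.
End SobolevChains2.

(** * The weights $p_d$ and two elementary growth arguments *)

Section WeightAndGrowth.
Context {R : realType}.
Notation mu := (@lebesgue_measure R).
Implicit Types (x a b k d K M e t : R) (m n i j : nat).

Lemma is_derive_quad d x : is_derive x 1 (fun y : R => 1 + d * (y * y)) (2 * d * x).
Proof.
have h1 : is_derive x 1 (fun y : R => y * y) (x * 1 + x * 1).
  have := @is_deriveM _ _ id id x 1 1 1 (is_derive_id x 1) (is_derive_id x 1).
  by [].
have h2 : is_derive x 1 (fun y : R => d * (y * y)) (d * (x * 1 + x * 1)).
  exact: is_deriveZ.
have h3 : is_derive x 1 (fun y : R => 1 + d * (y * y)) (0 + d * (x * 1 + x * 1)).
  by apply: is_deriveD.
by apply: is_derive_eq h3 _; ring.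
Qed.

Lemma quad_gt0 d x : 0 <= d -> 0 < 1 + d * (x * x).
Proof. by move=> d0; rewrite ltr_pwDl// mulr_ge0// -expr2 sqr_ge0. Qed.

(** Numerator and denominator are written as values of the same quadratic, at parameters 1 and [d],
    so that one derivative lemma serves both. *)
Definition wt d x : R := (1 + 1 * (x * x)) / (1 + d * (x * x)).
Definition dwt d x : R := 2 * (1 - d) * x * ((1 + d * (x * x))^-1 * (1 + d * (x * x))^-1).

Lemma wt_derive d x : 0 <= d -> is_derive x 1 (wt d) (dwt d x).
Proof.
move=> d0; have q0 := quad_gt0 x d0.
have hV := @is_deriveV _ (fun y : R => 1 + d * (y * y)) x _ _ (lt0r_neq0 q0) (is_derive_quad d x).
have := is_deriveM (is_derive_quad 1 x) hV.
rewrite /GRing.scale/= => D; apply: is_derive_eq D _.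
by rewrite /dwt; field; rewrite gt_eqF.
Qed.

Lemma quad_continuous d : continuous (fun y : R => 1 + d * (y * y)).
Proof.
move=> x; apply/differentiable_continuous/derivable1_diffP.
by have [] := is_derive_quad d x.
Qed.

Lemma dwt_continuous d : 0 <= d -> continuous (dwt d).
Proof.
move=> d0 x; have q0 := lt0r_neq0 (quad_gt0 x d0).
have hV : {for x, continuous (fun y : R => (1 + d * (y * y))^-1)}.
  by apply: continuousV => //; exact: quad_continuous.
apply: (continuousM _ (continuousM hV hV)).
have hc : {for x, continuous (fun=> 2 * (1 - d) : R)} by exact: cst_continuous.
have hi : {for x, continuous (fun y : R => y)} by move=> ?.
exact: (continuousM hc hi).
Qed.

Lemma wt_AC d : 0 < d <= 1 -> ACR (wt d) (dwt d).
Proof.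
move=> /andP[/ltW d0 _]; apply: is_derive_AC; last exact: dwt_continuous.
by move=> x; exact: wt_derive.
Qed.

Lemma dwt_meas d : 0 < d <= 1 -> measurable_fun setT (dwt d).
Proof.
by move=> /andP[/ltW d0 _]; apply: continuous_measurable_fun; exact: dwt_continuous.
Qed.

Lemma wt_ge1 d : 0 < d <= 1 -> forall x, 1 <= wt d x.
Proof.
move=> /andP[/ltW d0 d1] x; rewrite /wt ler_pdivlMr ?quad_gt0// !mul1r lerD2l.
by rewrite -[leRHS]mul1r ler_wpM2r// -expr2 sqr_ge0.
Qed.

Lemma wt_le d : 0 < d <= 1 -> forall x, wt d x <= d^-1.
Proof.
move=> /andP[d0 d1] x; rewrite /wt ler_pdivrMr ?quad_gt0 ?(ltW d0)//.
have -> : d^-1 * (1 + d * (x * x)) = d^-1 + 1 * (x * x) by field; rewrite gt_eqF.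
rewrite lerD2r.
by rewrite -invr1 lef_pV2 ?posrE.
Qed.

Lemma wt_le_quad d x : 0 <= d -> wt d x <= 1 + x * x.
Proof.
move=> d0; rewrite /wt mul1r ler_pdivrMr ?quad_gt0//.
have x0 : 0 <= x * x by rewrite -expr2 sqr_ge0.
by rewrite ler_peMr ?addr_ge0// lerDl mulr_ge0.
Qed.

(** With $q = 1 + dx^2 \ge 1$, the square is $4(1-d)^2x^2/q^4 \le 4x^2/q$. *)
Lemma dwt_le d : 0 < d <= 1 -> forall x, dwt d x ^+ 2 <= 4 * wt d x.
Proof.
move=> /andP[/ltW d0 d1] x; have q0 := quad_gt0 x d0; have q1 := quad_gt0 x ler01.
rewrite /dwt /wt; set q := 1 + d * _ in q0 *.
have qg : 1 <= q by rewrite /q lerDl mulr_ge0// -expr2 sqr_ge0.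
have qi : 0 <= q^-1 <= 1 by rewrite invr_ge0 ltW//= invf_le1.
have xx : 0 <= x ^+ 2 by exact: sqr_ge0.
have dd : (1 - d) ^+ 2 <= 1 by rewrite expr2; nra.
have h : q^-1 ^+ 3 <= 1 by apply: exprn_ile1; case/andP: qi.
have h0 : 0 <= q^-1 ^+ 3 by apply: exprn_ge0; case/andP: qi.
have -> : (2 * (1 - d) * x * (q^-1 * q^-1)) ^+ 2 =
   4 * ((1 - d) ^+ 2 * q^-1 ^+ 3 * x ^+ 2) * q^-1 by ring.
rewrite [leRHS]mulrA ler_wpM2r//; first by case/andP: qi.
rewrite ler_wpM2l// mul1r -expr2.
apply: (@le_trans _ _ (1 * x ^+ 2)); last by rewrite mul1r lerDr.
apply: ler_wpM2r => //.
by rewrite -[leRHS]mulr1 ler_pM// sqr_ge0.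
Qed.

(* The left end of the chain is bounded, so by induction each term is a small
   multiple of its successor plus a constant. *)
Lemma mixed_chain m M K i e : (i < m)%N -> 0 < e ->
  exists C, forall al : nat -> R, al 0%N <= M -> (forall i, 0 <= al i) ->
  (forall i eta, (i.+1 < m)%N -> 0 < eta ->
     al i.+1 <= eta * al i.+2 + eta^-1 * al i + K) ->
  al i <= e * al i.+1 + C.
Proof.
elim: i e => [|i IH] e im e0.
  by exists M => al a0 al0 _; apply: (le_trans a0); rewrite lerDr mulr_ge0// ltW.
(* The hypothesis is used with [eta = e / 2] and the induction with [e / 4]: their ratio $1/2$ lets
   half of [al i.+1] be absorbed on the left. *)
have e2 : 0 < e / 2 by rewrite divr_gt0.
have e4 : 0 < e / 4 by rewrite divr_gt0.
have [C HC] := IH _ (ltnW im) e4.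
exists (2 * ((e / 2)^-1 * C + K)) => al a0 al0 H.
have h1 := HC al a0 al0 H.
have h2 := H i (e / 2) im e2.
have h3 : (e / 2)^-1 * al i <= (e / 2)^-1 * (e / 4 * al i.+1 + C).
  by rewrite ler_wpM2l// invr_ge0 ltW.
have h4 : (e / 2)^-1 * (e / 4 * al i.+1 + C) =
  2^-1 * al i.+1 + (e / 2)^-1 * C by field; rewrite gt_eqF.
rewrite h4 in h3; lra.
Qed.

(** Starting from the bound at the right end, [mixed_chain] with [e = 1] carries it down one index
    at a time. The constant is chosen before the sequence, which later gives uniformity in [t] and
    [d]. *)
Lemma mixed_chain_bounded m M K A :
  exists C, forall al : nat -> R, al 0%N <= M -> (forall i, 0 <= al i) ->
  (forall i eta, (i.+1 < m)%N -> 0 < eta ->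
     al i.+1 <= eta * al i.+2 + eta^-1 * al i + K) ->
  al m <= A -> forall i, (i <= m)%N -> al i <= C.
Proof.
suff H : forall j, (j <= m)%N -> exists C, forall al : nat -> R, al 0%N <= M ->
    (forall i, 0 <= al i) ->
    (forall i eta, (i.+1 < m)%N -> 0 < eta ->
      al i.+1 <= eta * al i.+2 + eta^-1 * al i + K) ->
    al m <= A -> forall i, (m - j <= i <= m)%N -> al i <= C.
  have [C HC] := H m (leqnn m).
  by exists C => al h1 h2 h3 h4 i im; apply: (HC al) => //; rewrite subnn im.
elim=> [|j IH] jm.
  exists A => al _ _ _ h i; rewrite subn0 -eqn_leq => /eqP <-; exact: h.
have [C HC] := IH (ltnW jm).
have lt : (m - j.+1 < m)%N by rewrite subnSK// leq_subr.
have [D HD] := @mixed_chain m M K _ 1 lt ltr01.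
exists (Num.max C (C + D)) => al h1 h2 h3 h4 i /andP[].
have S : (m - j.+1).+1 = (m - j)%N by rewrite subnSK.
rewrite leq_eqVlt => /predU1P[<- _|].
  apply: (le_trans (HD al h1 h2 h3)); rewrite mul1r S.
  rewrite le_max; apply/orP; right; rewrite lerD2r.
  by apply: HC => //; rewrite leqnn leq_subr.
rewrite S => mi im; rewrite le_max HC ?mi//.
Qed.

Definition tau t : R := 1 + `|t|.

Lemma tau_ge1 t : 1 <= tau t. Proof. by rewrite /tau lerDl. Qed.
Lemma tau_gt0 t : 0 < tau t. Proof. exact: lt_le_trans (tau_ge1 t). Qed.

(** The factor $1/(1+t)$ is integrating: $(y/(1+t))' \le B(1+t)^{2m}$, which is at most the
    derivative of $B(1+t)^{2m+1}$. Hence [psi] does not increase. *)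
Lemma growth_pos m (y y' : R -> R) B : 0 <= B -> (forall t, 0 <= y t) ->
  (forall t, is_derive t 1 y (y' t)) ->
  y 0 <= B ->
  (forall t, 0 <= t -> y' t <= y t / (1 + t) + B * (1 + t) ^+ m.*2.+1) ->
  forall t, 0 <= t -> y t <= B * (1 + t) ^+ m.*2.+2.
Proof.
move=> B0 yp D y0 H t t0.
pose psi s := y s * (1 + s)^-1 - B * (1 + s) ^+ m.*2.+1.
pose dpsi s := y' s * (1 + s)^-1 - y s * (1 + s)^-1 ^+ 2 - B * (m.*2.+1%:R * (1 + s) ^+ m.*2).
have s1 (s : R) : -1 < s -> 0 < 1 + s by move=> h; lra.
have dA (s : R) : is_derive s 1 (fun z : R => 1 + z) 1.
  have := is_derive_affine 1 1 s; congr is_derive; apply/funext => z; ring.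
have Dpsi (s : R) : -1 < s -> is_derive s 1 psi (dpsi s).
  move=> sm; have sp := s1 s sm.
  have hV := is_deriveV (lt0r_neq0 sp) (dA s).
  have h1 := is_deriveM (D s) hV.
  have hX : is_derive s 1 (fun z : R => (1 + z) ^+ m.*2.+1) (m.*2.+1%:R * (1 + s) ^+ m.*2).
    have := @is_deriveX _ _ _ m.*2.+1 s 1 1 (dA s).
    by rewrite exprfctE /GRing.scale/= mulr1.
  have h2 : is_derive s 1 (fun z : R => B * (1 + z) ^+ m.*2.+1) (B * (m.*2.+1%:R * (1 + s) ^+ m.*2)).
    exact: is_deriveZ.
  have h3 := is_deriveB h1 h2.
  apply: is_derive_eq h3 _; rewrite /GRing.scale/= /dpsi; congr (_ - _).
  by rewrite exprVn; ring.
have neg (s : R) : 0 <= s -> dpsi s <= 0.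
  move=> s0; have sp : 0 < 1 + s by lra.
  have h := H s s0.
  have : y' s * (1 + s)^-1 <= (y s / (1 + s) + B * (1 + s) ^+ m.*2.+1) * (1 + s)^-1.
    by rewrite ler_wpM2r// invr_ge0 ltW.
  have -> : (y s / (1 + s) + B * (1 + s) ^+ m.*2.+1) * (1 + s)^-1 =
    y s * (1 + s)^-1 ^+ 2 + B * (1 + s) ^+ m.*2.
    by rewrite exprS; field; rewrite gt_eqF.
  have : B * (1 + s) ^+ m.*2 <= B * (m.*2.+1%:R * (1 + s) ^+ m.*2).
    by rewrite ler_wpM2l// ler_peMl ?exprn_ge0 ?(ltW sp)// ler1n.
  rewrite /dpsi; lra.
have : psi t <= psi 0.
  apply: (@ler0_derive1_le_cc _ psi 0 t) => //;
    [| | |by rewrite in_itv/= lexx t0|by rewrite in_itv/= lexx t0].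
  - move=> s; rewrite in_itv/= => /andP[s0 _].
    by have [] := Dpsi s (lt_trans (ltrN10 _) s0).
  - move=> s; rewrite in_itv/= => /andP[s0 _].
    rewrite derive1E; have [_ ->] := Dpsi s (lt_trans (ltrN10 _) s0).
    exact: neg (ltW s0).
  - apply: derivable_within_continuous => s; rewrite in_itv/= => /andP[s0 _].
    by have [] := Dpsi s (lt_le_trans (ltrN10 _) s0).
rewrite /psi addr0 invr1 mulr1 expr1n mulr1 => h.
have tp : 0 < 1 + t by lra.
have {}h : y t / (1 + t) <= B * (1 + t) ^+ m.*2.+1 by lra.
by move: h; rewrite ler_pdivrMr// -mulrA -exprSr.
Qed.

Lemma growth m (y y' : R -> R) B : 0 <= B -> (forall t, 0 <= y t) ->
  (forall t, is_derive t 1 y (y' t)) -> y 0 <= B ->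
  (forall t, `|y' t| <= y t / tau t + B * tau t ^+ m.*2.+1) ->
  forall t, y t <= B * tau t ^+ m.*2.+2.
Proof.
move=> B0 yp D y0 H t; have [t0|t0] := leP 0 t.
  rewrite /tau (ger0_norm t0); apply: (@growth_pos m y y') => // s s0.
  by have := H s; rewrite /tau (ger0_norm s0); apply: le_trans; exact: ler_norm.
rewrite /tau (ltr0_norm t0).
have := @growth_pos m (fun s => y (- s)) (fun s => - y' (- s)) B B0.
move=> /(_ (fun s => yp _)); rewrite oppr0 => h.
have tn : 0 <= - t by rewrite oppr_ge0 ltW.
rewrite -{1}[t]opprK; apply: h tn => // s.
  by rewrite -mulrN1; apply: (is_derive1_comp (D (- s))).
move=> s0; have := H (- s); rewrite /tau normrN (ger0_norm s0).
by apply: le_trans; rewrite -normrN; exact: ler_norm.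
Qed.

End WeightAndGrowth.

(** * Passage to real and imaginary parts *)

Section ComplexParts.
Context {R : realType}.
Notation mu := (@lebesgue_measure R).
Implicit Types (f g : R -> R[i]) (u v : R -> R) (n m i s : nat).

Definition re f x := complex.Re (f x).
Definition im f x := complex.Im (f x).

Lemma ReD (x y : R[i]) : complex.Re (x + y) = complex.Re x + complex.Re y.
Proof. by case: x; case: y. Qed.
Lemma ImD (x y : R[i]) : complex.Im (x + y) = complex.Im x + complex.Im y.
Proof. by case: x; case: y. Qed.
Lemma ReN (x : R[i]) : complex.Re (- x) = - complex.Re x.
Proof. by case: x. Qed.
Lemma ImN (x : R[i]) : complex.Im (- x) = - complex.Im x.
Proof. by case: x. Qed.
Lemma ReM (x y : R[i]) : complex.Re (x * y) =
  complex.Re x * complex.Re y - complex.Im x * complex.Im y.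
Proof. by case: x; case: y. Qed.
Lemma ImM (x y : R[i]) : complex.Im (x * y) =
  complex.Re x * complex.Im y + complex.Im x * complex.Re y.
Proof. by case: x; case: y. Qed.
Lemma Re_conj (x : R[i]) : complex.Re (conjc x) = complex.Re x.
Proof. by case: x. Qed.
Lemma Im_conj (x : R[i]) : complex.Im (conjc x) = - complex.Im x.
Proof. by case: x. Qed.
Lemma normc_sqr (x : R[i]) :
  Normc.normc x ^+ 2 = complex.Re x ^+ 2 + complex.Im x ^+ 2.
Proof. by case: x => a b /=; rewrite sqr_sqrtr// addr_ge0 ?sqr_ge0. Qed.

Lemma L2norm2_parts f : L2r (re f) -> L2r (im f) ->
  L2norm2 f = (n2 (re f) + n2 (im f))%:E.
Proof.
move=> lr li; have ir := L2r_itg lr; have ii := L2r_itg li.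
rewrite /L2norm2; under eq_integral do rewrite normc_sqr.
rewrite (fineK_itg (u := fun x => complex.Re (f x) ^+ 2 + complex.Im (f x) ^+ 2))//.
  by rewrite RintegralD.
exact: itgD.
Qed.

Lemma inL2P f : inL2 f <-> L2r (re f) /\ L2r (im f).
Proof.
split=> [[mr mi h]|[lr li]]; last first.
  split; [exact: L2r_meas lr|exact: L2r_meas li|].
  by rewrite L2norm2_parts// ltry.
have mn : measurable_fun setT (fun x => Normc.normc (f x) ^+ 2).
  under eq_fun do rewrite normc_sqr.
  by apply: measurable_funD; exact: measurable_funX.
have i : mu.-integrable setT (EFin \o (fun x => Normc.normc (f x) ^+ 2)).
  by apply/(itg_ge0 _ mn) => // x _; exact: sqr_ge0.
split; [apply: L2r_le i => // x|apply: L2r_le i => // x];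
  rewrite normc_sqr /re /im ?lerDl ?lerDr sqr_ge0//.
Qed.

Lemma inL2_re f : inL2 f -> L2r (re f). Proof. by move=> /inL2P[]. Qed.
Lemma inL2_im f : inL2 f -> L2r (im f). Proof. by move=> /inL2P[]. Qed.

Lemma L2norm2E f : inL2 f -> L2norm2 f = (n2 (re f) + n2 (im f))%:E.
Proof. by move=> /inL2P[lr li]; exact: L2norm2_parts. Qed.

Lemma Re_L2dot f g : inL2 f -> inL2 g -> complex.Re (L2dot f g) =
  \int[mu]_x (re f x * re g x) + \int[mu]_x (im f x * im g x).
Proof.
move=> /inL2P[lfr lfi] /inL2P[lgr lgi].
rewrite /L2dot/= -RintegralD//; [|exact: L2r_mul|exact: L2r_mul].
by apply: eq_Rintegral => x _; rewrite ReM Re_conj Im_conj mulrN opprK.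
Qed.

Definition rwd n u v := forall phi, test_function phi ->
  \int[mu]_x (u x * derive1n n phi x) = (-1) ^+ n * \int[mu]_x (v x * phi x).

Lemma cintegral_mulr f (phi : R -> R) :
  cintegral (fun x => f x * real_complex R (phi x)) =
  Complex (\int[mu]_x (re f x * phi x)) (\int[mu]_x (im f x * phi x)).
Proof.
rewrite /cintegral; congr Complex; apply: eq_Rintegral => x _.
  by rewrite ReM /= mulr0 subr0.
by rewrite ImM /= mulr0 add0r.
Qed.

Lemma sign_mulC n (a b : R) :
  (-1) ^+ n * Complex a b = Complex ((-1) ^+ n * a) ((-1) ^+ n * b) :> R[i].
Proof.
elim: n => [|n IH]; first by rewrite !expr0 !mul1r.
rewrite [in LHS]exprS -mulrA IH mulN1r.
by rewrite !exprS -!mulrA !mulN1r.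
Qed.

Lemma weak_parts n f g : is_weak_derivative n f g <->
  [/\ inL2 f, inL2 g, rwd n (re f) (re g) & rwd n (im f) (im g)].
Proof.
split=> [[lf lg H]|[lf lg Hr Hi]]; split=> // phi t.
- by have := H phi t; rewrite !cintegral_mulr sign_mulC => -[].
- by have := H phi t; rewrite !cintegral_mulr sign_mulC => -[].
- by rewrite !cintegral_mulr sign_mulC Hr// Hi.
Qed.

Lemma Hs_rwd m (v : nat -> R -> R) B n : Hs m v B -> (n <= m)%N -> rwd n (v 0%N) (v n).
Proof.
move=> hv; elim: n => [|n IH] nm phi t; first by rewrite derive1n0 expr0 mul1r.
have := IH (ltnW nm) _ (test_derive1 t).
rewrite -derive1Sn => ->; rewrite (ibp_test (Hs_AC hv nm) t) exprS; ring.
Qed.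

Lemma rwd_ae n u u' v v' : measurable_fun setT u -> measurable_fun setT u' ->
  measurable_fun setT v -> measurable_fun setT v' ->
  (\forall x \ae mu, u x = u' x) -> (\forall x \ae mu, v x = v' x) ->
  rwd n u v -> rwd n u' v'.
Proof.
move=> mu_ mu' mv mv' uu' vv' H phi t; have := H phi t.
have td : test_function (derive1n n phi).
  elim: n {H} => // n IH; rewrite derive1nS; exact: test_derive1.
have mp (p : R -> R) : test_function p -> measurable_fun setT p.
  by move=> tp; exact: AC_measurable (test_AC tp).
have E (w w' p : R -> R) : measurable_fun setT w -> measurable_fun setT w' ->
    (\forall x \ae mu, w x = w' x) -> test_function p ->
    \int[mu]_x (w x * p x) = \int[mu]_x (w' x * p x).
  move=> mw mw' ww' tp; apply: ae_eq_Rintegral => //.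
  - by apply: measurable_funM mw _; exact: mp.
  - by apply: measurable_funM mw' _; exact: mp.
  - by apply: aeS ww' => x ->.
by rewrite (E _ _ _ mu_ mu' uu' td) (E _ _ _ mv mv' vv' t).
Qed.

Lemma rwd_unique n u v v' : L2r v -> L2r v' -> rwd n u v -> rwd n u v' ->
  \forall x \ae mu, v x = v' x.
Proof.
move=> lv lv' H H'.
have E : \forall x \ae mu, v x - v' x = 0.
  apply: weak_eq0; first exact: L2rB.
  move=> phi t; have := H phi t; rewrite (H' phi t) => /mulfI.
  rewrite signr_eq0 => /(_ isT) E.
  under eq_Rintegral do rewrite mulrBl.
  rewrite RintegralB//; [|exact: L2r_mul (test_L2 t)|exact: L2r_mul (test_L2 t)].
  by rewrite E subrr.
by apply: aeS E => x /eqP; rewrite subr_eq0 => /eqP.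
Qed.

(** Each [g n.+1] is the first weak derivative of [g n]: compare order [n] tested with $\phi'$ and
    order [n.+1] tested with $\phi$. Then [weak_AC] applies to every consecutive pair. *)
Lemma rwd_Hs s u (g : nat -> R -> R) : (forall n, (n <= s)%N -> L2r (g n)) ->
  (forall n, (n <= s)%N -> rwd n u (g n)) -> exists (v : nat -> R -> R) B,
  Hs s v B /\ forall n, (n <= s)%N -> \forall x \ae mu, g n x = v n x.
Proof.
move=> lg H.
have ex n : exists w, (n < s)%N ->
    (\forall x \ae mu, g n x = w x) /\ ACR w (g n.+1).
  have [ns|] := boolP (n < s)%N; last by exists (fun=> 0).
  have [||phi t|w h1 h2] := @weak_AC R (g n) (g n.+1).
  - exact: lg (ltnW ns).
  - exact: lg ns.
  - have := H _ (ltnW ns) _ (test_derive1 t); have := H _ ns _ t.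
    rewrite derive1Sn => ->; rewrite exprS -mulrA mulN1r -mulrN => /mulfI.
    by rewrite signr_eq0 => /(_ isT) <-.
  by exists w.
pose w n := projT1 (cid (ex n)).
have hw n : (n < s)%N -> (\forall x \ae mu, g n x = w n x) /\ ACR (w n) (g n.+1).
  exact: (projT2 (cid (ex n))).
(* The highest derivative has no continuous representative and is kept as it is. *)
pose v n := if (n < s)%N then w n else g n.
have gv n : (n <= s)%N -> \forall x \ae mu, g n x = v n x.
  move=> ns; rewrite /v; case: ifPn => [lt|_]; first by have [] := hw n lt.
  exact: aeT.
have mv n : (n <= s)%N -> measurable_fun setT (v n).
  move=> ns; rewrite /v; case: ifPn => [lt|_].
    by have [_] := hw n lt; exact: AC_measurable.
  exact: L2r_meas (lg n ns).
have lv n : (n <= s)%N -> L2r (v n).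
  by move=> ns; apply: L2r_ae (gv n ns) (lg n ns); exact: mv.
exists v, (\sum_(n < s.+1) n2 (v n)); split=> //; split=> n ns.
  split; first exact: lv.
  rewrite (bigD1 (Ordinal (ns : (n < s.+1)%N)))//= lerDl.
  by apply: sumr_ge0 => i _; exact: n2_ge0.
have [_ aw] := hw n ns.
have -> : v n = w n by rewrite /v ns.
by apply: AC_ae (mv _ ns) (gv _ ns) aw.
Qed.

(* [HC m f a b B]: a i, b i are regular representatives of the i-th weak
   derivatives of the real and imaginary parts of f. *)
Definition HC m f (a b : nat -> R -> R) B :=
  [/\ Hs m a B, Hs m b B, \forall x \ae mu, re f x = a 0%N x
    & \forall x \ae mu, im f x = b 0%N x].

Lemma inH_HC s f : inH s f -> exists a b B, HC s f a b B.
Proof.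
move=> [lf H].
have W n : (n <= s)%N -> is_weak_derivative n f (weak_derivative n f).
  by move=> ns; apply: xgetPex; exact: H.
have [a [Ba [ha ga]]] : exists (v : nat -> R -> R) B, Hs s v B /\
    forall n, (n <= s)%N -> \forall x \ae mu, re (weak_derivative n f) x = v n x.
  apply: (@rwd_Hs s (re f)) => n ns; have /weak_parts[_ lg h1 _] := W n ns => //.
  exact: inL2_re.
have [b [Bb [hb gb]]] : exists (v : nat -> R -> R) B, Hs s v B /\
    forall n, (n <= s)%N -> \forall x \ae mu, im (weak_derivative n f) x = v n x.
  apply: (@rwd_Hs s (im f)) => n ns; have /weak_parts[_ lg _ h1] := W n ns => //.
  exact: inL2_im.
(* Even [weak_derivative 0 f] is only a choice, equal to [f] almost everywhere by uniqueness. *)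
have /weak_parts[_ lg h1 h2] := W 0%N (leq0n _).
have id0 (u : R -> R) : rwd 0 u u by move=> phi t; rewrite derive1n0 expr0 mul1r.
exists a, b, (Num.max Ba Bb); split.
- by apply: Hs_mono ha => //; rewrite le_max lexx.
- by apply: Hs_mono hb => //; rewrite le_max lexx orbT.
- apply: (aeS2 (P := fun x => re f x = re (weak_derivative 0 f) x)
    (Q := fun x => re (weak_derivative 0 f) x = a 0%N x)); last exact: ga.
    by move=> x -> ->.
  exact: rwd_unique (inL2_re lf) (inL2_re lg) (id0 _) h1.
- apply: (aeS2 (P := fun x => im f x = im (weak_derivative 0 f) x)
    (Q := fun x => im (weak_derivative 0 f) x = b 0%N x)); last exact: gb.
    by move=> x -> ->.
  exact: rwd_unique (inL2_im lf) (inL2_im lg) (id0 _) h2.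
Qed.

Lemma HC_weak m f a b B n : inL2 f -> HC m f a b B -> (n <= m)%N ->
  is_weak_derivative n f (fun x => Complex (a n x) (b n x)).
Proof.
move=> lf [ha hb ea eb] nm; have la := Hs_L2 ha nm; have lb := Hs_L2 hb nm.
apply/weak_parts; split=> //; first exact/inL2P.
- apply: rwd_ae (Hs_rwd ha nm).
  + exact: L2r_meas (Hs_L2 ha (leq0n _)).
  + exact: L2r_meas (inL2_re lf).
  + exact: L2r_meas la.
  + exact: L2r_meas la.
  + by apply: aeS ea => x.
  + exact: aeT.
- apply: rwd_ae (Hs_rwd hb nm).
  + exact: L2r_meas (Hs_L2 hb (leq0n _)).
  + exact: L2r_meas (inL2_im lf).
  + exact: L2r_meas lb.
  + exact: L2r_meas lb.
  + by apply: aeS eb => x.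
  + exact: aeT.
Qed.

Lemma HC_inH m f a b B : inL2 f -> HC m f a b B -> inH m f.
Proof.
move=> lf h; split=> // n nm.
by exists (fun x => Complex (a n x) (b n x)); exact: HC_weak h nm.
Qed.

Lemma weak_derivative_HC m f a b B n : inL2 f -> HC m f a b B -> (n <= m)%N ->
  [/\ inL2 (weak_derivative n f),
    \forall x \ae mu, re (weak_derivative n f) x = a n x
    & \forall x \ae mu, im (weak_derivative n f) x = b n x].
Proof.
move=> lf h nm.
have /weak_parts[_ l1 r1 i1] := HC_weak lf h nm.
have /weak_parts[_ l2 r2 i2] : is_weak_derivative n f (weak_derivative n f).
  by apply: xgetPex; exists (fun x => Complex (a n x) (b n x)); exact: HC_weak h nm.
split=> //.
- exact: rwd_unique (inL2_re l2) (inL2_re l1) r2 r1.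
- exact: rwd_unique (inL2_im l2) (inL2_im l1) i2 i1.
Qed.

Lemma L2norm2_weak m f a b B n : inL2 f -> HC m f a b B -> (n <= m)%N ->
  L2norm2 (weak_derivative n f) = (n2 (a n) + n2 (b n))%:E.
Proof.
move=> lf h nm; have [l2 er ei] := weak_derivative_HC lf h nm.
have [ha hb _ _] := h.
rewrite L2norm2E// (n2_ae _ _ er) ?(n2_ae _ _ ei)//.
- exact: L2r_meas (inL2_im l2).
- exact: L2r_meas (Hs_L2 hb nm).
- exact: L2r_meas (inL2_re l2).
- exact: L2r_meas (Hs_L2 ha nm).
Qed.

Lemma HC_le m m' f a b B : (m' <= m)%N -> HC m f a b B -> HC m' f a b B.
Proof.
by move=> mm [h1 h2 h3 h4]; split=> //; [exact: Hs_mono (lexx _) h1|exact: Hs_mono (lexx _) h2].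
Qed.

Variables (V : R -> R) (K : R).
Hypotheses (mV : measurable_fun setT V) (VK : forall x, `|V x| <= K).

Definition gen f x : R[i] := Complex 0 1 * schrodinger V f x.

Lemma gen_parts m f a b B : (2 <= m)%N -> inL2 f -> HC m f a b B ->
  [/\ inL2 (gen f),
    \forall x \ae mu, re (gen f) x = - (b 2%N x + V x * b 0%N x) &
    \forall x \ae mu, im (gen f) x = a 2%N x + V x * a 0%N x].
Proof.
move=> m2 lf h; have [l2 er ei] := weak_derivative_HC lf h m2.
have [ha hb ea eb] := h.
have Er x : re (gen f) x = - (im (weak_derivative 2 f) x + V x * im f x).
  rewrite /re /gen ReM /= mul0r mul1r sub0r /schrodinger ImD ImM /=.
  by rewrite mul0r addr0.
have Ei x : im (gen f) x = re (weak_derivative 2 f) x + V x * re f x.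
  rewrite /im /gen ImM /= mul0r mul1r add0r /schrodinger ReD ReM /=.
  by rewrite mul0r subr0.
split.
- apply/inL2P; split.
    rewrite (_ : re (gen f) = fun x => - (im (weak_derivative 2 f) x + V x * im f x)); last exact/funext.
    by apply: L2rN; apply: L2rD; [exact: inL2_im|apply: L2rM VK _ => //; exact: inL2_im].
  rewrite (_ : im (gen f) = fun x => re (weak_derivative 2 f) x + V x * re f x); last exact/funext.
  by apply: L2rD; [exact: inL2_re|apply: L2rM VK _ => //; exact: inL2_re].
- by apply: aeS2 ei eb => x; rewrite Er => -> ->.
- by apply: aeS2 er ea => x; rewrite Ei => -> ->.
Qed.

End ComplexParts.

(** * Propagation of Sobolev regularity by the group *)

Section Flow.
Context {R : realType}.
Notation mu := (@lebesgue_measure R).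
Implicit Types (f g : R -> R[i]) (u v : R -> R) (m n i s : nat) (t h : R).

Definition cn2 f : R := n2 (re f) + n2 (im f).

Lemma cn2_ge0 f : 0 <= cn2 f. Proof. by rewrite addr_ge0 ?n2_ge0. Qed.

Lemma n2_re_le f : n2 (re f) <= cn2 f. Proof. by rewrite lerDl n2_ge0. Qed.
Lemma n2_im_le f : n2 (im f) <= cn2 f. Proof. by rewrite lerDr n2_ge0. Qed.

Lemma inL2_lin (a : R[i]) f g : inL2 f -> inL2 g -> inL2 (fun x => a * f x + g x).
Proof.
move=> /inL2P[fr fi] /inL2P[gr gi]; apply/inL2P; split.
  have -> : re (fun x => a * f x + g x) =
     fun x => (complex.Re a * re f x - complex.Im a * im f x) + re g x.
    by apply/funext => x; rewrite /re /im ReD ReM.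
  by apply: L2rD => //; apply: L2rB; exact: L2rZ.
have -> : im (fun x => a * f x + g x) =
   fun x => (complex.Re a * im f x + complex.Im a * re f x) + im g x.
  by apply/funext => x; rewrite /re /im ImD ImM.
by apply: L2rD => //; apply: L2rD; exact: L2rZ.
Qed.

Lemma inL2B f g : inL2 f -> inL2 g -> inL2 (fun x => f x - g x).
Proof.
move=> lf lg; have := inL2_lin (-1) lg lf.
by under eq_fun do rewrite mulN1r addrC.
Qed.

Lemma inL2Z (k : R) f : inL2 f -> inL2 (fun x => real_complex R k * f x).
Proof.
move=> /inL2P[fr fi]; apply/inL2P; split.
  have -> : re (fun x => real_complex R k * f x) = fun x => k * re f x.
    by apply/funext => x; rewrite /re ReM /= mul0r subr0.
  exact: L2rZ.
have -> : im (fun x => real_complex R k * f x) = fun x => k * im f x.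
  by apply/funext => x; rewrite /im ImM /= mul0r addr0.
exact: L2rZ.
Qed.

Lemma cn2_ae f g : inL2 f -> inL2 g -> (\forall x \ae mu, f x = g x) -> cn2 f = cn2 g.
Proof.
move=> /inL2P[fr fi] /inL2P[gr gi] fg; congr (_ + _); apply: n2_ae.
- exact: L2r_meas fr.
- exact: L2r_meas gr.
- by apply: aeS fg => x; rewrite /re => ->.
- exact: L2r_meas fi.
- exact: L2r_meas gi.
- by apply: aeS fg => x; rewrite /im => ->.
Qed.

Lemma cn2B_sym f g : cn2 (fun x => f x - g x) = cn2 (fun x => g x - f x).
Proof.
congr (_ + _); rewrite -n2N; congr n2; apply/funext => x.
  by rewrite /re !ReD !ReN; ring.
by rewrite /im !ImD !ImN; ring.
Qed.

Lemma reB f g : re (fun x => f x - g x) = fun x => re f x - re g x.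
Proof. by apply/funext => x; rewrite /re ReD ReN. Qed.
Lemma imB f g : im (fun x => f x - g x) = fun x => im f x - im g x.
Proof. by apply/funext => x; rewrite /im ImD ImN. Qed.

Lemma cn2_sub_le f g : inL2 f -> inL2 g ->
  cn2 f <= 2 * cn2 g + 2 * cn2 (fun x => f x - g x).
Proof.
move=> /inL2P[fr fi] /inL2P[gr gi]; rewrite /cn2 reB imB.
have := n2D_le gr (L2rB fr gr); have := n2D_le gi (L2rB fi gi).
have -> : (fun x => re g x + (re f x - re g x)) = re f by apply/funext => x; ring.
have -> : (fun x => im g x + (im f x - im g x)) = im f by apply/funext => x; ring.
lra.
Qed.

Lemma Im_L2dot f g : inL2 f -> inL2 g -> complex.Im (L2dot f g) =
  \int[mu]_x (im f x * re g x) - \int[mu]_x (re f x * im g x).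
Proof.
move=> /inL2P[lfr lfi] /inL2P[lgr lgi].
rewrite /L2dot/= -RintegralB//; [|exact: L2r_mul|exact: L2r_mul].
by apply: eq_Rintegral => x _; rewrite ImM Re_conj Im_conj mulrN addrC.
Qed.

Lemma L2dot_ae f f' g g' : inL2 f -> inL2 f' -> inL2 g -> inL2 g' ->
  (\forall x \ae mu, f x = f' x) -> (\forall x \ae mu, g x = g' x) ->
  complex.Im (L2dot f g) = complex.Im (L2dot f' g').
Proof.
move=> lf lf' lg lg' ff gg; rewrite !Im_L2dot//.
congr (_ - _); apply: ae_eq_Rintegral => //.
- by apply: measurable_funM; [exact: L2r_meas (inL2_im lf)|exact: L2r_meas (inL2_re lg)].
- by apply: measurable_funM; [exact: L2r_meas (inL2_im lf')|exact: L2r_meas (inL2_re lg')].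
- by apply: aeS2 ff gg => x; rewrite /re /im => -> ->.
- by apply: measurable_funM; [exact: L2r_meas (inL2_re lf)|exact: L2r_meas (inL2_im lg)].
- by apply: measurable_funM; [exact: L2r_meas (inL2_re lf')|exact: L2r_meas (inL2_im lg')].
- by apply: aeS2 ff gg => x; rewrite /re /im => -> ->.
Qed.

Variables (V : R -> R) (K : R).
Hypotheses (mV : measurable_fun setT V) (VK : forall x, `|V x| <= K).
Variable (U : R -> (R -> R[i]) -> (R -> R[i])).
Hypothesis (U_group : generated_by_schrodinger V U).

Lemma U_L2 t f : inL2 f -> inL2 (U t f).
Proof. by have [[h _ _ _ _] _] := U_group; exact: h. Qed.

Lemma U_lin t (a : R[i]) f g : inL2 f -> inL2 g -> \forall x \ae mu,
  U t (fun x => a * f x + g x) x = a * U t f x + U t g x.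
Proof.
move=> lf lg; have [[_ h _ _ _] _] := U_group.
by apply: aeS (h t a f g lf lg) => x; apply.
Qed.

Lemma U_dot t f g : inL2 f -> inL2 g -> L2dot (U t f) (U t g) = L2dot f g.
Proof. by move=> lf lg; have [[_ _ h _ _] _] := U_group; exact: h. Qed.

Lemma U_0 f : inL2 f -> \forall x \ae mu, U 0 f x = f x.
Proof.
move=> lf; have [[_ _ _ [h _] _] _] := U_group.
by apply: aeS (h f lf) => x; apply.
Qed.

Lemma U_add t1 t2 f : inL2 f -> \forall x \ae mu, U (t1 + t2) f x = U t1 (U t2 f) x.
Proof.
move=> lf; have [[_ _ _ [_ h] _] _] := U_group.
by apply: aeS (h t1 t2 f lf) => x; apply.
Qed.

Lemma cn2E f : inL2 f -> cn2 f = complex.Re (L2dot f f).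
Proof.
by move=> lf; rewrite Re_L2dot//; congr (_ + _); apply: eq_Rintegral => x _; rewrite expr2.
Qed.

Lemma U_norm t f : inL2 f -> cn2 (U t f) = cn2 f.
Proof. by move=> lf; rewrite !cn2E//; [rewrite U_dot|exact: U_L2]. Qed.

Lemma U_sub t f g : inL2 f -> inL2 g -> \forall x \ae mu,
  U t (fun x => f x - g x) x = U t f x - U t g x.
Proof.
move=> lf lg; have := U_lin t (-1) lg lf.
have -> : (fun x => -1 * g x + f x) = (fun x => f x - g x).
  by apply/funext => x; rewrite mulN1r addrC.
by apply: aeS => x ->; rewrite mulN1r addrC.
Qed.

Lemma U_dist t f g : inL2 f -> inL2 g ->
  cn2 (fun x => U t f x - U t g x) = cn2 (fun x => f x - g x).
Proof.
move=> lf lg; rewrite -(U_norm t (inL2B lf lg)); apply: cn2_ae.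
- by apply: inL2B; exact: U_L2.
- by apply: U_L2; exact: inL2B.
- by apply: aeS (U_sub t lf lg) => x ->.
Qed.

Definition quot f g h x : R[i] := real_complex R h^-1 * (U h f x - f x) - g x.

Lemma quot_L2 f g h : inL2 f -> inL2 g -> inL2 (quot f g h).
Proof.
by move=> lf lg; apply: inL2B => //; apply: inL2Z; apply: inL2B => //; exact: U_L2.
Qed.

Lemma quot_cvg f g : inL2 f -> inL2 g ->
  (L2norm2 (quot f g h) @[h --> (0 : R)^'] --> 0%E) <->
  ((fun h => cn2 (quot f g h)) @ (0 : R)^' --> (0 : R)).
Proof.
move=> lf lg.
have -> : (fun h => L2norm2 (quot f g h)) = (EFin \o (fun h => cn2 (quot f g h))).
  by apply/funext => h; rewrite L2norm2E//; exact: quot_L2.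
split=> [H|H]; last by apply: cvg_EFin => //; exact: nearW.
by have /fine_cvgP[_] := H.
Qed.

Lemma genL2 f : inH 2 f -> inL2 (gen V f).
Proof.
move=> hf; have [a [b [B h]]] := inH_HC hf.
by have [] := gen_parts mV VK (leqnn 2) hf.1 h.
Qed.

Lemma gen_cvg f : inH 2 f -> (fun h => cn2 (quot f (gen V f) h)) @ (0 : R)^' --> (0 : R).
Proof.
move=> hf; have lg := genL2 hf; have [_ G] := U_group.
apply/(quot_cvg hf.1 lg); apply/(G f (gen V f) hf.1 lg); split=> //.
by apply: aeT => x.
Qed.

Lemma gen_conv f g : inL2 f -> inL2 g ->
  (fun h => cn2 (quot f g h)) @ (0 : R)^' --> (0 : R) ->
  inH 2 f /\ \forall x \ae mu, g x = gen V f x.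
Proof.
move=> lf lg /(quot_cvg lf lg); have [_ G] := U_group.
move=> /(G f g lf lg)[h1 h2]; split=> //.
by apply: aeS h2 => x; apply.
Qed.

Lemma U_comm t h f : inL2 f -> \forall x \ae mu, U t (U h f) x = U h (U t f) x.
Proof.
move=> lf; have h1 := U_add t h lf; rewrite addrC in h1.
by apply: aeS2 h1 (U_add h t lf) => x -> .
Qed.

(** As [U t] commutes with [U h], it maps the difference quotient of [f] to that of [U t f], and it
    preserves norms. The quotient at [U t f] thus converges to [U t (gen V f)], and the description
    of the generator, read backwards, puts [U t f] in the domain. *)
Lemma U_gen t f : inH 2 f ->
  inH 2 (U t f) /\ \forall x \ae mu, U t (gen V f) x = gen V (U t f) x.
Proof.
move=> hf; have lf := hf.1; have lg := genL2 hf.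
have lU := U_L2 t lf; have lUg := U_L2 t lg.
apply: gen_conv => //.
suff -> : (fun h => cn2 (quot (U t f) (U t (gen V f)) h)) =
   (fun h => cn2 (quot f (gen V f) h)) by exact: gen_cvg.
apply/funext => h; have lq := quot_L2 h lf lg.
rewrite -(U_norm t lq); apply: cn2_ae; [exact: quot_L2|exact: U_L2|].
have lUh := U_L2 h lf; have lD := inL2B lUh lf.
have := U_sub t (inL2Z h^-1 lD) lg.
(* Linearity is available only for combinations [a * f + g]; scaling is the case [g = 0] and needs
   [U t 0 = 0] almost everywhere. *)
have l0 : inL2 (fun=> 0 : R[i]).
  have := inL2B lf lf; by under eq_fun do rewrite subrr.
have U0 : \forall x \ae mu, U t (fun=> 0) x = 0.
  have := U_sub t lf lf; have -> : (fun x => f x - f x) = fun=> 0.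
    by apply/funext => x; rewrite subrr.
  by apply: aeS => x ->; rewrite subrr.
have := U_lin t (real_complex R h^-1) lD l0.
have -> : (fun x => real_complex R h^-1 * (U h f x - f x) + 0) =
  (fun x => real_complex R h^-1 * (U h f x - f x)).
  by apply/funext => x; rewrite addr0.
move=> e1 e2.
have e3 := aeS2 (S := fun x => U t (fun x => real_complex R h^-1 * (U h f x - f x)) x =
   real_complex R h^-1 * U t (fun x => U h f x - f x) x) _ e1 U0.
have {}e3 := e3 (fun x E E' => etrans E (etrans (congr1 _ E') (addr0 _))).
have e4 := U_sub t lUh lf; have e5 := U_comm t h lf.
have e6 := aeS2 (S := fun x => U t (fun x => U h f x - f x) x = U h (U t f) x - U t f x)
   (fun x E E' => etrans E (congr1 (fun z => z - U t f x) E')) e4 e5.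
have e7 := aeS2 (S := fun x => U t (fun x => real_complex R h^-1 * (U h f x - f x)) x =
   real_complex R h^-1 * (U h (U t f) x - U t f x))
   (fun x E E' => etrans E (congr1 (fun z => real_complex R h^-1 * z) E')) e3 e6.
by apply: aeS2 e2 e7 => x; rewrite /quot => -> ->.
Qed.

(** The imaginary part of $(iAf, f)$ is $(Af, f)$, that is minus the energy; the second derivative
    is integrated by parts. *)
Lemma energyE f a b B : inL2 f -> HC 2 f a b B ->
  complex.Im (L2dot (gen V f) f) = - (n2 (a 1%N) + n2 (b 1%N)) +
    (\int[mu]_x (V x * a 0%N x * a 0%N x) + \int[mu]_x (V x * b 0%N x * b 0%N x)).
Proof.
move=> lf h; have [lg gr gi] := gen_parts mV VK (leqnn 2) lf h.
have [ha hb ea eb] := h; rewrite Im_L2dot//.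
have la i (i2 : (i <= 2)%N) : L2r (a i) := Hs_L2 ha i2.
have lb i (i2 : (i <= 2)%N) : L2r (b i) := Hs_L2 hb i2.
have lVa : L2r (fun x => V x * a 0%N x) by apply: L2rM VK _ => //; exact: la.
have lVb : L2r (fun x => V x * b 0%N x) by apply: L2rM VK _ => //; exact: lb.
have P (v : nat -> R -> R) : Hs 2 v B -> \int[mu]_x (v 2%N x * v 0%N x) = - n2 (v 1%N).
  move=> hv; have [a0 l0 l1] := Hs_H1 hv (isT : (0 < 2)%N).
  have [a1 _ l2] := Hs_H1 hv (isT : (1 < 2)%N).
  have := AC_parts a0 a1 l0 l1 l1 l2.
  under eq_Rintegral do rewrite mulrC; move=> ->.
  by congr (- _); apply: eq_Rintegral => x _; rewrite expr2.
have E1 : \int[mu]_x (im (gen V f) x * re f x) =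
    - n2 (a 1%N) + \int[mu]_x (V x * a 0%N x * a 0%N x).
  rewrite -(P _ ha) -RintegralD//; [|exact: L2r_mul (la 2%N _) (la 0%N _)|exact: L2r_mul lVa (la 0%N _)].
  apply: ae_eq_Rintegral => //.
  - by apply: measurable_funM; [exact: L2r_meas (inL2_im lg)|exact: L2r_meas (inL2_re lf)].
  - apply: measurable_funD.
      exact: itg_meas (L2r_mul (la 2%N _) (la 0%N _)).
    exact: itg_meas (L2r_mul lVa (la 0%N _)).
  - by apply: aeS2 gi ea => x -> ->; rewrite mulrDl.
have E2 : \int[mu]_x (re (gen V f) x * im f x) =
    - (- n2 (b 1%N) + \int[mu]_x (V x * b 0%N x * b 0%N x)).
  have i1 := L2r_mul (lb 2%N (leqnn _)) (lb 0%N (leq0n _)).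
  have i2 := L2r_mul lVb (lb 0%N (leq0n _)).
  rewrite -(P _ hb) -RintegralD// -RintegralN//; last exact: itgD.
  apply: ae_eq_Rintegral => //.
  - by apply: measurable_funM; [exact: L2r_meas (inL2_re lg)|exact: L2r_meas (inL2_im lf)].
  - exact: itg_meas (itgN measurableT (itgD measurableT i1 i2)).
  - by apply: aeS2 gr eb => x -> ->; rewrite mulNr mulrDl.
by rewrite E1 E2; ring.
Qed.

Lemma V_quad u : L2r u -> `|\int[mu]_x (V x * u x * u x)| <= K * n2 u.
Proof.
move=> lu; have lVu := L2rM mV VK lu; have i := L2r_mul lVu lu.
apply: (le_trans (Rint_norm_le _ i)) => //; rewrite /n2 -RintegralZl//; last exact: L2r_itg.
apply: le_Rintegral => //; first exact: itg_abs.
  by apply: itgZ => //; exact: L2r_itg.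
move=> x _; rewrite -mulrA normrM -expr2 (ger0_norm (sqr_ge0 (u x))).
by rewrite ler_wpM2r ?sqr_ge0.
Qed.

Lemma HC_cn2 m f a b B : inL2 f -> HC m f a b B -> cn2 f = n2 (a 0%N) + n2 (b 0%N).
Proof.
move=> lf [ha hb ea eb]; congr (_ + _); apply: n2_ae => //.
- exact: L2r_meas (inL2_re lf).
- exact: L2r_meas (Hs_L2 ha (leq0n _)).
- exact: L2r_meas (inL2_im lf).
- exact: L2r_meas (Hs_L2 hb (leq0n _)).
Qed.

(** Energy conservation follows from [U_gen] and [U_dot]. The potential terms at time 0 and at time
    [t] are each at most [K * cn2 f], whence the factor 2. *)
Lemma energy_bound t f a b B a' b' B' : inL2 f -> HC 2 f a b B ->
  HC 2 (U t f) a' b' B' ->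
  n2 (a' 1%N) + n2 (b' 1%N) <= n2 (a 1%N) + n2 (b 1%N) + 2 * K * cn2 f.
Proof.
move=> lf h h'; have hf := HC_inH lf h; have lU := U_L2 t lf.
have [hU eU] := U_gen t hf; have lg := genL2 hf; have lgU := genL2 hU.
have E : complex.Im (L2dot (gen V (U t f)) (U t f)) = complex.Im (L2dot (gen V f) f).
  rewrite -(U_dot t lg lf); apply: L2dot_ae => //; [exact: U_L2| |exact: aeT].
  by apply: aeS eU => x ->.
rewrite (energyE lf h) (energyE lU h') in E.
have [ha hb _ _] := h; have [ha' hb' _ _] := h'.
have Va := V_quad (Hs_L2 ha (leq0n _)); have Vb := V_quad (Hs_L2 hb (leq0n _)).
have Va' := V_quad (Hs_L2 ha' (leq0n _)); have Vb' := V_quad (Hs_L2 hb' (leq0n _)).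
have c1 := HC_cn2 lf h; have c2 := HC_cn2 lU h'; rewrite U_norm// in c2.
move: Va Vb Va' Vb'; rewrite !ler_norml => /andP[A1 A2] /andP[B1 B2] /andP[A1' A2'] /andP[B1' B2'].
have : 2 * K * cn2 f = K * (n2 (a 0%N) + n2 (b 0%N)) + K * (n2 (a' 0%N) + n2 (b' 0%N)).
  by rewrite -c1 -c2; ring.
rewrite !mulrDr; lra.
Qed.

Definition mkC u v x : R[i] := Complex (u x) (v x).

Lemma Hs2_of u v w : H1 u v -> H1 v w ->
  exists B, Hs 2 (scons u (scons v (fun=> w))) B.
Proof.
move=> [a1 lu lv] [a2 _ lw]; exists (n2 u + n2 v + n2 w).
have := n2_ge0 u; have := n2_ge0 v; have := n2_ge0 w => w0 v0 u0.
split; first by move=> [|[|[|i]]]//= _; split=> //; lra.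
by move=> [|[|i]].
Qed.

Lemma H2_approx f a b B e : inL2 f -> HC 1 f a b B -> 0 < e ->
  exists fe a' b' B', [/\ inL2 fe, HC 2 fe a' b' B',
    cn2 (fun x => fe x - f x) <= e & n2 (a' 1%N) + n2 (b' 1%N) <= 2 * B].
Proof.
move=> lf [ha hb ea eb] e0.
have B0 := Hs_ge0 ha.
(* Then $d^2B \le dB \le e/2$, half of the allowed error for each of the real and imaginary
   parts. *)
pose d := Num.min 1 (e / (2 * (B + 1))).
have eB : 0 < e / (2 * (B + 1)) by rewrite divr_gt0// mulr_gt0// ltr_wpDl.
have d0 : 0 < d by rewrite lt_min ltr01.
have d1 : d <= 1 by rewrite ge_min lexx.
have dB : d ^+ 2 * B <= e / 2.
  have : d <= e / (2 * (B + 1)) by rewrite ge_min lexx orbT.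
  rewrite ler_pdivlMr; last by rewrite mulr_gt0// ltr_wpDl.
  by rewrite expr2; nra.
have [wa [wa1 [wa2 [p1 p2 p3 p4]]]] := H1_approx (Hs_H1 ha (ltnSn 0)) d0.
have [wb [wb1 [wb2 [q1 q2 q3 q4]]]] := H1_approx (Hs_H1 hb (ltnSn 0)) d0.
have [Ba hA] := Hs2_of p1 p2; have [Bb hBb] := Hs2_of q1 q2.
have [_ lwa _] := p1; have [_ lwb _] := q1.
have lm : inL2 (mkC wa wb) by apply/inL2P; split.
have na := Hs_n2 ha (leqnn 1); have nb := Hs_n2 hb (leqnn 1).
exists (mkC wa wb), (scons wa (scons wa1 (fun=> wa2))), (scons wb (scons wb1 (fun=> wb2))),
  (Num.max Ba Bb); split=> //=.
- split; [| |exact: aeT|exact: aeT].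
  + by apply: Hs_mono hA => //; rewrite le_max lexx.
  + by apply: Hs_mono hBb => //; rewrite le_max lexx orbT.
- rewrite /cn2 reB imB.
  have la := inL2_re lf; have lb := inL2_im lf.
  have la0 := Hs_L2 ha (leq0n _); have lb0 := Hs_L2 hb (leq0n _).
  rewrite (@n2_ae _ _ (fun x => wa x - a 0%N x)); last 3 first.
  + exact: L2r_meas (L2rB lwa la).
  + exact: L2r_meas (L2rB lwa la0).
  + by apply: aeS ea => x /= ->.
  rewrite (@n2_ae _ (fun x => im (mkC wa wb) x - im f x) (fun x => wb x - b 0%N x)); last 3 first.
  + exact: L2r_meas (L2rB lwb lb).
  + exact: L2r_meas (L2rB lwb lb0).
  + by apply: aeS eb => x /= ->.
  have d2 : 0 <= d ^+ 2 by exact: sqr_ge0.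
  have h1 : d ^+ 2 * n2 (a 1%N) <= d ^+ 2 * B by rewrite ler_wpM2l.
  have h2 : d ^+ 2 * n2 (b 1%N) <= d ^+ 2 * B by rewrite ler_wpM2l.
  lra.
- lra.
Qed.

Lemma K_ge0 : 0 <= K. Proof. by apply: le_trans (VK 0). Qed.

(** Here [f] need not be in the domain, so the energy is bounded along $H^2$ approximations of [f];
    their images converge to [U t f] because [U t] is an isometry, and [H1_lsc] passes to the
    limit. *)
Lemma flow_H1 f a b B : inL2 f -> HC 1 f a b B ->
  exists C, forall t, exists a' b', HC 1 (U t f) a' b' C.
Proof.
(* The bound of [energy_bound] for approximations within squared distance 1, whose own squared norm
   is at most [2 * cn2 f + 2]. *)
move=> lf h; pose M := 2 * B + 2 * K * (2 * cn2 f + 2).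
have c0 := cn2_ge0 f.
exists (Num.max (cn2 f) (2 * M + 4)) => t.
have lU := U_L2 t lf.
have approx e : 0 < e -> exists a' b' B' fe, [/\ inL2 fe, HC 2 fe a' b' B',
    cn2 (fun x => fe x - U t f x) <= e & n2 (a' 1%N) + n2 (b' 1%N) <= M].
  move=> e0; pose d := Num.min 1 e.
  have d0 : 0 < d by rewrite lt_min ltr01 e0.
  have [fe [a' [b' [B' [lfe hfe dfe nfe]]]]] := H2_approx lf h d0.
  have hf2 := HC_inH lfe hfe.
  have [hU _] := U_gen t hf2.
  have [a2 [b2 [B2 hU2]]] := inH_HC hU.
  exists a2, b2, B2, (U t fe); split=> //; first exact: U_L2.
    by rewrite U_dist//; apply: (le_trans dfe); rewrite ge_min lexx orbT.
  apply: (le_trans (energy_bound lfe hfe hU2)).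
  have := cn2_sub_le lfe lf.
  have : d <= 1 by rewrite ge_min lexx.
  have := K_ge0; rewrite /M => k0 d1 h1.
  have : 2 * K * cn2 fe <= 2 * K * (2 * cn2 f + 2).
    by rewrite ler_wpM2l ?mulr_ge0//; lra.
  lra.
have M2 : 2 * M + 4 <= Num.max (cn2 f) (2 * M + 4) by rewrite le_max lexx orbT.
have M1 : cn2 f <= Num.max (cn2 f) (2 * M + 4) by rewrite le_max lexx.
have build u v : H1 u v -> n2 u <= cn2 f -> n2 v <= 2 * M + 4 ->
    Hs 1 (scons u (fun=> v)) (Num.max (cn2 f) (2 * M + 4)).
  move=> [auv lu lv] nu nv; split; last by move=> [|i].
  by move=> [|[|i]]//= _; split=> //; [exact: le_trans M1|exact: le_trans M2].
have lr := inL2_re lU; have li := inL2_im lU.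
have [u [v [uE huv nv]]] : exists u v, [/\ \forall x \ae mu, re (U t f) x = u x,
    H1 u v & n2 v <= 2 * M + 4].
  apply: H1_lsc => // e e0; have [a' [b' [B' [fe [lfe hfe dfe nfe]]]]] := approx e e0.
  have [ha' hb' ea' eb'] := hfe; exists (a' 0%N), (a' 1%N); split.
  - exact: Hs_H1 ha' _.
  - have -> : n2 (fun x => a' 0%N x - re (U t f) x) = n2 (re (fun x => fe x - U t f x)).
      rewrite reB; apply: n2_ae.
      + exact: L2r_meas (L2rB (Hs_L2 ha' _) lr).
      + exact: L2r_meas (L2rB (inL2_re lfe) lr).
      + by apply: aeS ea' => x ->.
    by apply: le_trans dfe; exact: n2_re_le.
  - by apply: le_trans nfe; rewrite lerDl n2_ge0.
have [w [z [wE hwz nz]]] : exists u v, [/\ \forall x \ae mu, im (U t f) x = u x,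
    H1 u v & n2 v <= 2 * M + 4].
  apply: H1_lsc => // e e0; have [a' [b' [B' [fe [lfe hfe dfe nfe]]]]] := approx e e0.
  have [ha' hb' ea' eb'] := hfe; exists (b' 0%N), (b' 1%N); split.
  - exact: Hs_H1 hb' _.
  - have -> : n2 (fun x => b' 0%N x - im (U t f) x) = n2 (im (fun x => fe x - U t f x)).
      rewrite imB; apply: n2_ae.
      + exact: L2r_meas (L2rB (Hs_L2 hb' _) li).
      + exact: L2r_meas (L2rB (inL2_im lfe) li).
      + by apply: aeS eb' => x ->.
    by apply: le_trans dfe; exact: n2_im_le.
  - by apply: le_trans nfe; rewrite lerDr n2_ge0.
have [_ lu _] := huv; have [_ lw _] := hwz.
exists (scons u (fun=> v)), (scons w (fun=> z)); split=> //=.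
- apply: build => //; rewrite -(n2_ae _ _ uE); [|exact: L2r_meas lr|exact: L2r_meas lu].
  by rewrite -(U_norm t lf) n2_re_le.
- apply: build => //; rewrite -(n2_ae _ _ wE); [|exact: L2r_meas li|exact: L2r_meas lw].
  by rewrite -(U_norm t lf) n2_im_le.
Qed.

Variable (Vd : nat -> R -> R) (r : nat).
Hypotheses (Vd0 : Vd 0%N = V)
  (Vd_bd : forall i, (i <= r)%N -> measurable_fun setT (Vd i) /\ forall x, `|Vd i x| <= K)
  (Vd_AC : forall i, (i < r)%N -> ACR (Vd i) (Vd i.+1)).

Lemma V_mul m B : (m <= r)%N -> exists C, forall v : nat -> R -> R, Hs m v B ->
  exists w, w 0%N = (fun x => V x * v 0%N x) /\ Hs m w C.
Proof.
move=> mr; have [C HC] := Hs_mul m B K_ge0; exists C => v hv.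
rewrite -Vd0; apply: HC => // i im; [apply: Vd_bd|apply: Vd_AC].
  exact: leq_trans mr.
exact: leq_trans mr.
Qed.

Lemma gen_HC m f a b B : (m <= r)%N -> inL2 f -> HC m.+2 f a b B ->
  exists a' b' B', HC m (gen V f) a' b' B'.
Proof.
move=> mr lf h; have m2 : (2 <= m.+2)%N by [].
have [lg gr gi] := gen_parts mV VK m2 lf h.
have [ha hb ea eb] := h.
have hA : Hs m a B by apply: Hs_mono ha => //; exact: leq_trans (leqnSn _) (leqnSn _).
have hB : Hs m b B by apply: Hs_mono hb => //; exact: leq_trans (leqnSn _) (leqnSn _).
have [C VC] := V_mul B mr.
have [wa [ea0 hwa]] := VC a hA; have [wb [eb0 hwb]] := VC b hB.
have sa := Hs_add (Hs_shift (Hs_shift ha)) hwa.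
have sb := Hs_scale (-1) (Hs_add (Hs_shift (Hs_shift hb)) hwb).
exists (fun i x => -1 * (b i.+2 x + wb i x)), (fun i x => a i.+2 x + wa i x),
  (Num.max ((-1) ^+ 2 * (2 * B + 2 * C)) (2 * B + 2 * C)); split.
- by apply: Hs_mono sb => //; rewrite le_max lexx.
- by apply: Hs_mono sa => //; rewrite le_max lexx orbT.
- by apply: aeS gr => x ->; rewrite eb0 mulN1r.
- by apply: aeS gi => x ->; rewrite ea0.
Qed.

(* U t commutes with the generator, and f'' is recovered from gen V f and V f,
   so regularity is propagated two derivatives at a time. *)
Lemma flow_HC m : (m <= r.+2)%N -> forall f a b B, inL2 f -> HC m f a b B ->
  exists C, forall t, exists a' b', HC m (U t f) a' b' C.
Proof.
(* Two consecutive orders are proved together, since the induction advances by 2. *)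
suff H : forall k, ((k <= r.+2)%N -> forall f a b B, inL2 f -> HC k f a b B ->
    exists C, forall t, exists a' b', HC k (U t f) a' b' C) /\
  ((k.+1 <= r.+2)%N -> forall f a b B, inL2 f -> HC k.+1 f a b B ->
    exists C, forall t, exists a' b', HC k.+1 (U t f) a' b' C) by exact: (H m).1.
elim=> [|k [IH0 IH1]]; split=> // kr f a b B lf h.
- exists (cn2 f) => t; have lU := U_L2 t lf.
  exists (fun=> re (U t f)), (fun=> im (U t f)); split; [..|exact: aeT|exact: aeT].
    split=> // i _; split; first exact: inL2_re.
    by rewrite -(U_norm t lf) n2_re_le.
  split=> // i _; split; first exact: inL2_im.
  by rewrite -(U_norm t lf) n2_im_le.
- exact: flow_H1 lf h.
have kr' : (k <= r)%N by [].
have k2 : (k <= k.+2)%N by exact: leq_trans (leqnSn _) (leqnSn _).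
have [ag [bg [Bg hg]]] := gen_HC kr' lf h.
have hf2 : inH 2 f by apply: HC_inH lf (HC_le _ h).
have lg := genL2 hf2.
have kr2 : (k <= r.+2)%N by exact: leq_trans k2 kr.
have [C1 flowg] := IH0 kr2 _ _ _ _ lg hg.
have [C2 flowf] := IH0 kr2 _ _ _ _ lf (HC_le k2 h).
have [C3 mulV] := V_mul C2 kr'.
pose DA := 2 * C1 + 2 * ((-1) ^+ 2 * C3).
pose DB := 2 * ((-1) ^+ 2 * C1) + 2 * ((-1) ^+ 2 * C3).
exists (Num.max (cn2 f) (Num.max DA DB)) => t; set D := Num.max _ _.
have cD : cn2 f <= D by rewrite le_max lexx.
have AD : DA <= D by rewrite !le_max lexx orbT.
have BD : DB <= D by rewrite !le_max lexx !orbT.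
have lU := U_L2 t lf; have [hU eU] := U_gen t hf2.
have [al [be [B2 hab]]] := inH_HC hU.
have [lgU gr gi] := gen_parts mV VK (leqnn 2) lU hab.
have [ag' [bg' [hag hbg eag ebg]]] := flowg t.
have [a' [b' [ha' hb' ea' eb']]] := flowf t.
have [hal hbe eal ebe] := hab.
have [wa [wa0 hwa]] := mulV a' ha'; have [wb [wb0 hwb]] := mulV b' hb'.
have sA := Hs_add hbg (Hs_scale (-1) hwa).
have sB := Hs_add (Hs_scale (-1) hag) (Hs_scale (-1) hwb).
(* Multiplication by $i$ exchanges the parts: the imaginary part of the generator is $a'' + Va$,
   solved here for $a''$. The real part gives $b''$ in the same way. *)
have EA : \forall x \ae mu, al 2%N x = bg' 0%N x + -1 * wa 0%N x.
  have e1 : \forall x \ae mu, im (gen V (U t f)) x = bg' 0%N x.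
    by apply: aeS2 eU ebg => x E <-; rewrite /im E.
  have e2 : \forall x \ae mu, al 0%N x = a' 0%N x.
    by apply: aeS2 eal ea' => x <- <-.
  have e3 : \forall x \ae mu, al 2%N x + V x * al 0%N x = bg' 0%N x.
    by apply: aeS2 gi e1 => x <- <-.
  by apply: aeS2 e2 e3 => x E <-; rewrite wa0 E; ring.
have EB : \forall x \ae mu, be 2%N x = -1 * ag' 0%N x + -1 * wb 0%N x.
  have e1 : \forall x \ae mu, re (gen V (U t f)) x = ag' 0%N x.
    by apply: aeS2 eU eag => x E <-; rewrite /re E.
  have e2 : \forall x \ae mu, be 0%N x = b' 0%N x.
    by apply: aeS2 ebe eb' => x <- <-.
  have e3 : \forall x \ae mu, - (be 2%N x + V x * be 0%N x) = ag' 0%N x.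
    by apply: aeS2 gr e1 => x <- <-.
  by apply: aeS2 e2 e3 => x E <-; rewrite wb0 E; ring.
have cU := HC_cn2 lU hab; rewrite U_norm// in cU.
have [vA [vA0 hvA]] : exists v' : nat -> R -> R, v' 0%N = al 0%N /\ Hs k.+2 v' D.
  apply: (Hs_extend2 hal sA EA) => //.
  by apply: le_trans cD; rewrite cU lerDl n2_ge0.
have [vB [vB0 hvB]] : exists v' : nat -> R -> R, v' 0%N = be 0%N /\ Hs k.+2 v' D.
  apply: (Hs_extend2 hbe sB EB) => //.
  by apply: le_trans cD; rewrite cU lerDr n2_ge0.
by exists vA, vB; split=> //; rewrite ?vA0 ?vB0.
Qed.

End Flow.

(** * Time derivative of a weighted mass *)

Section WeightedGrowth.
Context {R : realType}.
Notation mu := (@lebesgue_measure R).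
Implicit Types (f g : R -> R[i]) (u v w : R -> R) (m n i s : nat) (t h : R).

(** Writing $F_h = u + h(G + r_h)$ with $r_h \to 0$ in $L^2$, the quotient is $2\int wuG + 2\int
    wur_h + h\int w(G+r_h)^2$. The second term vanishes by Cauchy-Schwarz, the third because its
    integral stays bounded. *)
Lemma wsq_derive w (Kw : R) u G (F : R -> R -> R) :
  measurable_fun setT w -> (forall x, `|w x| <= Kw) -> L2r u -> L2r G ->
  (forall h, L2r (F h)) ->
  (fun h => n2 (fun x => h^-1 * (F h x - u x) - G x)) @ (0 : R)^' --> (0 : R) ->
  (fun h => h^-1 * (\int[mu]_x (w x * (F h x * F h x)) -
     \int[mu]_x (w x * (u x * u x)))) @ (0 : R)^' --> 2 * \int[mu]_x (w x * (u x * G x)).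
Proof.
move=> mw wK lu lG lF H.
pose r h x := h^-1 * (F h x - u x) - G x.
have lr h : L2r (r h) by apply: L2rB => //; apply: L2rZ; exact: L2rB.
have lwu := L2rM mw wK lu.
have Kw0 : 0 <= Kw by apply: le_trans (wK 0).
apply/cvgrPdist_le => e e0.
have c0 : 0 < n2 (fun x => w x * u x) + 1 by rewrite ltr_wpDl// n2_ge0.
have d0 : 0 < Kw * (2 * n2 G + 2) + 1.
  by rewrite ltr_wpDl// mulr_ge0// addr_ge0// mulr_ge0// n2_ge0.
have e1 : 0 < e ^+ 2 / 16 / (n2 (fun x => w x * u x) + 1).
  by rewrite !divr_gt0// exprn_gt0.
have e2 : 0 < e / 2 / (Kw * (2 * n2 G + 2) + 1) by rewrite !divr_gt0.
near=> h.
have h0 : h != 0 by near: h; exact: nbhs_dnbhs_neq.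
have hs : `|h| <= e / 2 / (Kw * (2 * n2 G + 2) + 1) by near: h; exact: dnbhs0_le.
have r1 : n2 (r h) <= 1.
  apply: (le_trans (ler_norm _)); near: h; exact: ((cvgr0Pnorm_le _).1 H _ ltr01).
have r2 : n2 (r h) <= e ^+ 2 / 16 / (n2 (fun x => w x * u x) + 1).
  apply: (le_trans (ler_norm _)); near: h; exact: ((cvgr0Pnorm_le _).1 H _ e1).
have W v1 v2 : L2r v1 -> L2r v2 -> mu.-integrable setT (EFin \o (fun x => w x * (v1 x * v2 x))).
  exact: itg_wuv mw wK.
have lGr : L2r (fun x => G x + r h x) by exact: L2rD.
have E : h^-1 * (\int[mu]_x (w x * (F h x * F h x)) - \int[mu]_x (w x * (u x * u x))) =
   2 * \int[mu]_x (w x * (u x * G x)) + 2 * \int[mu]_x (w x * (u x * r h x)) +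
   h * \int[mu]_x (w x * ((G x + r h x) * (G x + r h x))).
  have i1 := W _ _ (lF h) (lF h); have i2 := W _ _ lu lu.
  have i3 := W _ _ lu lG; have i4 := W _ _ lu (lr h); have i5 := W _ _ lGr lGr.
  rewrite -RintegralB// -!RintegralZl//; last exact: itgB.
  rewrite -!RintegralD//; try exact: itgZ; last by apply: itgD => //; exact: itgZ.
  apply: eq_Rintegral => x _; rewrite /r; field; exact: h0.
rewrite E.
set A := \int[mu]_x (w x * (u x * G x)).
have -> : forall P Q : R, 2 * A - (2 * A + P + Q) = - (P + Q) by move=> P Q; ring.
rewrite normrN (le_trans (ler_normD _ _))// [leRHS]splitr; apply: lerD.
  have CS := Cauchy_Schwarz lwu (lr h).
  have {}CS : (\int[mu]_x (w x * (u x * r h x))) ^+ 2 <= n2 (fun x => w x * u x) * n2 (r h).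
    by under eq_Rintegral do rewrite mulrA.
  have : (\int[mu]_x (w x * (u x * r h x))) ^+ 2 <= (e / 4) ^+ 2.
    apply: (le_trans CS).
    move: r2; rewrite ler_pdivlMr// => r2.
    apply: (@le_trans _ _ (n2 (r h) * (n2 (fun x => w x * u x) + 1))).
      by rewrite mulrC ler_wpM2l ?n2_ge0// lerDl.
    by apply: (le_trans r2); rewrite le_eqVlt; apply/orP; left; apply/eqP; field.
  rewrite -[X in X <= _](real_normK (num_real _)) ler_sqr ?nnegrE ?divr_ge0 ?(ltW e0)//.
  by rewrite normrM (ger0_norm (ler0n _ 2)); lra.
rewrite normrM.
have B : `|\int[mu]_x (w x * ((G x + r h x) * (G x + r h x)))| <= Kw * (2 * n2 G + 2).
  apply: (le_trans (Rint_norm_le _ (W _ _ lGr lGr))) => //.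
  apply: (@le_trans _ _ (Kw * n2 (fun x => G x + r h x))).
    rewrite /n2 -RintegralZl//; last exact: L2r_itg.
    apply: le_Rintegral => //; first by apply: itg_abs => //; exact: W.
      by apply: itgZ => //; exact: L2r_itg.
    move=> x _; rewrite normrM -expr2 (ger0_norm (sqr_ge0 _)).
    by rewrite ler_wpM2r// sqr_ge0.
  rewrite ler_wpM2l//; apply: (le_trans (n2D_le lG (lr h))).
  by have := r1; lra.
move: hs; rewrite ler_pdivlMr// => hs.
apply: le_trans hs; rewrite ler_wpM2l//; apply: (le_trans B); by rewrite lerDl.
Unshelve. all: by end_near. Qed.

Lemma wn2_ae (p : R -> R) n u v : measurable_fun setT p -> measurable_fun setT u ->
  measurable_fun setT v -> (\forall x \ae mu, u x = v x) -> wn2 p n u = wn2 p n v.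
Proof.
move=> mp mu_ mv uv; apply: ae_eq_Rintegral => //.
- by apply: measurable_funM; [exact: measurable_funX|exact: measurable_funM].
- by apply: measurable_funM; [exact: measurable_funX|exact: measurable_funM].
- by apply: aeS uv => x ->.
Qed.

Variables (V : R -> R) (K : R).
Hypotheses (mV : measurable_fun setT V) (VK : forall x, `|V x| <= K).
Variable (U : R -> (R -> R[i]) -> (R -> R[i])).
Hypothesis (U_group : generated_by_schrodinger V U).

Lemma quot_re f g h x :
  re (quot U f g h) x = h^-1 * (re (U h f) x - re f x) - re g x.
Proof.
rewrite /re /quot; case: (U h f x) => a1 b1; case: (f x) => a2 b2.
by case: (g x) => a3 b3; rewrite /= mul0r subr0.
Qed.

Lemma quot_im f g h x :
  im (quot U f g h) x = h^-1 * (im (U h f) x - im f x) - im g x.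
Proof.
rewrite /im /quot; case: (U h f x) => a1 b1; case: (f x) => a2 b2.
by case: (g x) => a3 b3; rewrite /= mul0r addr0.
Qed.

Section Weight.
Variables (p p' : R -> R) (Kp : R).
Hypotheses (ap : ACR p p') (mp' : measurable_fun setT p')
  (p1 : forall x, 1 <= p x) (pK : forall x, p x <= Kp)
  (pp' : forall x, p' x ^+ 2 <= 4 * p x).

Definition wmass n f := wn2 p n (re f) + wn2 p n (im f).

Lemma wmass_ae n f g : inL2 f -> inL2 g -> (\forall x \ae mu, f x = g x) ->
  wmass n f = wmass n g.
Proof.
have mp := AC_measurable ap.
move=> /inL2P[fr fi] /inL2P[gr gi] fg; congr (_ + _); apply: wn2_ae => //.
- exact: L2r_meas fr.
- exact: L2r_meas gr.
- by apply: aeS fg => x; rewrite /re => ->.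
- exact: L2r_meas fi.
- exact: L2r_meas gi.
- by apply: aeS fg => x; rewrite /im => ->.
Qed.

Lemma wmass_HC m n f a b B : inL2 f -> HC m f a b B ->
  wmass n f = wn2 p n (a 0%N) + wn2 p n (b 0%N).
Proof.
have mp := AC_measurable ap.
move=> lf [ha hb ea eb]; congr (_ + _); apply: wn2_ae => //.
- exact: L2r_meas (inL2_re lf).
- exact: L2r_meas (Hs_L2 ha (leq0n _)).
- exact: L2r_meas (inL2_im lf).
- exact: L2r_meas (Hs_L2 hb (leq0n _)).
Qed.

(* V does not appear: it rotates f pointwise, which leaves |f| unchanged. *)
Lemma wmass_derive n f t a b B : inH 2 f -> HC 2 (U t f) a b B ->
  is_derive t 1 (fun t' : R => wmass n (U t' f))
   (2 * \int[mu]_x (p x ^+ n * (b 0%N x * a 2%N x) - p x ^+ n * (a 0%N x * b 2%N x))).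
Proof.
move=> hf h; have lf := hf.1; have lU := U_L2 U_group t lf.
have [hU _] := U_gen mV VK U_group t hf.
have [lg gr gi] := gen_parts mV VK (leqnn 2) lU h.
have C := gen_cvg mV VK U_group hU.
have [ha hb ea eb] := h.
set u := U t f in lU hU lg gr gi C ea eb *; set g := gen V u in lg gr gi C *.
have mw := weight_meas ap n; have wb := weight_bound p1 pK n.
have sq (F : R -> R) : (forall h, 0 <= F h <= cn2 (quot U u g h)) -> F @ (0 : R)^' --> (0 : R).
  move=> HF; apply: (@squeeze_cvgr _ _ _ _ (fun=> 0) (fun h => cn2 (quot U u g h))) => //.
  - by apply: nearW => h'; exact: HF.
  - exact: cvg_cst.
have Cr : (fun h => n2 (fun x => h^-1 * (re (U h u) x - re u x) - re g x)) @ (0 : R)^' --> (0 : R).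
  apply: sq => k; rewrite n2_ge0/=; apply: le_trans (n2_re_le _).
  rewrite le_eqVlt; apply/orP; left; apply/eqP; congr n2; apply/funext => x.
  by rewrite quot_re.
have Ci : (fun h => n2 (fun x => h^-1 * (im (U h u) x - im u x) - im g x)) @ (0 : R)^' --> (0 : R).
  apply: sq => k; rewrite n2_ge0/=; apply: le_trans (n2_im_le _).
  rewrite le_eqVlt; apply/orP; left; apply/eqP; congr n2; apply/funext => x.
  by rewrite quot_im.
have Dr := wsq_derive mw wb (inL2_re lU) (inL2_re lg) (fun h => inL2_re (U_L2 U_group h lU)) Cr.
have Di := wsq_derive mw wb (inL2_im lU) (inL2_im lg) (fun h => inL2_im (U_L2 U_group h lU)) Ci.
apply: is_derive_at_cvg.
(* By the group law, the derivative at [t] is the derivative at 0 along the orbit of [U t f]. *)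
have -> : (fun h => h^-1 * (wmass n (U (h + t) f) - wmass n (U t f))) =
  (fun h => h^-1 * (wmass n (U h u) - wmass n u)).
  apply/funext => k; congr (_ * (_ - _)).
  apply: wmass_ae; [exact: (U_L2 U_group (k + t) lf)|exact: (U_L2 U_group k lU)|].
  exact: U_add U_group k t f lf.
have -> : (fun h => h^-1 * (wmass n (U h u) - wmass n u)) = (fun h =>
   h^-1 * (wn2 p n (re (U h u)) - wn2 p n (re u)) +
   h^-1 * (wn2 p n (im (U h u)) - wn2 p n (im u))).
  by apply/funext => k; rewrite /wmass; ring.
have La i (i2 : (i <= 2)%N) : L2r (a i) := Hs_L2 ha i2.
have Lb i (i2 : (i <= 2)%N) : L2r (b i) := Hs_L2 hb i2.
have W v1 v2 : L2r v1 -> L2r v2 -> mu.-integrable setT (EFin \o (fun x => p x ^+ n * (v1 x * v2 x))).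
  exact: itg_wuv mw wb.
have lVa : L2r (fun x => V x * a 0%N x) by apply: L2rM VK _ => //; exact: La.
have lVb : L2r (fun x => V x * b 0%N x) by apply: L2rM VK _ => //; exact: Lb.
have i1 := W _ _ (La 0%N isT) (Lb 2%N isT); have i2 := W _ _ (La 0%N isT) lVb.
have i3 := W _ _ (Lb 0%N isT) (La 2%N isT); have i4 := W _ _ (Lb 0%N isT) lVa.
have E1 : \int[mu]_x (p x ^+ n * (re u x * re g x)) =
    - (\int[mu]_x (p x ^+ n * (a 0%N x * b 2%N x))
    + \int[mu]_x (p x ^+ n * (a 0%N x * (V x * b 0%N x)))).
  rewrite -RintegralD// -RintegralN//; last exact: itgD.
  apply: ae_eq_Rintegral => //.
  - exact: itg_meas (W _ _ (inL2_re lU) (inL2_re lg)).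
  - exact: itg_meas (itgN measurableT (itgD measurableT i1 i2)).
  - by apply: aeS2 ea gr => x -> ->; ring.
have E2 : \int[mu]_x (p x ^+ n * (im u x * im g x)) =
    \int[mu]_x (p x ^+ n * (b 0%N x * a 2%N x))
    + \int[mu]_x (p x ^+ n * (b 0%N x * (V x * a 0%N x))).
  rewrite -RintegralD//.
  apply: ae_eq_Rintegral => //.
  - exact: itg_meas (W _ _ (inL2_im lU) (inL2_im lg)).
  - exact: itg_meas (itgD measurableT i3 i4).
  - by apply: aeS2 eb gi => x -> ->; ring.
have E3 : \int[mu]_x (p x ^+ n * (a 0%N x * (V x * b 0%N x))) =
   \int[mu]_x (p x ^+ n * (b 0%N x * (V x * a 0%N x))).
  by apply: eq_Rintegral => x _; ring.
rewrite RintegralB//.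
have -> : 2 * (\int[mu]_x (p x ^+ n * (b 0%N x * a 2%N x)) -
   \int[mu]_x (p x ^+ n * (a 0%N x * b 2%N x))) =
  2 * \int[mu]_x (p x ^+ n * (re u x * re g x)) + 2 * \int[mu]_x (p x ^+ n * (im u x * im g x)).
  by rewrite E1 E2 E3; ring.
exact: cvgD Dr Di.
Qed.

(** The differential inequality for one power of the weight. The mass of the first derivative with
    one power less is left as a hypothesis, because it is obtained by energy conservation when
    [n = 0] and by the interpolation chain otherwise. *)
Lemma growth_H2 n f (C0 C1 : R) : inH 2 f -> 0 <= C0 -> 0 <= C1 ->
  wmass n.+1 f <= C0 ->
  (forall t a b B, HC 2 (U t f) a b B ->
    wn2 p n (a 1%N) + wn2 p n (b 1%N) <=
      (16 * n.+1%:R ^+ 2)^-1 / tau t ^+ 2 * wmass n.+1 (U t f) + C1 * tau t ^+ n.*2) ->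
  forall t, wmass n.+1 (U t f) <=
    Num.max C0 (8 * n.+1%:R ^+ 2 * C1) * tau t ^+ n.*2.+2.
Proof.
move=> hf C00 C10 y0 H.
have ex t : exists q : (nat -> R -> R) * (nat -> R -> R) * R, HC 2 (U t f) q.1.1 q.1.2 q.2.
  have [hU _] := U_gen mV VK U_group t hf.
  by have [a [b [B h]]] := inH_HC hU; exists (a, b, B).
pose A t := (projT1 (cid (ex t))).1.1; pose Bb t := (projT1 (cid (ex t))).1.2.
have hq t : HC 2 (U t f) (A t) (Bb t) (projT1 (cid (ex t))).2 := projT2 (cid (ex t)).
apply: (growth (y' := fun t => 2 * \int[mu]_x (p x ^+ n.+1 * (Bb t 0%N x * A t 2%N x) -
    p x ^+ n.+1 * (A t 0%N x * Bb t 2%N x)))).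
- by rewrite le_max C00.
- by move=> t; apply: addr_ge0; exact: wn2_ge0.
- by move=> t; exact: wmass_derive hf (hq t).
- rewrite (wmass_ae _ (U_L2 U_group 0 hf.1) hf.1 (U_0 U_group hf.1)).
  by apply: le_trans y0 _; rewrite le_max lexx.
move=> t; have [ha hb _ _] := hq t.
have t0 := tau_gt0 t.
(* This $\theta$ gives $y/(2\tau)$ directly, and $4N^2 \cdot 2\tau \cdot y/(16N^2\tau^2)$ is the
   other half of $y/\tau$. *)
have th0 : 0 < (2 * tau t)^-1 by rewrite invr_gt0 mulr_gt0.
have := weight_flux ap mp' p1 pK pp' n th0 (Hs_H1 ha (isT : (0 < 2)%N))
  (Hs_H1 ha (isT : (1 < 2)%N)) (Hs_H1 hb (isT : (0 < 2)%N)) (Hs_H1 hb (isT : (1 < 2)%N)).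
move=> /le_trans; apply.
rewrite -(wmass_HC n.+1 (U_L2 U_group t hf.1) (hq t)) invrK.
set y := wmass n.+1 (U t f).
have N0 : 0 < n.+1%:R ^+ 2 :> R by rewrite exprn_gt0.
have h1 := H t _ _ _ (hq t); rewrite -/y in h1.
have h2 : 4 * n.+1%:R ^+ 2 * (2 * tau t) * (wn2 p n (A t 1%N) + wn2 p n (Bb t 1%N)) <=
  4 * n.+1%:R ^+ 2 * (2 * tau t) * ((16 * n.+1%:R ^+ 2)^-1 / tau t ^+ 2 * y + C1 * tau t ^+ n.*2).
  by rewrite ler_wpM2l// ?mulr_ge0// ltW.
apply: (le_trans (lerD (lexx _) h2)).
have -> : (2 * tau t)^-1 * y + 4 * n.+1%:R ^+ 2 * (2 * tau t) *
   ((16 * n.+1%:R ^+ 2)^-1 / tau t ^+ 2 * y + C1 * tau t ^+ n.*2) =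
   y / tau t + 8 * n.+1%:R ^+ 2 * C1 * tau t ^+ n.*2.+1.
  rewrite (exprS (tau t) n.*2); move: (tau t ^+ n.*2) (n.+1%:R ^+ 2 : R) N0 => T N N0; field.
  by rewrite (gt_eqF t0)/= (gt_eqF N0).
rewrite lerD2l ler_wpM2r ?exprn_ge0 ?(ltW t0)//.
by rewrite le_max lexx orbT.
Qed.

End Weight.
End WeightedGrowth.

(** * Growth of the masses mixing weights and derivatives *)

Section MixedGrowth.
Context {R : realType}.
Notation mu := (@lebesgue_measure R).
Implicit Types (f g : R -> R[i]) (u v w : R -> R) (m n i j k s : nat) (t h d : R).

Lemma wmass_sub_le (p : R -> R) (Kp : R) n f g : measurable_fun setT (fun x => p x ^+ n) ->
  (forall x, 0 <= p x ^+ n <= Kp) -> inL2 f -> inL2 g ->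
  wmass p n f <= 2 * wmass p n g + 2 * Kp * cn2 (fun x => f x - g x).
Proof.
move=> mp pK lf lg.
have pn x : `|p x ^+ n| <= Kp by have /andP[h1 h2] := pK x; rewrite ger0_norm.
have H (u v : R -> R) : L2r u -> L2r v -> wn2 p n u <= 2 * wn2 p n v + 2 * Kp * n2 (fun x => u x - v x).
  move=> lu lv; have luv := L2rB lu lv.
  have iu := itg_wuv mp pn lu lu; have iv := itg_wuv mp pn lv lv.
  have iw := L2r_itg luv.
  rewrite /wn2 /n2 -!RintegralZl// -RintegralD//; try exact: itgZ.
  apply: le_Rintegral => //; first by apply: itgD => //; exact: itgZ.
  move=> x _; have /andP[h1 h2] := pK x.
  have h3 : 0 <= (2 * v x - u x) ^+ 2 by exact: sqr_ge0.
  have h4 : 0 <= (u x - v x) ^+ 2 by exact: sqr_ge0.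
  have -> : p x ^+ n * (u x * u x) = 2 * (p x ^+ n * (v x * v x)) +
    2 * (p x ^+ n * (u x - v x) ^+ 2) - p x ^+ n * (2 * v x - u x) ^+ 2 by ring.
  have h5 : 0 <= p x ^+ n * (2 * v x - u x) ^+ 2 by rewrite mulr_ge0.
  have h6 : p x ^+ n * (u x - v x) ^+ 2 <= Kp * (u x - v x) ^+ 2 by rewrite ler_wpM2r.
  lra.
have := H _ _ (inL2_re lf) (inL2_re lg); have := H _ _ (inL2_im lf) (inL2_im lg).
rewrite /wmass /cn2 reB imB; lra.
Qed.

Variables (V : R -> R) (K : R).
Hypotheses (mV : measurable_fun setT V) (VK : forall x, `|V x| <= K).
Variable (U : R -> (R -> R[i]) -> (R -> R[i])).
Hypothesis (U_group : generated_by_schrodinger V U).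

(** The data is replaced by $H^2$ data [fe] depending on [d], with [cn2 (fe - f) <= d]. As the
    weight is at most $1/d$, each of the two exchanges, at time 0 and at time [t], adds at most 2.
    The energy bounds the first derivative of the approximation for all times. *)
Lemma growth_H1 f a b (B C0 : R) : inL2 f -> HC 1 f a b B -> 0 <= C0 ->
  (forall d, 0 < d <= 1 -> wmass (wt d) 1 f <= C0) ->
  exists C, forall d t, 0 < d <= 1 -> wmass (wt d) 1 (U t f) <= C * tau t ^+ 2.
Proof.
move=> lf h C00 H0; have K0 := K_ge0 VK; have c0 := cn2_ge0 f.
have B0 : 0 <= B by have [ha _ _ _] := h; exact: Hs_ge0 ha.
pose M := 2 * B + 2 * K * (2 * cn2 f + 2).
have M0 : 0 <= M by rewrite addr_ge0 ?mulr_ge0// addr_ge0// mulr_ge0.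
exists (2 * Num.max (2 * C0 + 2) (8 * 1%:R ^+ 2 * M) + 2) => d t d01.
have /andP[d0 d1] := d01.
have [fe [a' [b' [B' [le he ce ne]]]]] := H2_approx lf h d0.
have ap := wt_AC d01; have mp := weight_meas ap 1.
have wb x : 0 <= wt d x ^+ 1 <= d^-1.
  by rewrite expr1 (le_trans ler01 (wt_ge1 d01 x))/= wt_le.
have dd (c : R) : c <= d -> 2 * d^-1 * c <= 2.
  move=> cd; rewrite -mulrA -[leRHS]mulr1 ler_pM2l//.
  by rewrite mulrC ler_pdivrMr// mul1r.
have y0 : wmass (wt d) 1 fe <= 2 * C0 + 2.
  apply: (le_trans (wmass_sub_le mp wb le lf)); apply: lerD; last exact: dd.
  by rewrite ler_pM2l//; exact: H0.
have H t' a1 b1 B1 : HC 2 (U t' fe) a1 b1 B1 -> wn2 (wt d) 0 (a1 1%N) + wn2 (wt d) 0 (b1 1%N) <=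
      (16 * 1%:R ^+ 2)^-1 / tau t' ^+ 2 * wmass (wt d) 1 (U t' fe) + M * tau t' ^+ 0.*2.
  move=> h1; have E := energy_bound mV VK U_group le he h1.
  have ee : cn2 fe <= 2 * cn2 f + 2.
    apply: (le_trans (cn2_sub_le le lf)); rewrite lerD2l -[leRHS]mulr1 ler_pM2l//.
    exact: le_trans ce d1.
  have Q (u : R -> R) : wn2 (wt d) 0 u = n2 u.
    by apply: eq_Rintegral => x _; rewrite expr0 mul1r expr2.
  rewrite !Q expr0 mulr1 ler_wpDl//.
    rewrite mulr_ge0 ?divr_ge0 ?invr_ge0 ?mulr_ge0 ?exprn_ge0 ?(ltW (tau_gt0 _))//.
    by rewrite addr_ge0// wn2_ge0//; exact: wt_ge1.
  apply: (le_trans E); rewrite /M lerD// ler_wpM2l// mulr_ge0//.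
have G := growth_H2 mV VK U_group ap (dwt_meas d01) (wt_ge1 d01) (wt_le d01) (dwt_le d01)
  (HC_inH le he) (_ : 0 <= 2 * C0 + 2) M0 y0 H t.
have G' := G (addr_ge0 (mulr_ge0 (ler0n _ 2) C00) (ler0n _ 2)).
apply: (le_trans (wmass_sub_le mp wb (U_L2 U_group t lf) (U_L2 U_group t le))).
rewrite [leRHS]mulrDl -[2 * Num.max _ _ * _]mulrA; apply: lerD; first by rewrite ler_pM2l.
rewrite (U_dist U_group)// cn2B_sym.
apply: (le_trans (dd _ ce)); rewrite ler_peMr// exprn_ege1// tau_ge1//.
Qed.

(** The quantity $\int p_d^k|u^{(j)}|^2$. *)
Definition mixed (a b : nat -> R -> R) d k j := wn2 (wt d) k (a j) + wn2 (wt d) k (b j).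

Section Chain.
Variables (s : nat) (f : R -> R[i]) (B C0 : R) (a b : R -> nat -> R -> R).
Hypotheses (lf : inL2 f) (hf : inH s f) (C00 : 0 <= C0).
Hypothesis hab : forall t, HC s (U t f) (a t) (b t) B.
Hypothesis init : forall d m, 0 < d <= 1 -> (m <= s)%N -> wmass (wt d) m f <= C0.

Definition mixed_bound m := exists C, forall d t k, 0 < d <= 1 -> (k <= m)%N ->
  mixed (a t) (b t) d k (m - k) <= C * (tau t ^+ 2) ^+ k.

Lemma mixed_ge0 d t k j : 0 < d <= 1 -> 0 <= mixed (a t) (b t) d k j.
Proof. by move=> d01; rewrite addr_ge0// wn2_ge0//; exact: wt_ge1. Qed.

Lemma mixed0 d t j : (j <= s)%N -> mixed (a t) (b t) d 0 j <= 2 * B.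
Proof.
move=> js; have [ha hb _ _] := hab t.
have Q (u : R -> R) : wn2 (wt d) 0 u = n2 u.
  by apply: eq_Rintegral => x _; rewrite expr0 mul1r expr2.
by rewrite /mixed !Q; have := Hs_n2 ha js; have := Hs_n2 hb js; lra.
Qed.

Lemma mixed_top d t k : 0 < d <= 1 -> mixed (a t) (b t) d k 0 = wmass (wt d) k (U t f).
Proof.
by move=> d01; rewrite (wmass_HC (wt_AC d01) k (U_L2 U_group t lf) (hab t)).
Qed.

Lemma mixed_bound0 : mixed_bound 0.
Proof.
exists (2 * B) => d t k d01; rewrite leqn0 => /eqP ->.
by rewrite expr0 mulr1; exact: mixed0.
Qed.

Lemma mixed_bound1 : (1 <= s)%N -> mixed_bound 1.
Proof.
move=> s1; have [a0 [b0 [B0 h0]]] := inH_HC hf.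
have [C H] := growth_H1 lf (HC_le s1 h0) C00 (fun d d01 => init d01 s1).
exists (Num.max (2 * B) C) => d t [|[|//]] d01 _.
  by rewrite expr0 mulr1 (le_trans (mixed0 _ _ _))// le_max lexx.
rewrite mixed_top//; apply: (le_trans (H d t d01)).
by rewrite expr1 ler_wpM2r ?sqr_ge0// le_max lexx orbT.
Qed.

Definition nmixed m d t i := mixed (a t) (b t) d i (m - i) / (tau t ^+ 2) ^+ i.

(** [weight_interp] is applied with [eta / tau t ^+ 2], so that division by powers of $\tau^2$
    removes the time from both main terms. The remainder has total order [m]; by hypothesis it is at
    most $C\tau^{2i}$, and $\tau \ge 1$ does the rest. *)
Lemma mixed_chain_step m C d t i (eta : R) : (m.+2 <= s)%N ->
  (forall d t k, 0 < d <= 1 -> (k <= m)%N ->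
    mixed (a t) (b t) d k (m - k) <= C * (tau t ^+ 2) ^+ k) ->
  0 < d <= 1 -> (i.+1 < m.+2)%N -> 0 < eta ->
  nmixed m.+2 d t i.+1 <= eta * nmixed m.+2 d t i.+2 + eta^-1 * nmixed m.+2 d t i +
    4 * m.+2%:R ^+ 2 * C.
Proof.
move=> ms H d01 im e0.
have T1 : 1 <= tau t ^+ 2 by rewrite exprn_ege1// tau_ge1.
have T0 : 0 < tau t ^+ 2 by exact: lt_le_trans T1.
have Ti0 : 0 < (tau t ^+ 2) ^+ i by rewrite exprn_gt0.
have im' : (i <= m)%N by rewrite -ltnS -ltnS.
have e1 : (m.+2 - i = (m - i).+2)%N by rewrite !subSn// leqW.
have e2 : (m.+2 - i.+1 = (m - i).+1)%N by rewrite subSS subSn.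
have e3 : (m.+2 - i.+2 = m - i)%N by [].
have C0' : 0 <= C.
  by have := H d t 0%N d01 (leq0n _); rewrite expr0 mulr1; apply: le_trans; exact: mixed_ge0.
have [ha hb _ _] := hab t.
have ls1 : (m - i < s)%N by rewrite (leq_ltn_trans (leq_subr _ _))// (leq_trans _ ms).
have ls2 : ((m - i).+1 < s)%N by rewrite (leq_ltn_trans _ ms)// ltnS leq_subr.
have W (u u1 u2 : R -> R) := @weight_interp R (wt d) (dwt d) d^-1 (wt_AC d01) (dwt_meas d01)
  (wt_ge1 d01) (wt_le d01) (dwt_le d01) i (eta / tau t ^+ 2) u u1 u2 (divr_gt0 e0 T0).
have Wa := W _ _ _ (Hs_H1 ha ls1) (Hs_H1 ha ls2).
have Wb := W _ _ _ (Hs_H1 hb ls1) (Hs_H1 hb ls2).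
have Wm : mixed (a t) (b t) d i.+1 (m - i).+1 <= eta / tau t ^+ 2 * mixed (a t) (b t) d i.+2 (m - i) +
   (eta / tau t ^+ 2)^-1 * mixed (a t) (b t) d i (m - i).+2 +
   4 * i.+1%:R ^+ 2 * mixed (a t) (b t) d i (m - i).
  by apply: (le_trans (lerD Wa Wb)); rewrite /mixed le_eqVlt; apply/orP; left; apply/eqP; ring.
have Hi := H d t i d01 im'; have M0 := mixed_ge0 t i (m - i) d01.
rewrite /nmixed e1 e2 e3 ler_pdivrMr; last by rewrite exprn_gt0.
apply: (le_trans Wm).
have Ni : i.+1%:R ^+ 2 <= m.+2%:R ^+ 2 :> R by rewrite lerXn2r ?nnegrE// ler_nat; exact: ltnW.
have N0 : 0 <= i.+1%:R ^+ 2 :> R by exact: sqr_ge0.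
set X := mixed _ _ _ _ (m - i) in Hi M0 *.
set Y := mixed _ _ _ i.+2 _; set Z := mixed _ _ _ _ (m - i).+2.
set T := tau t ^+ 2 in T1 T0 Ti0 Hi *; rewrite (exprS T i.+1) (exprS T i).
set S := T ^+ i in Ti0 Hi *.
have -> : (eta * (Y / (T * (T * S))) + eta^-1 * (Z / S) + 4 * m.+2%:R ^+ 2 * C) * (T * S) =
   eta / T * Y + (eta / T)^-1 * Z + 4 * m.+2%:R ^+ 2 * C * S * T.
  by field; rewrite !gt_eqF.
rewrite lerD2l.
apply: (@le_trans _ _ (4 * m.+2%:R ^+ 2 * (C * S))).
  by apply: ler_pM => //; rewrite ?mulr_ge0 ?ler_pM2l.
have -> : 4 * m.+2%:R ^+ 2 * C * S * T = 4 * m.+2%:R ^+ 2 * (C * S) * T by ring.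
by rewrite ler_peMr// mulr_ge0 ?mulr_ge0// ltW.
Qed.

(** The chain inequality is used twice: first to supply the hypothesis of [growth_H2], which bounds
    the pure moment, then to spread that bound from the right end to all intermediate terms. *)
Lemma mixed_bound_step m : (m.+2 <= s)%N -> mixed_bound m -> mixed_bound m.+2.
Proof.
move=> ms [C H]; pose e : R := (16 * m.+2%:R ^+ 2)^-1.
have N0 : 0 < m.+2%:R ^+ 2 :> R by rewrite exprn_gt0.
have e0 : 0 < e by rewrite invr_gt0 mulr_gt0.
pose K' := 4 * m.+2%:R ^+ 2 * C.
have [C1 H1] := @mixed_chain R m.+2 (2 * B) K' m.+1 e (ltnSn _) e0.
(* [growth_H2] asks for a nonnegative constant. *)
pose C1' := Num.max 0 C1.
have C1'0 : 0 <= C1' by rewrite le_max lexx.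
pose D := Num.max C0 (8 * m.+2%:R ^+ 2 * C1').
have [C2 H2] := @mixed_chain_bounded R m.+2 (2 * B) K' D.
exists C2 => d t k d01 km.
pose al t := nmixed m.+2 d t.
have T0 t' : 0 < tau t' ^+ 2 by rewrite exprn_gt0// tau_gt0.
have al0 t' : al t' 0%N <= 2 * B by rewrite /al /nmixed subn0 expr0 divr1; exact: mixed0.
have alp t' i : 0 <= al t' i by rewrite divr_ge0 ?mixed_ge0// exprn_ge0// ltW.
have als t' i (eta : R) (im : (i.+1 < m.+2)%N) (e1 : 0 < eta) :
   al t' i.+1 <= eta * al t' i.+2 + eta^-1 * al t' i + K'.
  exact: mixed_chain_step ms H d01 im e1.
have hf2 : inH 2 f by split=> // n n2'; apply: hf.2; exact: leq_trans n2' (leq_trans _ ms).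
have G := growth_H2 mV VK U_group (wt_AC d01) (dwt_meas d01) (wt_ge1 d01) (wt_le d01)
  (dwt_le d01) hf2 C00 C1'0 (init d01 ms).
have {}G : wmass (wt d) m.+2 (U t f) <= D * tau t ^+ m.+1.*2.+2.
  apply: G => t' a1 b1 B1 h1.
  have h2 := H1 (al t') (al0 t') (alp t') (als t').
  have [ha1 hb1 ea1 eb1] := h1; have [ha hb ea eb] := hab t'.
  have s1 : (1 <= s)%N by exact: leq_trans ms.
  (* [growth_H2] speaks of any chain representing the solution; the bounds at hand concern the fixed
     one, and first derivatives are unique almost everywhere. *)
  have Ea : \forall x \ae mu, a1 1%N x = a t' 1%N x.
    apply: (Hs_unique (m := 1) (Hs_mono _ (lexx _) ha1) (Hs_mono s1 (lexx _) ha)) => //.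
    by apply: aeS2 ea1 ea => x <- <-.
  have Eb : \forall x \ae mu, b1 1%N x = b t' 1%N x.
    apply: (Hs_unique (m := 1) (Hs_mono _ (lexx _) hb1) (Hs_mono s1 (lexx _) hb)) => //.
    by apply: aeS2 eb1 eb => x <- <-.
  have mp := AC_measurable (wt_AC d01).
  rewrite (wn2_ae _ mp _ _ Ea) ?(wn2_ae _ mp _ _ Eb).
  - move: h2; rewrite /al /nmixed subnn subSn// subnn -mixed_top//.
    rewrite ler_pdivrMr ?exprn_gt0 ?tau_gt0// => h2.
    apply: (le_trans h2); rewrite [(_ ^+ _) ^+ m.+2]exprS -exprM -muln2 [(m.+1 * 2)%N]mulnC.
    rewrite mulrDl; apply: lerD; last first.
      by rewrite ler_wpM2r ?exprn_ge0 ?(ltW (tau_gt0 _))// le_max lexx orbT.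
    rewrite le_eqVlt -/e; apply/orP; left; apply/eqP.
    have P0 : 0 < tau t' ^+ (2 * m.+1) by rewrite exprn_gt0// tau_gt0.
    move: (tau t' ^+ (2 * m.+1)) (tau t' ^+ 2) P0 (T0 t') => P Q P0 Q0.
    by field; rewrite !gt_eqF.
  - exact: L2r_meas (Hs_L2 hb1 _).
  - exact: L2r_meas (Hs_L2 hb s1).
  - exact: L2r_meas (Hs_L2 ha1 _).
  - exact: L2r_meas (Hs_L2 ha s1).
have hD : al t m.+2 <= D.
  rewrite /al /nmixed subnn mixed_top// ler_pdivrMr ?exprn_gt0 ?tau_gt0//.
  by move: G; rewrite -exprM mul2n doubleS.
have := H2 (al t) (al0 t) (alp t) (als t) hD k km.
by rewrite /al /nmixed ler_pdivrMr ?exprn_gt0 ?tau_gt0.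
Qed.

Lemma mixed_bound_all m : (m <= s)%N -> mixed_bound m.
Proof.
suff H : ((m <= s)%N -> mixed_bound m) /\ ((m.+1 <= s)%N -> mixed_bound m.+1) by exact: H.1.
elim: m => [|m [IH0 IH1]]; first by split=> [_|]; [exact: mixed_bound0|exact: mixed_bound1].
by split=> // ms; apply: mixed_bound_step => //; apply: IH0; exact: leq_trans (leq_trans _ ms).
Qed.

Lemma wmass_growth : exists C, forall d t, 0 < d <= 1 ->
  wmass (wt d) s (U t f) <= C * (tau t ^+ 2) ^+ s.
Proof.
have [C H] := mixed_bound_all (leqnn s); exists C => d t d01.
by have := H d t s d01 (leqnn s); rewrite subnn mixed_top.
Qed.

End Chain.
End MixedGrowth.

(** * Moments, and boundedness of the potential *)

Section Moments.
Context {R : realType}.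
Notation mu := (@lebesgue_measure R).
Implicit Types (f g : R -> R[i]) (u v w : R -> R) (m n i j k s : nat) (t h d : R).

(** Pointwise, $p_d^m \le p_d^s \le (1+x^2)^s \le 2^s(1+x^{2s})$, the last step by comparing $x^2$
    with 1. *)
Lemma wn2_wt_le s m d u : L2r u -> 0 < d <= 1 -> (m <= s)%N ->
  mu.-integrable setT (EFin \o (fun x => x ^+ (2 * s) * u x ^+ 2)) ->
  wn2 (wt d) m u <= 2 ^+ s * (n2 u + \int[mu]_x (x ^+ (2 * s) * u x ^+ 2)).
Proof.
move=> lu d01 ms iu; have lq := L2r_itg lu.
rewrite /n2 -RintegralD// -RintegralZl//; last exact: itgD.
apply: le_Rintegral => //.
- exact: (weight_itg (wt_AC d01) (wt_ge1 d01) (wt_le d01) m lu lu).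
- by apply: itgZ => //; exact: itgD.
move=> x _; have xx : 0 <= x * x by rewrite -expr2 sqr_ge0.
have -> : 2 ^+ s * (u x ^+ 2 + x ^+ (2 * s) * u x ^+ 2) =
  2 ^+ s * (1 + (x * x) ^+ s) * (u x * u x) by rewrite exprM expr2; ring.
have uu : 0 <= u x * u x by rewrite -expr2 sqr_ge0.
rewrite ler_wpM2r//.
have w1 := wt_ge1 d01 x.
apply: (@le_trans _ _ ((1 + x * x) ^+ s)).
  apply: (@le_trans _ _ (wt d x ^+ s)); first exact: ler_weXn2l.
  rewrite lerXn2r ?nnegrE ?addr_ge0// ?(le_trans ler01 w1)//.
  by apply: wt_le_quad; case/andP: d01 => /ltW.
have [x1|x1] := leP (x * x) 1.
  apply: (@le_trans _ _ (2 ^+ s)); last by rewrite ler_peMr ?exprn_ge0// lerDl exprn_ge0.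
  by rewrite lerXn2r ?nnegrE ?addr_ge0//; lra.
apply: (@le_trans _ _ ((2 * (x * x)) ^+ s)).
  by rewrite lerXn2r ?nnegrE//; lra.
by rewrite exprMn ler_pM2l ?exprn_gt0// lerDr.
Qed.

Lemma moment_parts s f : inL2 f ->
  (\int[mu]_x (x ^+ (2 * s) * Normc.normc (f x) ^+ 2)%:E < +oo)%E ->
  mu.-integrable setT (EFin \o (fun x => x ^+ (2 * s) * re f x ^+ 2)) /\
  mu.-integrable setT (EFin \o (fun x => x ^+ (2 * s) * im f x ^+ 2)).
Proof.
move=> lf fin.
have mr := L2r_meas (inL2_re lf); have mi := L2r_meas (inL2_im lf).
have xs (x : R) : 0 <= x ^+ (2 * s) by rewrite exprM exprn_ge0// sqr_ge0.
have mN : measurable_fun setT (fun x : R => x ^+ (2 * s) * Normc.normc (f x) ^+ 2).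
  under eq_fun do rewrite normc_sqr.
  apply: measurable_funM; first exact: measurable_funX.
  by apply: measurable_funD; exact: measurable_funX.
have I : mu.-integrable setT (EFin \o (fun x => x ^+ (2 * s) * Normc.normc (f x) ^+ 2)).
  by apply/(itg_ge0 _ mN) => // x _; rewrite mulr_ge0// sqr_ge0.
split; apply: itg_le I => //.
- by apply: measurable_funM; exact: measurable_funX.
- move=> x _; rewrite (ger0_norm (mulr_ge0 (xs x) (sqr_ge0 _))) normc_sqr ler_wpM2l//.
  by rewrite lerDl sqr_ge0.
- by apply: measurable_funM; exact: measurable_funX.
- move=> x _; rewrite (ger0_norm (mulr_ge0 (xs x) (sqr_ge0 _))) normc_sqr ler_wpM2l//.
  by rewrite lerDr sqr_ge0.
Qed.

Lemma wmass_wt_le s f : inL2 f ->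
  (\int[mu]_x (x ^+ (2 * s) * Normc.normc (f x) ^+ 2)%:E < +oo)%E ->
  exists2 C0, 0 <= C0 & forall d m, 0 < d <= 1 -> (m <= s)%N -> wmass (wt d) m f <= C0.
Proof.
move=> lf fin; have [ir ii] := moment_parts lf fin.
have xs (x : R) : 0 <= x ^+ (2 * s) by rewrite exprM exprn_ge0// sqr_ge0.
have I0 (u : R -> R) : 0 <= \int[mu]_x (x ^+ (2 * s) * u x ^+ 2).
  by apply: Rintegral_ge0 => x _; rewrite mulr_ge0// sqr_ge0.
exists (2 ^+ s * (n2 (re f) + \int[mu]_x (x ^+ (2 * s) * re f x ^+ 2)) +
   2 ^+ s * (n2 (im f) + \int[mu]_x (x ^+ (2 * s) * im f x ^+ 2))).
  by rewrite addr_ge0// mulr_ge0 ?exprn_ge0// addr_ge0// n2_ge0.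
by move=> d m d01 ms; apply: lerD; apply: wn2_wt_le => //; [exact: inL2_re|exact: inL2_im].
Qed.

(* Fatou as d tends to 0, since [wt d x] increases to [1 + x * x]. *)
Lemma moment_le s f (Q : R) : inL2 f ->
  (forall d, 0 < d <= 1 -> wmass (wt d) s f <= Q) ->
  (\int[mu]_x (x ^+ (2 * s) * Normc.normc (f x) ^+ 2)%:E <= Q%:E)%E.
Proof.
move=> lf H.
have mr := L2r_meas (inL2_re lf); have mi := L2r_meas (inL2_im lf).
have xs (x : R) : 0 <= x ^+ (2 * s) by rewrite exprM exprn_ge0// sqr_ge0.
pose N x := re f x * re f x + im f x * im f x.
have N0 x : 0 <= N x by rewrite addr_ge0// -expr2 sqr_ge0.
have mN : measurable_fun setT N by apply: measurable_funD; exact: measurable_funM.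
have mq : measurable_fun setT (fun x : R => 1 + 1 * (x * x)).
  by apply: continuous_measurable_fun => x; exact: quad_continuous.
pose d_ n : R := n.+1%:R^-1.
have d01 n : 0 < d_ n <= 1 by rewrite invr_gt0 ltr0n/= invf_le1 ?ltr0n// ler1n.
have [||x|n x|n|I IQ] := @Rfatou R (fun n x => wt (d_ n) x ^+ s * N x)
    (fun x => (1 + 1 * (x * x)) ^+ s * N x) Q.
- move=> n; apply: measurable_funM => //.
  exact: weight_meas (wt_AC (d01 n)) _.
- by apply: measurable_funM => //; exact: measurable_funX.
- apply: cvgM; last exact: cvg_cst.
  suff X : (fun n => wt (d_ n) x) @ \oo --> (1 + 1 * (x * x)).
    exact: (cvg_comp _ _ X (@exprn_continuous R s _)).
  rewrite /wt -[X in _ --> X]divr1; apply: cvgM; first exact: cvg_cst.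
  apply: cvgV; first exact: oner_neq0.
  rewrite -[X in _ --> X]addr0; apply: cvgD; first exact: cvg_cst.
  rewrite -[X in _ --> X](mul0r (x * x)); apply: cvgM; last exact: cvg_cst.
  exact: cvg_harmonic.
- by rewrite mulr_ge0// exprn_ge0// (le_trans ler01)// wt_ge1.
- have W (u : R -> R) : L2r u -> mu.-integrable setT (EFin \o (fun x => wt (d_ n) x ^+ s * (u x * u x))).
    by move=> lu; exact: (weight_itg (wt_AC (d01 n)) (wt_ge1 (d01 n)) (wt_le (d01 n)) s lu lu).
  have i1 := W _ (inL2_re lf); have i2 := W _ (inL2_im lf).
  have E : (fun x => wt (d_ n) x ^+ s * N x) = (fun x => wt (d_ n) x ^+ s * (re f x * re f x) +
     wt (d_ n) x ^+ s * (im f x * im f x)) by apply/funext => x; rewrite mulrDr.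
  rewrite E; split; first exact: itgD.
  by rewrite RintegralD//; exact: H.
have le x : x ^+ (2 * s) * Normc.normc (f x) ^+ 2 <= (1 + 1 * (x * x)) ^+ s * N x.
  have -> : Normc.normc (f x) ^+ 2 = N x by rewrite normc_sqr !expr2.
  have xx : 0 <= x * x by rewrite -expr2 sqr_ge0.
  by rewrite ler_wpM2r// exprM expr2 lerXn2r ?nnegrE ?mul1r ?addr_ge0// lerDr.
have I' : mu.-integrable setT (EFin \o (fun x => x ^+ (2 * s) * Normc.normc (f x) ^+ 2)).
  apply: itg_le I => //; last by move=> x _; rewrite ger0_norm// mulr_ge0// sqr_ge0.
  under eq_fun do rewrite normc_sqr.
  apply: measurable_funM; first exact: measurable_funX.
  by apply: measurable_funD; exact: measurable_funX.
rewrite (fineK_itg measurableT I') lee_fin; apply: le_trans IQ.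
by apply: le_Rintegral.
Qed.

(** A point where the bound fails would have a whole ball of such points, of positive measure. *)
Lemma continuous_ae_bound (V : R -> R) (K : R) : continuous V ->
  (\forall x \ae mu, `|V x| <= K) -> forall x, `|V x| <= K.
Proof.
move=> cV [A [mA A0 sub]] x; rewrite leNgt; apply/negP => Kx.
have : \forall y \near x, K < `|V y|.
  have cn : (fun y => `|V y|) @ x --> `|V x| by apply: cvg_norm; exact: cV.
  exact: (cvgr_gt _ cn _ Kx).
move=> /nbhs_ballP[e/= e0 be].
have : (mu (ball x e) <= mu A)%E.
  apply: le_measure; rewrite ?inE//; first exact: measurable_ball.
  by move=> y /be Ky; apply: sub => /=; rewrite leNgt Ky.
rewrite A0 lebesgue_measure_ball ?(ltW e0)// lee_fin leNgt => /negP; apply.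
by rewrite mulrn_wgt0.
Qed.

Lemma Linfty_continuous_bounded (V : R -> R) : continuous V -> V \in Lfun mu +oo%E ->
  exists K, forall x, `|V x| <= K.
Proof.
move=> cV /sub_Lfun_finLfun; rewrite inE/= /finite_norm unlock.
(* Positivity of the total measure selects the essential supremum in the definition of the norm. *)
have -> : (0 < mu [set: R])%E.
  apply: (@lt_le_trans _ _ (mu (ball (0 : R) 1))).
    by rewrite lebesgue_measure_ball// lte_fin mulrn_wgt0.
  by apply: le_measure; rewrite ?inE//; exact: measurable_ball.
move=> fin; have [K HK] : exists K, \forall x \ae mu, `|V x| <= K.
  exact: (@ess_supr_bounded _ _ _ mu (fun x => `|V x|)).
by exists K; exact: continuous_ae_bound.
Qed.

Lemma uniform_bound n (g : nat -> R -> R) :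
  (forall j, (j <= n)%N -> exists K, forall x, `|g j x| <= K) ->
  exists K, forall j, (j <= n)%N -> forall x, `|g j x| <= K.
Proof.
elim: n => [|n IH] H.
  by have [K HK] := H 0%N isT; exists K => -[].
have [K1 H1] := IH (fun j jn => H j (leqW jn)); have [K2 H2] := H n.+1 (leqnn _).
exists (Num.max K1 K2) => j; rewrite leq_eqVlt => /orP[/eqP ->|jn] x; rewrite le_max.
  by rewrite H2 orbT.
by rewrite H1.
Qed.

Lemma tau_sqr_le t : tau t ^+ 2 <= 2 * (1 + t ^+ 2).
Proof.
rewrite /tau -(real_normK (num_real t)); have := sqr_ge0 (1 - `|t|); rewrite !expr2; lra.
Qed.

End Moments.

(** * Assembling the Sobolev and moment bounds *)

Theorem theorem1p1 (R : realType) (s : nat) (hs : (1 <= s)%N) (V : R -> R)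
  (V_bounded : V \in Lfun (@lebesgue_measure R) +oo%E)
  (V_derivable : forall j : nat, (j < s)%N ->
     forall x : R, derivable (derive1n j V) x 1)
  (V_decay : forall j : nat, (1 <= j <= s)%N ->
     exists2 C : R, 0 < C &
       forall x : R, `|derive1n j V x| <= C * (1 + `|x|)^-1)
  (V_nonneg : schrodinger_nonpos V)
  (U : R -> (R -> R[i]) -> (R -> R[i]))
  (U_group : generated_by_schrodinger V U)
  (f : R -> R[i]) (f_Sigma : inSigma s f) :
  exists2 C : R, 0 < C &
    forall t : R,
      inSigma s (U t f) /\
      (Sigma_norm2 s (U t f) <= (C * japanese_bracket t ^+ (2 * s))%:E)%E.
Proof.
have cV j : (j < s)%N -> continuous (derive1n j V).
  by move=> js x; apply/differentiable_continuous/derivable1_diffP; exact: V_derivable.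
have [K HK] : exists K, forall j, (j <= s)%N -> forall x, `|derive1n j V x| <= K.
  (* Order 0 comes from the essential bound and continuity, higher orders from the decay, as
     $(1+|x|)^{-1} \le 1$. *)
  apply: uniform_bound => -[|j] js; first by apply: Linfty_continuous_bounded => //; exact: (cV 0%N).
  have [C C0 HC] := V_decay j.+1 js; exists C => x; apply: (le_trans (HC x)).
  by rewrite ler_piMr ?(ltW C0)// invf_le1 ?ltr_pwDl// lerDl.
have mVd j : (j < s)%N -> measurable_fun setT (derive1n j V).
  by move=> js; exact: continuous_measurable_fun (cV j js).
have mV : measurable_fun setT V by exact: (mVd 0%N).
have VK := HK 0%N (leq0n s).
have [[lf hf] fin] := f_Sigma; have [a0 [b0 [B0 h0]]] := inH_HC (conj lf hf).
have fin2 : (\int[lebesgue_measure]_x (x ^+ (2 * s) * Normc.normc (f x) ^+ 2)%:E < +oo)%E.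
  apply: le_lt_trans fin; rewrite leeDr// /Hnorm2 sume_ge0// => n _.
  by apply: integral_ge0 => x _; rewrite lee_fin sqr_ge0.
(* Each application of the generator restores two derivatives, so [s.-2] derivatives of the
   potential are enough; the truncated value 0 covers [s = 1]. *)
have rs i : (i <= s.-2)%N -> (i < s)%N.
  by move=> /leq_ltn_trans; apply; case: (s) hs => [|[|n]].
have ss : (s <= s.-2.+2)%N by case: (s) => [|[|n]].
have [B HB] := @flow_HC R V K mV VK U U_group (fun j => derive1n j V) s.-2 erefl
  (fun i ir => conj (mVd i (rs i ir)) (HK i (ltnW (rs i ir))))
  (fun i ir => C1_AC (V_derivable i (rs i (ltnW ir))) (cV i.+1 (rs _ ir)))
  s ss f a0 b0 B0 lf h0.
have [a Ha] := choice HB; have [b hab] := choice Ha.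
have [C0 C00 init] := wmass_wt_le lf fin2.
have [C HW] := wmass_growth mV VK U_group lf (conj lf hf) C00 hab init.
have B0' : 0 <= B by have [ha _ _ _] := hab 0; exact: Hs_ge0 ha.
(* The $s+1$ derivatives cost $2B$ each, $2^s$ comes from $(1+|t|)^2 \le 2\langle t\rangle^2$, and
   the final 1 makes the constant positive. *)
exists (s.+1%:R * (2 * B) + `|C| * 2 ^+ s + 1).
  by rewrite ltr_wpDl// addr_ge0 ?mulr_ge0 ?exprn_ge0.
move=> t; have lU := U_L2 U_group t lf; have hU := HC_inH lU (hab t).
suff le : (Sigma_norm2 s (U t f) <=
    ((s.+1%:R * (2 * B) + `|C| * 2 ^+ s + 1) * japanese_bracket t ^+ (2 * s))%:E)%E.
  by split=> //; split=> //; apply: le_lt_trans le _; rewrite ltry.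
have [hA hB _ _] := hab t.
have H1 : (Hnorm2 s (U t f) <= (s.+1%:R * (2 * B))%:E)%E.
  rewrite /Hnorm2 (@le_trans _ _ (\sum_(n < s.+1) (2 * B)%:E)%E)//.
    apply: lee_sum => n _; have ns : (n <= s)%N by rewrite -ltnS.
    rewrite (L2norm2_weak lU (hab t) ns) lee_fin.
    by have := Hs_n2 hA ns; have := Hs_n2 hB ns; lra.
  by rewrite sumEFin lee_fin sumr_const card_ord [s.+1%:R * _]mulr_natl.
have H2 := moment_le lU (fun d d01 => HW d t d01).
apply: (le_trans (leeD H1 H2)); rewrite -EFinD lee_fin.
have J1 : 1 <= japanese_bracket t ^+ (2 * s).
  by rewrite exprM sqr_sqrtr ?addr_ge0 ?sqr_ge0// exprn_ege1// lerDl sqr_ge0.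
have J2 : (tau t ^+ 2) ^+ s <= 2 ^+ s * japanese_bracket t ^+ (2 * s).
  rewrite exprM sqr_sqrtr ?addr_ge0 ?sqr_ge0// -exprMn.
  by rewrite lerXn2r ?nnegrE ?sqr_ge0 ?mulr_ge0 ?addr_ge0 ?sqr_ge0// tau_sqr_le.
have T0 : 0 <= (tau t ^+ 2) ^+ s by rewrite exprn_ge0// sqr_ge0.
set J := japanese_bracket t ^+ _ in J1 J2 *; have J0 : 0 <= J := le_trans ler01 J1.
have h1 : C * (tau t ^+ 2) ^+ s <= `|C| * (2 ^+ s * J).
  apply: (@le_trans _ _ (`|C| * (tau t ^+ 2) ^+ s)); first by rewrite ler_wpM2r// ler_norm.
  by rewrite ler_wpM2l.
have h2 : s.+1%:R * (2 * B) <= s.+1%:R * (2 * B) * J by rewrite ler_peMr// !mulr_ge0.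
have -> : (s.+1%:R * (2 * B) + `|C| * 2 ^+ s + 1) * J =
   s.+1%:R * (2 * B) * J + `|C| * (2 ^+ s * J) + J by ring.
lra.
Qed.
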